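(* Let $n\ge 1$ and let $\varphi:\mathbb{C}^n\to\mathbb{C}^n$ be a holomorphic mapping such that the composition operator $C_\varphi$ is bounded on the Fock space $\mathcal{F}^2(\mathbb{C}^n)$. Then $C_\varphi$ is essentially normal if and only if $C_\varphi$ is either compact or normal.
   Context: On $\mathbb{C}^n$ use the inner product $\langle z,w\rangle=\sum_{j=1}^n z_j\overline{w_j}$ and norm $|z|=\sqrt{\langle z,z\rangle}$. The Fock space $\mathcal{F}^2(\mathbb{C}^n)$ is the Hilbert space of all holomorphic functions $f:\mathbb{C}^n\to\mathbb{C}$ with $\|f\|^2=\left(\frac{1}{2\pi}\right)^n\int_{\mathbb{C}^n}|f(z)|^2e^{-|z|^2/2}\,dv(z)<\infty$, where $dv$ is Lebesgue volume measure on $\mathbb{C}^n$. The composition operator is $C_\varphi f=f\circ\varphi$; it is called bounded if it maps $\mathcal{F}^2(\mathbb{C}^n)$ into itself and is a bounded linear operator there. $C_\varphi$ is normal if $C_\varphi^*C_\varphi=C_\varphi C_\varphi^*$, and essentially normal if the commutator $[C_\varphi^*,C_\varphi]=C_\varphi^*C_\varphi-C_\varphi C_\varphi^*$ is compact. *)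

(* Defs.v *)
From HB Require Import structures.
From mathcomp Require Import all_boot all_order all_algebra.
From mathcomp Require Import all_classical all_reals all_analysis.
From mathcomp Require Import complex.

Set Implicit Arguments.
Unset Strict Implicit.
Unset Printing Implicit Defensive.

Import Order.TTheory GRing.Theory Num.Theory.
Import numFieldNormedType.Exports.

Local Open Scope classical_set_scope.
Local Open Scope ring_scope.
Local Open Scope complex_scope.

(* real-closed gives R[i] no topology; it is made a normed space over itself,
   so that [differentiable] below means complex differentiability. *)
#[non_forgetful_inheritance]
HB.instance Definition _ (R : rcfType) := PseudoPointedMetric.copy R[i] R[i]^o.
#[non_forgetful_inheritance]
HB.instance Definition _ (R : rcfType) := Vector.copy R[i] R[i]^o.
#[non_forgetful_inheritance]
HB.instance Definition _ (R : rcfType) := NormedModule.copy R[i] R[i]^o.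

Section tuple_measure.
Local Open Scope ereal_scope.
Context d (T : measurableType d) (R : realType).
Variable mu : {sigma_finite_measure set T -> \bar R}.

Definition tuple_cons m (x : T * m.-tuple T) : m.+1.-tuple T :=
  [tuple of x.1 :: x.2].

Lemma measurable_tuple_cons m :
  measurable_fun [set: T * m.-tuple T] (@tuple_cons m).
Proof. exact: measurable_cons. Qed.

Section step.
Variables (m : nat) (nu : {sigma_finite_measure set (m.-tuple T) -> \bar R}).

Definition cons_measure : set (m.+1.-tuple T) -> \bar R :=
  pushforward (mu \x nu) (@tuple_cons m).

Let cons_measure0 : cons_measure set0 = 0.
Proof. by rewrite /cons_measure /pushforward preimage_set0 measure0. Qed.

Let cons_measure_ge0 A : 0 <= cons_measure A.
Proof. by rewrite /cons_measure /pushforward; exact: measure_ge0. Qed.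

Let mpre (A : set (m.+1.-tuple T)) :
  measurable A -> measurable (@tuple_cons m @^-1` A).
Proof.
by move=> mA; rewrite -[X in measurable X]setTI; exact: measurable_tuple_cons.
Qed.

Let cons_measure_sigma_additive : semi_sigma_additive cons_measure.
Proof.
move=> F mF tF mUF; rewrite /cons_measure /pushforward preimage_bigcup.
apply: measure_semi_sigma_additive.
- by move=> n; exact: mpre.
- apply/trivIsetP => /= i j _ _ ij; rewrite -preimage_setI.
  by move/trivIsetP : tF => /(_ _ _ _ _ ij) ->//; rewrite preimage_set0.
- by rewrite -preimage_bigcup; exact: mpre.
Qed.

HB.instance Definition _ := isMeasure.Build _ _ _ cons_measure
  cons_measure0 cons_measure_ge0 cons_measure_sigma_additive.

Let cons_measure_sigma_finite : sigma_finite setT cons_measure.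
Proof.
have /sigma_finiteP[F [FT Fnd Foo]] := sigma_finiteT mu.
have /sigma_finiteP[G [GT Gnd Goo]] := sigma_finiteT nu.
exists (fun k => [set t | F k (thead t) /\ G k [tuple of behead t]]).
  apply/seteqP; split=> // t _.
  have [i _ Fi] : (\bigcup_k F k) (thead t) by rewrite -FT.
  have [j _ Gj] : (\bigcup_k G k) [tuple of behead t] by rewrite -GT.
  exists (maxn i j) => //; split.
  - by move: Fi; exact/subsetPset/Fnd/leq_maxl.
  - by move: Gj; exact/subsetPset/Gnd/leq_maxr.
move=> k; have [mF Fk] := Foo k; have [mG Gk] := Goo k; split.
  apply: measurableI.
    by rewrite -[X in measurable X]setTI; exact: (measurable_tnth ord0).
  by rewrite -[X in measurable X]setTI; exact: measurable_behead.
rewrite /cons_measure /pushforward [X in (_ \x _) X](_ : _ = F k `*` G k).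
  by rewrite product_measure1E// lte_mul_pinfty// ge0_fin_numE.
have beheadK x t : [tuple of behead (@tuple_cons m (x, t))] = t.
  exact/val_inj.
by apply/seteqP; split=> -[x t] /=; rewrite beheadK.
Qed.

HB.instance Definition _ := Measure_isSigmaFinite.Build _ _ _ cons_measure
  cons_measure_sigma_finite.

End step.

Fixpoint tuple_measure m : {sigma_finite_measure set (m.-tuple T) -> \bar R} :=
  match m with
  | 0 => dirac [tuple]
  | m'.+1 => cons_measure (tuple_measure m')
  end.

End tuple_measure.

Section fock.
Context (R : realType) (n : nat).
Local Notation C := R[i].
Local Notation Cn := 'rV[C]_n.
Local Notation normc := ComplexField.Normc.normc.

Definition holomorphic (W : normedModType C) (h : Cn -> W) :=
  forall z, differentiable h z.

Definition cvec_of_reals (t : (n + n).-tuple (measurableTypeR R)) : Cn :=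
  \row_j (tnth t (lshift n j) +i* tnth t (rshift n j)).

(* C^n is identified with R^(2n) by [cvec_of_reals]: an integral over C^n is the
   integral over R^(2n) of the composite with [cvec_of_reals]. *)
Definition volume := tuple_measure (@lebesgue_measure R) (n + n).

Definition sqnorm (z : Cn) : R := \sum_j normc (z ord0 j) ^+ 2.

Definition gauss_weight (z : Cn) : R := expR (- sqnorm z / 2).

Definition fock_sqnorm (f : Cn -> C) : \bar R :=
  (((2 * pi)^-1 ^+ n)%:E *
   \int[volume]_t (normc (f (cvec_of_reals t)) ^+ 2 *
                   gauss_weight (cvec_of_reals t))%:E)%E.

Definition fock (f : Cn -> C) := holomorphic f /\ (fock_sqnorm f < +oo)%E.

Definition fock_norm (f : Cn -> C) : R := Num.sqrt (fine (fock_sqnorm f)).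

Definition fock_dot (f g : Cn -> C) : C :=
  let h t := f (cvec_of_reals t) * (g (cvec_of_reals t))^* in
  let w t := gauss_weight (cvec_of_reals t) in
  ((2 * pi)^-1 ^+ n)%:C *
  ((\int[volume]_t (complex.Re (h t) * w t))%R +i*
   (\int[volume]_t (complex.Im (h t) * w t))%R).

(* Operators on the Fock space are given by maps on all functions C^n -> C, of
   which only the restriction to the Fock space matters. *)
Definition linear_operator (T : (Cn -> C) -> (Cn -> C)) :=
  (forall f, fock f -> fock (T f)) /\
  (forall (a : C) f g, fock f -> fock g -> T (a *: f + g) = a *: T f + T g).

Definition bounded_operator (T : (Cn -> C) -> (Cn -> C)) :=
  linear_operator T /\
  exists M : R, forall f, fock f -> fock_norm (T f) <= M * fock_norm f.

(* Every norm-bounded sequence has a subsequence whose image converges. *)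
Definition compact_operator (T : (Cn -> C) -> (Cn -> C)) :=
  linear_operator T /\
  forall u : nat -> Cn -> C,
    (forall k, fock (u k)) ->
    (exists M : R, forall k, fock_norm (u k) <= M) ->
    exists s : nat -> nat, {homo s : i j / (i < j)%N} /\
      exists2 g, fock g & fock_norm (T (u (s k)) - g) @[k --> \oo] --> (0 : R).

Definition adjoint_of (T S : (Cn -> C) -> (Cn -> C)) :=
  bounded_operator S /\
  forall f g, fock f -> fock g -> fock_dot (T f) g = fock_dot f (S g).

(* By the Riesz representation theorem a bounded operator has an adjoint, and it
   is unique on the Fock space, so [exists2 S, adjoint_of T S & ..] below reads
   as a statement about T^*. *)
Definition normal_operator (T : (Cn -> C) -> (Cn -> C)) :=
  exists2 S, adjoint_of T S & forall f, fock f -> S (T f) = T (S f).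

Definition essentially_normal (T : (Cn -> C) -> (Cn -> C)) :=
  exists2 S, adjoint_of T S & compact_operator (fun f => S (T f) - T (S f)).

Definition composition_operator (phi : Cn -> Cn) (f : Cn -> C) : Cn -> C :=
  f \o phi.

End fock.

(* Main.v *)
Require Import Defs.
From HB Require Import structures.
From mathcomp Require Import all_boot all_order all_algebra.
From mathcomp Require Import all_classical all_reals all_analysis.
From mathcomp Require Import measurable_realfun complex ring lra.
Set Implicit Arguments. Unset Strict Implicit. Unset Printing Implicit Defensive.
Import Order.TTheory GRing.Theory Num.Theory.
Import numFieldNormedType.Exports.
Local Open Scope classical_set_scope.
Local Open Scope ring_scope.

(** Let K_w(z) = exp(<z,w>/2), let T be the composition operator of phi and T'
    its adjoint.  The symbol of a bounded T is affine, and whether T falls under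
    compact or under normal depends on whether its linear part preserves the
    norm of some nonzero vector.

    Evaluating T K_(phi w) at w gives |phi w|^2 <= |w|^2 + c
    ([composition_growth]).  The argument of Liouville then yields
    phi z = z A + b ([composition_affine]), where A is a contraction
    ([growth_contraction]) and <z A, b> = 0 whenever |z A| = |z|
    ([growth_orthogonal]).

    If |z A| < |z| for all z <> 0, then |z A|^2 <= k |z|^2 with k < 1
    ([strict_contraction]), and T is compact ([composition_compact]): a bounded
    sequence has a pointwise convergent subsequence ([fock_montel]), and the
    bound |f(phi z)| <= ||f|| exp(|phi z|^2/4) dominates its image by a function
    that is square integrable for the Gaussian weight.

    Otherwise |x A| = |x| for some x <> 0.  Both T and T' map kernels to
    multiples of kernels: with A' the conjugate transpose of A,
    T K_w = exp(<b,w>/2) K_(w A') and T' K_w = K_(phi w).  For the commutator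
    D = T' T - T T' and the normalized kernel k_w this gives
      <D k_w, k_w> = exp(Re <b,w> + |w A'|^2/2 - |w|^2/2)
                     - exp(|phi w|^2/2 - |w|^2/2).
    Normalized kernels tend weakly to zero as |w| grows, so when D is compact
    this difference takes arbitrarily small values along w = m x + y, m -> oo
    ([commutator_frequently_small]).  On that sequence the second exponent is
    constant, and the first one is a quadratic polynomial in m.  Taking y = 0
    gives |x A'| = |x| and b = 0 ([isometric_direction_adjmx]); the first
    exponent is then constant as well and an arbitrary y gives |y A| = |y A'|
    ([isometric_direction_normal]).  So A is normal, and T f(z) = f(z A)
    commutes with T' f(z) = f(z A') ([isometric_direction_normal_operator]).

    Conversely the commutator of a normal operator vanishes on the space, and
    T' T and T T' are compact when T is ([compact_essentially_normal]).

    The theory of the space rests on the reproducing formula f(w) = <f, K_w>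
    ([fock_dot_kernel]).  It comes from Cauchy's theorem on rectangles
    ([goursat]), which gives the mean value property on circles
    ([circle_mean]), from the invariance of the Gaussian under
    multiplication by unimodular scalars, which turns this into
    the mean value property for the Gaussian ([gaussian_mean]), and from a
    translation.  A bounded sequence of the space that converges pointwise
    converges within the space ([fock_limit]); this gives completeness, and
    with it the adjoint ([bounded_adjoint]). *)

(** * Shears preserve the product Lebesgue measure *)

Section shear.
Context (R : realType).
Local Notation mu := (@lebesgue_measure R).
Local Notation mR := (measurableTypeR R).
Local Open Scope ereal_scope.

Lemma measurable_addr (a : R) : measurable_fun [set: mR] (fun x : mR => (x + a)%R : mR).
Proof. exact: measurable_funD. Qed.

Lemma lebesgue_translation (a : R) (A : set mR) : measurable A ->
  mu ((fun x : mR => (x + a)%R : mR) @^-1` A) = mu A.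
Proof.
move=> mA.
pose f : {mfun mR >-> mR} := HB.pack (fun x : mR => (x + a)%R : mR)
  (isMeasurableFun.Build _ _ _ _ _ (measurable_addr a)).
rewrite -[LHS]/(pushforward mu f A).
apply/esym; apply: lebesgue_measure_unique => // X [[c d] /= _ <-].
rewrite /pushforward /=.
rewrite [X in _ = mu X](_ : _ = [set` `](c - a)%R, (d - a)%R]]); last first.
  by apply/seteqP; split=> x /=; rewrite !in_itv/= ltrBlDr lerBrDr.
rewrite !lebesgue_measure_itv/= !lte_fin.
have -> : (c - a < d - a)%R = (c < d)%R by rewrite ltrD2r.
by case: ifP => // _; rewrite -!EFinB; congr (_%:E); lra.
Qed.

Lemma ge0_integral_translation (a : R) (F : mR -> \bar R) :
  measurable_fun setT F -> (forall x, 0 <= F x) ->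
  \int[mu]_x F (x + a)%R = \int[mu]_x F x.
Proof.
move=> mF F0.
have := @ge0_integral_pushforward _ _ _ _ R _ (measurable_addr a) mu setT F measurableT mF (fun x _ => F0 x).
rewrite preimage_setT => <-.
apply: eq_measure_integral => [|mf A mA _]; first exact: measurable_addr.
exact: lebesgue_translation.
Qed.

Local Notation V m := (tuple_measure mu m).

(** Unfolds the recursive definition of the product measure, so that the
    Tonelli theorem applies to one coordinate at a time. *)
Lemma ge0_integral_tuple_measureS m (F : m.+1.-tuple mR -> \bar R) :
  measurable_fun setT F -> (forall x, 0 <= F x) ->
  \int[V m.+1]_t F t = \int[mu \x V m]_p F (tuple_cons p).
Proof.
move=> mF F0.
have := @ge0_integral_pushforward _ _ _ _ R _ (@measurable_tuple_cons _ mR m) (mu \x V m) setT F measurableT mF (fun x _ => F0 x).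
by rewrite preimage_setT.
Qed.
Definition shear m (h : 'I_m -> m.-tuple mR -> R) (t : m.-tuple mR) : m.-tuple mR :=
  [tuple (tnth t i + h i t)%R | i < m].

Lemma measurable_shear m (h : 'I_m -> m.-tuple mR -> R) :
  (forall i, measurable_fun setT (h i)) -> measurable_fun setT (shear h).
Proof.
move=> mh; apply/measurable_fun_tnthP => i.
rewrite (_ : _ \o _ = (fun t => tnth t i + h i t)%R); last first.
  by apply/funext => t; rewrite /= tnth_mktuple.
apply: measurable_funD; [exact: (@measurable_tnth _ mR)|exact: mh].
Qed.

Lemma tuple_cons_tnth0 m (x : mR) (t : m.-tuple mR) :
  tnth (tuple_cons (x, t)) ord0 = x.
Proof. by []. Qed.

Lemma tuple_cons_tnthS m (x : mR) (t : m.-tuple mR) i :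
  tnth (tuple_cons (x, t)) (lift ord0 i) = tnth t i.
Proof. exact: tnthS. Qed.

Lemma tuple_cons_eta m (t : m.+1.-tuple mR) :
  t = tuple_cons (tnth t ord0, [tuple tnth t (lift ord0 i) | i < m]).
Proof.
apply/eq_from_tnth => i; case: (unliftP ord0 i) => [j ->|->].
  by rewrite tuple_cons_tnthS tnth_mktuple.
by rewrite tuple_cons_tnth0.
Qed.

(** Coordinates in I move by an amount that depends only on the coordinates
    outside I, so a Tonelli argument over one coordinate at a time reduces the
    claim to the translation invariance of Lebesgue measure. The induction
    integrates the first coordinate innermost when it moves and outermost when
    it stays fixed. *)
Lemma ge0_integral_shear m (I : pred 'I_m) (h : 'I_m -> m.-tuple mR -> R)
    (F : m.-tuple mR -> \bar R) :
  (forall i, measurable_fun setT (h i)) ->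
  (forall i t, ~~ I i -> h i t = 0%R) ->
  (forall i t t', (forall j, ~~ I j -> tnth t j = tnth t' j) -> h i t = h i t') ->
  measurable_fun setT F -> (forall t, 0 <= F t) ->
  \int[V m]_t F (shear h t) = \int[V m]_t F t.
Proof.
elim: m I h F => [|m IH] I h F mh h0 hI mF F0.
  by apply: eq_integral => t _; congr F; rewrite [LHS]tuple0 [RHS]tuple0.
have mFh : measurable_fun setT (F \o shear h).
  by apply: measurableT_comp => //; exact: measurable_shear.
apply: etrans (ge0_integral_tuple_measureS mFh _) _; first by move=> t /=.
apply: etrans (esym (ge0_integral_tuple_measureS mF F0)).
have mc : measurable_fun setT (@tuple_cons _ mR m).
  exact: measurable_tuple_cons.
have mcx x : measurable_fun setT (fun t : m.-tuple mR => tuple_cons (x, t)).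
  by apply: (measurableT_comp mc); exact: pair1_measurable.
have mcy t : measurable_fun setT (fun x : mR => tuple_cons (x, t : m.-tuple mR)).
  by apply: (measurableT_comp mc); exact: pair2_measurable.
have mhx x i : measurable_fun setT (fun t => h (lift ord0 i) (tuple_cons (x, t))).
  by apply: (measurableT_comp (mh _)); exact: mcx.
have shE x t : shear h (tuple_cons (x, t)) =
    tuple_cons ((x + h ord0 (tuple_cons (x, t)))%R,
      shear (fun i s => h (lift ord0 i) (tuple_cons (x, s))) t).
  rewrite [LHS]tuple_cons_eta; congr tuple_cons; congr pair.
    by rewrite tnth_mktuple.
  apply/eq_from_tnth => i; rewrite !tnth_mktuple.
  by rewrite tuple_cons_tnthS.
have mFc : measurable_fun setT (F \o @tuple_cons _ mR m).
  exact: measurableT_comp.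
have mFhc : measurable_fun setT ((F \o shear h) \o @tuple_cons _ mR m).
  exact: measurableT_comp.
have F0c p : 0 <= (F \o @tuple_cons _ mR m) p by exact: F0.
have F0hc p : 0 <= ((F \o shear h) \o @tuple_cons _ mR m) p by exact: F0.
have [I0|nI0] := boolP (I ord0).
- rewrite (fubini_tonelli2 _ mFhc F0hc) (fubini_tonelli2 _ mFc F0c) /fubini_G.
  pose h' i s := h (lift ord0 i) (tuple_cons (0%R : mR, s)).
  have hE i x t : h i (tuple_cons (x, t)) = h i (tuple_cons (0%R : mR, t)).
    apply: hI => j; case: (unliftP ord0 j) => [k ->|->]; last by rewrite I0.
    by rewrite !tuple_cons_tnthS.
  pose G t := \int[mu]_x F (tuple_cons (x, t)).
  transitivity (\int[V m]_t G (shear h' t)).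
    apply: eq_integral => t _; rewrite /G /=.
    rewrite -[RHS](@ge0_integral_translation (h ord0 (tuple_cons (0%R : mR, t)))); last 2 first.
    - exact: (measurableT_comp mF (mcy _)).
    - by move=> x.
    apply: eq_integral => x _; rewrite shE hE; congr (F (tuple_cons (_, _))).
    by apply/eq_from_tnth => i; rewrite !tnth_mktuple hE.
  apply: (IH (fun i => I (lift ord0 i)) h').
  - by move=> i; exact: mhx.
  - by move=> i t Ii; rewrite /h' h0.
  - move=> i t t' tt'; apply: hI => j; case: (unliftP ord0 j) => [k ->|->].
      by rewrite !tuple_cons_tnthS; exact: tt'.
    by rewrite I0.
  - exact: (measurable_fun_fubini_tonelli_G (F \o @tuple_cons _ mR m) mFc F0c).
  - by move=> t; apply: integral_ge0 => x _; exact: F0.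
- rewrite (fubini_tonelli1 _ mFhc F0hc) (fubini_tonelli1 _ mFc F0c) /fubini_F.
  apply: eq_integral => x _ /=.
  rewrite -[RHS](IH (fun i => I (lift ord0 i))
    (fun i s => h (lift ord0 i) (tuple_cons (x, s))))//.
  + by apply: eq_integral => t _; rewrite shE h0// addr0.
  + by move=> i t Ii; rewrite h0.
  + move=> i t t' tt'; apply: hI => j; case: (unliftP ord0 j) => [k ->|-> _//].
    by rewrite !tuple_cons_tnthS; exact: tt'.
  + exact: measurableT_comp.
Qed.

Lemma ge0_integral_tuple_prod m (f : R -> R) :
  measurable_fun setT f -> (forall x, (0 <= f x)%R) ->
  \int[V m]_t (\prod_(i < m) f (tnth t i))%:E =
  (\int[mu]_x (f x)%:E) ^+ m.
Proof.
move=> mf f0; elim: m => [|m IH].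
  rewrite expe0 (eq_integral (cst 1)) => [|t _]; last by rewrite big_ord0.
  by rewrite integral_cst// mul1e /= diracT.
have mp k : measurable_fun setT (fun t : k.-tuple mR => (\prod_(i < k) f (tnth t i))%R).
  apply: measurable_prod => i _ /=; apply: (measurableT_comp mf).
  exact: (@measurable_tnth _ mR).
have p0 k (t : k.-tuple mR) : (0 <= \prod_(i < k) f (tnth t i))%R by apply: prodr_ge0.
rewrite ge0_integral_tuple_measureS; last 2 first.
- by apply/measurable_EFinP; exact: mp.
- by move=> t; rewrite lee_fin; exact: p0.
rewrite (fubini_tonelli1 ((fun t : m.+1.-tuple mR => (\prod_(i < m.+1) f (tnth t i))%:E) \o @tuple_cons _ mR m)) /fubini_F//; last 2 first.
- by apply: measurableT_comp; [apply/measurable_EFinP; exact: mp|exact: measurable_tuple_cons].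
- by move=> t; rewrite lee_fin; exact: p0.
transitivity (\int[mu]_x ((f x)%:E * (\int[mu]_x (f x)%:E) ^+ m)).
  apply: eq_integral => x _ /=; rewrite -IH.
  rewrite -ge0_integralZl//; last 3 first.
  - by apply/measurable_EFinP; exact: mp.
  - by move=> t _; rewrite lee_fin; exact: p0.
  - by rewrite lee_fin.
  apply: eq_integral => t _; rewrite big_ord_recl tuple_cons_tnth0 EFinM.
  by congr (_ * _%:E); apply: eq_bigr => i _; rewrite tuple_cons_tnthS.
rewrite ge0_integralZr//; last 3 first.
- exact/measurable_EFinP.
- by move=> x _; rewrite lee_fin.
- by apply: expe_ge0; apply: integral_ge0 => x _; rewrite lee_fin.
by rewrite expeS.
Qed.
End shear.

(** * Cauchy's theorem on rectangles *)

Section itg.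
Context (R : realType).
Local Notation mu := (@lebesgue_measure R).

(** The interval is given by its length, which is what bisection of rectangles
    halves. *)
Definition itg (f : R -> R) (a l : R) : R := \int[mu]_(x in `[a, a + l]) f x.

Lemma itg_integrable (f : R -> R) (a b : R) : continuous f ->
  mu.-integrable `[a, b] (EFin \o f).
Proof.
move=> cf; apply: continuous_compact_integrable; first exact: segment_compact.
exact: continuous_subspaceT.
Qed.

Lemma itgD (f : R -> R) (a k l : R) : continuous f -> 0 <= k -> 0 <= l ->
  itg f a (k + l) = itg f a k + itg f (a + k) l.
Proof.
move=> cf k0 l0; rewrite /itg.
rewrite -[LHS](subrK (\int[mu]_(x in `[a, a + k]) f x)) addrC; congr (_ + _).
rewrite Rintegral_itvB//=; last 3 first.
- exact: itg_integrable.
- by rewrite bnd_simp lerDl.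
- by rewrite bnd_simp addrA lerDl.
rewrite -addrA; apply: Rintegral_itv_obnd_cbnd.
apply: (integrableS _ _ _ (itg_integrable (a + k) (a + (k + l)) cf)) => //.
by apply: subset_itvr; rewrite bnd_simp.
Qed.

(** The mean value estimate with a general center m: in the proof of Cauchy's
    theorem the integrand is close to a nonzero constant. *)
Lemma itg_bound (f : R -> R) (a l m e : R) : continuous f -> 0 <= l ->
  (forall x, a <= x <= a + l -> `|f x - m| <= e) -> `|itg f a l - m * l| <= e * l.
Proof.
move=> cf l0 fm; rewrite /itg.
have mul : fine (mu `[a, a + l]) = l.
  rewrite lebesgue_measure_itv/= lte_fin.
  case: ifPn => [_|]; first by rewrite -EFinB/= addrAC subrr add0r.
  by rewrite -leNgt gerDl => l0'; apply/eqP; rewrite eq_le l0 l0'.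
have ic c : mu.-integrable `[a, a + l] (EFin \o (fun=> c)).
  by apply: itg_integrable => x; exact: cvg_cst.
have ifn := itg_integrable a (a + l) cf.
have -> : m * l = \int[mu]_(x in `[a, a + l]) m.
  by rewrite Rintegral_cst// mul.
have ifm : mu.-integrable `[a, a + l] (EFin \o (fun x => f x - m)).
  by apply: itg_integrable => x; apply: cvgB; [exact: cf|exact: cvg_cst].
rewrite -RintegralB//; apply: le_trans (le_normr_Rintegral _ ifm) _ => //.
have -> : e * l = \int[mu]_(x in `[a, a + l]) e.
  by rewrite Rintegral_cst// mul.
apply: le_Rintegral => //.
by apply: itg_integrable => x; apply: cvg_norm; apply: cvgB; [exact: cf|exact: cvg_cst].
Qed.

Lemma itgB (f g : R -> R) (a l : R) : continuous f -> continuous g ->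
  itg (fun x => f x - g x) a l = itg f a l - itg g a l.
Proof. by move=> cf cg; rewrite /itg RintegralB//; exact: itg_integrable. Qed.

End itg.

Section goursat.
Context (R : realType).
Implicit Types P Q : R -> R -> R.

(** Complex differentiability of P + iQ at s + iv with derivative al + i be,
    written for the real and imaginary parts so that only real integrals
    occur. *)
Definition cauchy_riemann_at P Q (s v : R) := exists al be : R,
  forall e : R, 0 < e -> exists2 d : R, 0 < d & forall x y : R, `|x| <= d -> `|y| <= d ->
    `|P (s + x) (v + y) - P s v - (al * x - be * y)| <= e * (`|x| + `|y|) /\
    `|Q (s + x) (v + y) - Q s v - (be * x + al * y)| <= e * (`|x| + `|y|).

Lemma cauchy_riemann_cont P Q s v : cauchy_riemann_at P Q s v ->
  forall e : R, 0 < e -> exists2 d : R, 0 < d & forall x y : R, `|x| <= d -> `|y| <= d ->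
    `|P (s + x) (v + y) - P s v| <= e /\ `|Q (s + x) (v + y) - Q s v| <= e.
Proof.
move=> [al [be H]] e e0; have [d d0 Hd] := H _ ltr01.
pose M := `|al| + `|be| + 1.
have M0 : 0 < M by rewrite /M ltr_wpDl// addr_ge0.
exists (Num.min d (e / (2 * M))) => [|x y].
  by rewrite lt_min d0 divr_gt0// mulr_gt0.
rewrite !le_min => /andP[xd xe] /andP[yd ye].
have [HP HQ] := Hd x y xd yd.
have xye : M * (`|x| + `|y|) <= e.
  have : `|x| + `|y| <= e / (2 * M) + e / (2 * M) by exact: lerD.
  have -> : e / (2 * M) + e / (2 * M) = e / M by field; rewrite gt_eqF.
  by rewrite ler_pdivlMr// mulrC.
have bnd (a b : R) : `|a * x + b * y| <= `|a| * `|x| + `|b| * `|y|.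
  by apply: le_trans (ler_normD _ _) _; rewrite !normrM.
have h (a b : R) : `|a| <= `|al| + `|be| -> `|b| <= `|al| + `|be| -> forall z,
    `|z - (a * x + b * y)| <= 1 * (`|x| + `|y|) -> `|z| <= e.
  move=> ha hb z Hz; apply: le_trans xye.
  have -> : z = (z - (a * x + b * y)) + (a * x + b * y) by rewrite subrK.
  apply: le_trans (ler_normD _ _) _.
  apply: le_trans (lerD Hz (bnd a b)) _.
  rewrite mul1r /M.
  have : `|a| * `|x| <= (`|al| + `|be|) * `|x| by apply: ler_wpM2r.
  have : `|b| * `|y| <= (`|al| + `|be|) * `|y| by apply: ler_wpM2r.
  move: (`|a| * _) (`|b| * _) => p q.
  rewrite !mulrDl !mulrDr !mul1r; lra.
split.
- apply: (h al (- be)); rewrite ?normrN ?lerDl ?lerDr// mulNr.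
  exact: HP.
- by apply: (h be al); rewrite ?lerDl ?lerDr.
Qed.

Lemma cauchy_riemann_continuous P Q :
  (forall s v, cauchy_riemann_at P Q s v) ->
  [/\ forall s, continuous (P s), forall v, continuous (fun s => P s v),
      forall s, continuous (Q s) & forall v, continuous (fun s => Q s v)].
Proof.
move=> H.
have key (F : R -> R) (s0 : R) : (forall e : R, 0 < e -> exists2 d : R, 0 < d &
    forall x : R, `|x| <= d -> `|F (s0 + x) - F s0| <= e) -> F x @[x --> s0] --> F s0.
  move=> HF; apply/cvgrPdist_le => e e0.
  have [d d0 Hd] := HF e e0.
  near=> x; rewrite distrC; have := Hd (x - s0).
  rewrite [s0 + _]addrC subrK; apply.
  rewrite distrC; near: x; exact: cvgr_dist_le.
split=> [s v|v s|s v|v s]; apply: key => e e0;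
  have [d d0 Hd] := cauchy_riemann_cont (H s v) e0; exists d => // x xd.
- by have [] := Hd 0 x; rewrite ?normr0 ?addr0//; exact: ltW.
- by have [] := Hd x 0; rewrite ?normr0 ?addr0//; exact: ltW.
- by have [] := Hd 0 x; rewrite ?normr0 ?addr0//; exact: ltW.
- by have [] := Hd x 0; rewrite ?normr0 ?addr0//; exact: ltW.
Unshelve. all: by end_near. Qed.

(** The imaginary part of the integral of (P + iQ)dz over the boundary of the
    rectangle with corner s + iv and side lengths a and b. *)
Definition rect_integral P Q (s v a b : R) : R :=
  itg (fun u => Q u v) s a - itg (fun u => Q u (v + b)) s a +
  (itg (P (s + a)) v b - itg (P s) v b).

(** Bisection: if the integral over the rectangle is nonzero, one of the four
    quarters carries at least a quarter of it, and so on down to a point.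
    There the function agrees with its first order expansion up to an error
    small with respect to the diameter, while the expansion integrates to
    zero. *)
Lemma goursat P Q : (forall s v, cauchy_riemann_at P Q s v) ->
  forall s v a b : R, 0 <= a -> 0 <= b -> rect_integral P Q s v a b = 0.
Proof.
move=> H s v a b a0 b0; have [cP1 cP2 cQ1 cQ2] := cauchy_riemann_continuous H.
pose I := rect_integral P Q.
pose ak k := a / 2 ^+ k; pose bk k := b / 2 ^+ k.
have ak0 k : 0 <= ak k by rewrite divr_ge0// exprn_ge0.
have bk0 k : 0 <= bk k by rewrite divr_ge0// exprn_ge0.
have akS k : ak k = ak k.+1 + ak k.+1.
  by rewrite /ak exprS; field; rewrite expf_neq0.
have bkS k : bk k = bk k.+1 + bk k.+1.
  by rewrite /bk exprS; field; rewrite expf_neq0.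
have quad k x y : I x y (ak k) (bk k) =
    I x y (ak k.+1) (bk k.+1) + I (x + ak k.+1) y (ak k.+1) (bk k.+1) +
    I x (y + bk k.+1) (ak k.+1) (bk k.+1) +
    I (x + ak k.+1) (y + bk k.+1) (ak k.+1) (bk k.+1).
  by rewrite /I /rect_integral akS bkS !itgD// !addrA; ring.
have step k (p : R * R) : exists q : R * R,
    [/\ p.1 <= q.1, q.1 + ak k.+1 <= p.1 + ak k, p.2 <= q.2,
        q.2 + bk k.+1 <= p.2 + bk k &
        `|I p.1 p.2 (ak k) (bk k)| <= 4 * `|I q.1 q.2 (ak k.+1) (bk k.+1)|].
  have := quad k p.1 p.2; have := akS k; have := bkS k.
  have := ak0 k.+1; have := bk0 k.+1.
  set A := ak k.+1; set B := bk k.+1.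
  set i0 := I p.1 p.2 (ak k) (bk k).
  set i1 := I p.1 p.2 A B; set i2 := I (p.1 + A) p.2 A B.
  set i3 := I p.1 (p.2 + B) A B; set i4 := I (p.1 + A) (p.2 + B) A B.
  move=> B0 A0 bE aE E.
  have [c1|c1] := leP `|i0| (4 * `|i1|).
    by exists p; split => //=; lra.
  have [c2|c2] := leP `|i0| (4 * `|i2|).
    by exists (p.1 + A, p.2); split => //=; lra.
  have [c3|c3] := leP `|i0| (4 * `|i3|).
    by exists (p.1, p.2 + B); split => //=; lra.
  exists (p.1 + A, p.2 + B); split => //=; try lra.
  have n1 := ler_normD (i1 + i2 + i3) i4.
  have n2 := ler_normD (i1 + i2) i3.
  have n3 := ler_normD i1 i2.
  rewrite -/i4 E; rewrite E in c1 c2 c3; lra.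
have [F HF] := choice (fun kp : nat * (R * R) => step kp.1 kp.2).
pose x := fix x k := if k is k'.+1 then F (k', x k') else (s, v).
have xS k : x k.+1 = F (k, x k) by [].
have Ik k : `|I s v a b| <= 4 ^+ k * `|I (x k).1 (x k).2 (ak k) (bk k)|.
  elim: k => [|k IH]; first by rewrite expr0 mul1r /ak /bk /= !expr0 !divr1.
  apply: le_trans IH _; rewrite exprSr -mulrA ler_wpM2l ?exprn_ge0// xS.
  by have [] := HF (k, x k).
have mono1 j k : (j <= k)%N -> (x j).1 <= (x k).1 /\ (x k).1 + ak k <= (x j).1 + ak j.
  elim: k => [|k IH]; first by rewrite leqn0 => /eqP ->.
  rewrite leq_eqVlt => /predU1P[->//|]; rewrite ltnS => /IH[h1 h2].
  by have /= [h3 h4 _ _ _] := HF (k, x k); rewrite -xS in h3 h4; split; lra.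
have mono2 j k : (j <= k)%N -> (x j).2 <= (x k).2 /\ (x k).2 + bk k <= (x j).2 + bk j.
  elim: k => [|k IH]; first by rewrite leqn0 => /eqP ->.
  rewrite leq_eqVlt => /predU1P[->//|]; rewrite ltnS => /IH[h1 h2].
  by have /= [_ _ h3 h4 _] := HF (k, x k); rewrite -xS in h3 h4; split; lra.
have nested (w : nat -> R) (c : nat -> R) : (forall k, 0 <= c k) ->
    (forall j k, (j <= k)%N -> w j <= w k /\ w k + c k <= w j + c j) ->
    exists z, forall k, w k <= z <= w k + c k.
  move=> c0 hw; exists (sup (range w)) => k.
  have ub j : w j <= w k + c k.
    have [jk|/ltnW kj] := leqP j k.
      by apply: le_trans (hw _ _ jk).1 _; rewrite lerDl.
    by apply: le_trans (hw _ _ kj).2; rewrite lerDl.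
  apply/andP; split.
    apply: ub_le_sup; last by exists k.
    by exists (w k + c k) => _ [j _ <-].
  apply: ge_sup; first by exists (w 0%N), 0%N.
  by move=> _ [j _ <-].
(* The nested rectangles shrink to the point sx + i vx. *)
have [sx Hsx] := nested (fun k => (x k).1) ak ak0 mono1.
have [vx Hvx] := nested (fun k => (x k).2) bk bk0 mono2.
apply/eqP; rewrite -normr_eq0; apply/eqP/le_anti; rewrite normr_ge0 andbT.
apply/ler_addgt0Pl => e e0; rewrite addr0.
have [al [be Hd]] := H sx vx.
pose S := (a + b) ^+ 2 + 1.
have S0 : 0 < S by rewrite ltr_wpDl// sqr_ge0.
have [d d0 {}Hd] := Hd (e / (2 * S)) (divr_gt0 e0 (mulr_gt0 (ltr0n _ 2) S0)).
have [k abk] : exists k, ak k + bk k <= d.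
  exists (Num.truncn ((a + b) / d)).
  rewrite /ak /bk -mulrDl ler_pdivrMr ?exprn_gt0// -ler_pdivrMl// mulrC.
  apply: le_trans (ltW (truncnS_gt _)) _.
  by rewrite -natrX ler_nat; exact: ltn_expl.
apply: le_trans (Ik k) _.
have := Hsx k; have := Hvx k.
move: (x k) => [p q] /=; rewrite /I /rect_integral.
have := ak0 k; have := bk0 k.
set A := ak k; set B := bk k => B0 A0 /andP[q1 q2] /andP[p1 p2].
(* Opposite sides are combined first, so that the affine part of the expansion
   leaves only constants to integrate: - al * B below and al * A on the
   sides, which cancel. *)
rewrite -itgB// -itgB//.
have E u w : p <= u <= p + A -> q <= w <= q + B ->
   `|P u w - P sx vx - (al * (u - sx) - be * (w - vx))| <= e / (2 * S) * (A + B) /\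
   `|Q u w - Q sx vx - (be * (u - sx) + al * (w - vx))| <= e / (2 * S) * (A + B).
  move=> /andP[u1 u2] /andP[w1 w2].
  have uA : `|u - sx| <= A by rewrite ler_norml; lra.
  have wB : `|w - vx| <= B by rewrite ler_norml; lra.
  have Ad : A <= d by apply: le_trans abk; rewrite lerDl.
  have Bd : B <= d by apply: le_trans abk; rewrite lerDr.
  have [hP hQ] := Hd (u - sx) (w - vx) (le_trans uA Ad) (le_trans wB Bd).
  rewrite !(addrC _ (_ - _)) !subrK in hP hQ.
  by split; [apply: le_trans hP _|apply: le_trans hQ _];
    apply: ler_wpM2l (lerD uA wB); rewrite divr_ge0 ?mulr_ge0// ltW.
set e' := e / (2 * S) * (A + B) in E.
have i1 := @itg_bound _ (fun u => Q u q - Q u (q + B)) p A (- al * B) (2 * e').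
have i2 := @itg_bound _ (fun w => P (p + A) w - P p w) q B (al * A) (2 * e').
have {}i1 : `|itg (fun u => Q u q - Q u (q + B)) p A - - al * B * A| <= 2 * e' * A.
  apply: i1 => // [|u pu]; first by move=> u; apply: cvgB; exact: cQ2.
  have [|_ h1] := E u q pu; first by rewrite lexx/=; lra.
  have [|_ h2] := E u (q + B) pu; first by rewrite lexx andbT; lra.
  move: h1 h2; rewrite !ler_norml => /andP[? ?] /andP[? ?]; lra.
have {}i2 : `|itg (fun w => P (p + A) w - P p w) q B - al * A * B| <= 2 * e' * B.
  apply: i2 => // [|w pw]; first by move=> w; apply: cvgB; exact: cP1.
  have [|h1 _] := E p w _ pw; first by rewrite lexx/=; lra.
  have [|h2 _] := E (p + A) w _ pw; first by rewrite lexx andbT; lra.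
  move: h1 h2; rewrite !ler_norml => /andP[? ?] /andP[? ?]; lra.
have tot : `|itg (fun u => Q u q - Q u (q + B)) p A +
    itg (fun w => P (p + A) w - P p w) q B| <= 2 * e' * (A + B).
  have -> : itg (fun u => Q u q - Q u (q + B)) p A +
    itg (fun w => P (p + A) w - P p w) q B =
    (itg (fun u => Q u q - Q u (q + B)) p A - - al * B * A) +
    (itg (fun w => P (p + A) w - P p w) q B - al * A * B) by ring.
  by rewrite mulrDr; apply: le_trans (ler_normD _ _) (lerD i1 i2).
apply: le_trans (ler_wpM2l (exprn_ge0 _ _) tot) _ => //.
have -> : 4 ^+ k * (2 * e' * (A + B)) = e * ((a + b) ^+ 2 / S).
  rewrite /e' /A /B /ak /bk; have -> : 4 ^+ k = (2 ^+ k) ^+ 2 :> R.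
    by rewrite expr2 -exprMn -natrM.
  by field; rewrite expf_neq0//= gt_eqF.
by rewrite ger_pMr// ler_pdivrMr// mul1r lerDl.
Qed.

End goursat.

Local Open Scope complex_scope.
Local Open Scope ring_scope.

Local Notation normc := (@ComplexField.Normc.normc _).
Local Notation Re := (@complex.Re _).
Local Notation Im := (@complex.Im _).

(** * Modulus, exponential and derivative in one complex variable *)

Section complex_numbers.
Context (R : realType).
Local Notation C := R[i].
Implicit Types (z w : C) (x y : R).

Lemma normc_sqr z : normc z ^+ 2 = Re z ^+ 2 + Im z ^+ 2.
Proof. by case: z => a b /=; rewrite sqr_sqrtr// addr_ge0// sqr_ge0. Qed.
Lemma normc_ge0 z : 0 <= normc z.
Proof. by case: z => a b /=; exact: sqrtr_ge0. Qed.
Lemma normcD z w : normc (z + w) <= normc z + normc w.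
Proof. exact: le_normcD. Qed.
Lemma normcM z w : normc (z * w) = normc z * normc w.
Proof. exact: ComplexField.Normc.normcM. Qed.
Lemma normcNE z : normc (- z) = normc z.
Proof. exact: normcN. Qed.
Lemma normcB z w : normc (z - w) = normc (w - z).
Proof. by rewrite -normcNE opprB. Qed.
Lemma normc0E : normc (0 : C) = 0.
Proof. exact: ComplexField.Normc.normc0. Qed.
Lemma normc1E : normc (1 : C) = 1.
Proof. exact: ComplexField.Normc.normc1. Qed.
Lemma normc_eq0 z : normc z = 0 -> z = 0.
Proof. exact: ComplexField.Normc.eq0_normc. Qed.
Lemma conjcE z : z^* = Re z -i* Im z. Proof. by case: z. Qed.
Lemma normc_conj z : normc z^* = normc z.
Proof. by rewrite conjcE; case: z => a b /=; rewrite sqrrN. Qed.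
Lemma normc_real x : normc x%:C = `|x|.
Proof. by rewrite /= expr0n addr0 sqrtr_sqr. Qed.
Lemma normc_norm z : `|z| = (normc z)%:C.
Proof. by []. Qed.
Lemma normc_le_ReIm z : normc z <= `|Re z| + `|Im z|.
Proof.
rewrite -(@ler_pXn2r _ 2) ?nnegrE ?normc_ge0 ?addr_ge0// normc_sqr sqrrD !real_normK ?num_real//.
by rewrite addrAC lerDl mulrn_wge0// mulr_ge0.
Qed.
Lemma Re_le_normc z : `|Re z| <= normc z.
Proof.
rewrite -(@ler_pXn2r _ 2) ?nnegrE ?normc_ge0// normc_sqr real_normK ?num_real//.
by rewrite lerDl sqr_ge0.
Qed.
Lemma Im_le_normc z : `|Im z| <= normc z.
Proof.
rewrite -(@ler_pXn2r _ 2) ?nnegrE ?normc_ge0// normc_sqr real_normK ?num_real//.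
by rewrite lerDr sqr_ge0.
Qed.
Lemma ReD z w : Re (z + w) = Re z + Re w. Proof. by case: z w => ? ? []. Qed.
Lemma ImD z w : Im (z + w) = Im z + Im w. Proof. by case: z w => ? ? []. Qed.
Lemma ReN z : Re (- z) = - Re z. Proof. by case: z. Qed.
Lemma ReB z w : Re (z - w) = Re z - Re w. Proof. by case: z w => ? ? []. Qed.
Lemma ImB z w : Im (z - w) = Im z - Im w. Proof. by case: z w => ? ? []. Qed.
Lemma ReM z w : Re (z * w) = Re z * Re w - Im z * Im w.
Proof. by case: z w => ? ? []. Qed.
Lemma ImM z w : Im (z * w) = Re z * Im w + Im z * Re w.
Proof. by case: z w => ? ? []. Qed.
Lemma ReJ z : Re z^* = Re z. Proof. by rewrite conjcE. Qed.
Lemma ImJ z : Im z^* = - Im z. Proof. by rewrite conjcE. Qed.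
Lemma Re_sum (I : Type) (r : seq I) (P : pred I) (F : I -> C) :
  Re (\sum_(i <- r | P i) F i) = \sum_(i <- r | P i) Re (F i).
Proof. by apply: (big_morph Re ReD). Qed.
Lemma Im_sum (I : Type) (r : seq I) (P : pred I) (F : I -> C) :
  Im (\sum_(i <- r | P i) F i) = \sum_(i <- r | P i) Im (F i).
Proof. by apply: (big_morph Im ImD). Qed.
Lemma normc_sum (I : Type) (r : seq I) (P : pred I) (F : I -> C) :
  normc (\sum_(i <- r | P i) F i) <= \sum_(i <- r | P i) normc (F i).
Proof.
elim/big_ind2 : _ => [|z a w b za wb|//]; first by rewrite normc0E.
exact: le_trans (normcD _ _) (lerD za wb).
Qed.
Lemma eq_ReIm z w : Re z = Re w -> Im z = Im w -> z = w.
Proof. by case: z w => ? ? [? ?] /= -> ->. Qed.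
Lemma mulcJ z : z * z^* = (normc z ^+ 2)%:C.
Proof.
by apply: eq_ReIm; rewrite ?ReM ?ImM ReJ ImJ normc_sqr /=; ring.
Qed.
Lemma realcM x y : (x * y)%:C = x%:C * y%:C.
Proof. by apply: eq_ReIm => /=; ring. Qed.
Lemma realcN x : (- x)%:C = - x%:C.
Proof. by apply: eq_ReIm => /=; ring. Qed.
Lemma conjcM z w : (z * w)^* = z^* * w^*.
Proof. exact: rmorphM. Qed.
Lemma conjcD z w : (z + w)^* = z^* + w^*.
Proof. exact: rmorphD. Qed.
Lemma conjcN z : (- z)^* = - z^*.
Proof. exact: rmorphN. Qed.
Lemma conjc_sum (I : Type) (r : seq I) (P : pred I) (F : I -> C) :
  (\sum_(i <- r | P i) F i)^* = \sum_(i <- r | P i) (F i)^*.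
Proof. exact: rmorph_sum. Qed.
Lemma conjcR x : (x%:C)^* = x%:C. Proof. exact: conjc_real. Qed.

Lemma ltr0C x : (0 < x%:C) = (0 < x). Proof. exact: ltcR. Qed.

Definition cexp z : C := (expR (Re z) * cos (Im z)) +i* (expR (Re z) * sin (Im z)).

Lemma cexpD z w : cexp (z + w) = cexp z * cexp w.
Proof.
by apply: eq_ReIm; rewrite ?ReM ?ImM /= ReD ImD expRD ?cosD ?sinD; ring.
Qed.
Lemma cexp0 : cexp 0 = 1.
Proof. by apply: eq_ReIm => /=; rewrite expR0 ?cos0 ?sin0 mul1r. Qed.
Lemma cexp_real x : cexp x%:C = (expR x)%:C.
Proof. by apply: eq_ReIm => /=; rewrite ?cos0 ?sin0 ?mulr1 ?mulr0. Qed.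
Lemma normc_cexp z : normc (cexp z) = expR (Re z).
Proof.
by rewrite /= !exprMn -mulrDr cos2Dsin2 mulr1 sqrtr_sqr ger0_norm// expR_ge0.
Qed.
Lemma cexpJ z : (cexp z)^* = cexp z^*.
Proof. by apply: eq_ReIm; rewrite ?ReJ ?ImJ /= ReJ ImJ ?cosN ?sinN ?mulrN. Qed.

Lemma expR_sub1_le x : `|expR x - 1| <= `|x| * expR `|x|.
Proof.
have h1 := expR_ge1Dx x; have h2 := expR_ge1Dx (- x).
have e0 := expR_gt0 x.
have [x0|x0] := leP 0 x.
  rewrite ger0_norm ?(ger0_norm x0); last by lra.
  have : expR x * (1 - x) <= 1.
    by rewrite -ler_pdivlMl// mulr1 -expRN.
  nra.
rewrite ler0_norm; last by rewrite subr_le0 -[leRHS]expR0 ler_expR ltW.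
rewrite (ltr0_norm x0).
have : 1 <= expR (- x) by rewrite -[leLHS]expR0 ler_expR oppr_ge0 ltW.
nra.
Qed.

Lemma expR_sub1D_le x : `|expR x - 1 - x| <= x ^+ 2 * expR `|x|.
Proof.
have h1 := expR_ge1Dx x; have h2 := expR_ge1Dx (- x).
have e0 := expR_gt0 x.
rewrite ger0_norm; last by lra.
have h3 : expR x * (1 - x) <= 1.
  by rewrite -ler_pdivlMl// mulr1 -expRN.
have [x0|x0] := leP 0 x; first by rewrite (ger0_norm x0); nra.
have : 1 <= expR `|x| by rewrite -[leLHS]expR0 ler_expR.
have : 0 <= x ^+ 2 := sqr_ge0 _.
rewrite expr2 => h4 h5.
have h6 : x * x <= x * x * expR `|x| by rewrite ler_peMr.
apply: le_trans h6; nra.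
Qed.

Lemma cos_sub1_le x : `|cos x - 1| <= x ^+ 2.
Proof.
wlog x0 : x / 0 <= x.
  by move=> H; have [/H//|/ltW x0] := leP 0 x; rewrite -cosN -sqrrN; apply: H; rewrite oppr_ge0.
have [|c cx] := @MVT_segment R (@cos R) (fun t => - sin t) 0 x x0.
  by apply: continuous_subspaceT; exact: continuous_cos.
rewrite cos0 subr0 => ->.
have c0 : 0 <= c <= x by rewrite in_itv/= in cx.
have sc : `|sin c| <= c.
  have [|d dc] := @MVT_segment R (@sin R) (@cos R) 0 c (proj1 (andP c0)).
    by apply: continuous_subspaceT; exact: continuous_sin.
  rewrite sin0 !subr0 => ->; rewrite normrM (ger0_norm (proj1 (andP c0))).
  rewrite ler_piMl ?(proj1 (andP c0))// ler_norml cos_geN1 cos_le1//.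
rewrite normrM normrN (ger0_norm x0) expr2 ler_wpM2r//.
by apply: le_trans sc _; case/andP: c0.
Qed.

Lemma sin_sub_le x : `|sin x - x| <= x ^+ 2.
Proof.
wlog x0 : x / 0 <= x.
  move=> H; have [/H//|/ltW x0] := leP 0 x.
  by rewrite -normrN opprD -sinN -sqrrN; apply: H; rewrite oppr_ge0.
have [|c cx] := @MVT_segment R (fun t => sin t - t) (fun t => cos t - 1) 0 x x0.
  apply: continuous_subspaceT => t; apply: cvgB; last exact: cvg_id.
  exact: continuous_sin.
rewrite sin0 !subr0 => ->.
have {}cx : 0 <= c <= x by rewrite in_itv/= in cx.
have [|d dc] := @MVT_segment R (@cos R) (fun t => - sin t) 0 c (proj1 (andP cx)).
  by apply: continuous_subspaceT; exact: continuous_cos.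
rewrite cos0 subr0 => ->.
rewrite !normrM normrN expr2 (ger0_norm x0) ler_wpM2r//.
have sd : `|sin d| <= 1 by rewrite ler_norml sin_geN1 sin_le1.
apply: le_trans (_ : 1 * `|c| <= _); first by apply: ler_wpM2r.
by rewrite mul1r ger0_norm; case/andP: cx.
Qed.

(** The constant is not sharp; what matters is a quadratic bound with at most
    exponential growth, which a Gaussian weight absorbs. *)
Lemma cexp_taylor z : normc (cexp z - 1 - z) <= 4 * normc z ^+ 2 * expR (normc z).
Proof.
apply: le_trans (normc_le_ReIm _) _; rewrite !ReB !ImB /= !subr0 normc_sqr.
set a := Re z; set b := Im z.
have ez : expR `|a| <= expR (normc z) by rewrite ler_expR Re_le_normc.
have ea : expR a <= expR `|a| by rewrite ler_expR ler_norm.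
have e0 := expR_gt0 a.
have h1 := expR_sub1D_le a; have h2 := expR_sub1_le a.
have h3 := cos_sub1_le b; have h4 := sin_sub_le b.
have -> : expR a * cos b - 1 - a = (expR a - 1 - a) + expR a * (cos b - 1) by ring.
have -> : expR a * sin b - b = expR a * (sin b - b) + b * (expR a - 1) by ring.
set E := expR `|a| in ez ea h1 h2 *; have E0 : 0 < E := expR_gt0 _.
have k1 := ler_normD (expR a - 1 - a) (expR a * (cos b - 1)).
have k2 := ler_normD (expR a * (sin b - b)) (b * (expR a - 1)).
rewrite !normrM (gtr0_norm e0) in k1 k2.
have k3 : expR a * `|cos b - 1| <= E * b ^+ 2 by apply: ler_pM => //; exact: ltW.
have k4 : expR a * `|sin b - b| <= E * b ^+ 2 by apply: ler_pM => //; exact: ltW.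
have k5 : `|b| * `|expR a - 1| <= `|b| * (`|a| * E) by apply: ler_wpM2l.
have k6 : `|b| * `|a| * 2 <= a ^+ 2 + b ^+ 2.
  rewrite -(real_normK (num_real a)) -(real_normK (num_real b)).
  by have := sqr_ge0 (`|a| - `|b|); rewrite sqrrB; lra.
have k7 : 4 * (a ^+ 2 + b ^+ 2) * E <= 4 * (a ^+ 2 + b ^+ 2) * expR (normc z).
  by apply: ler_wpM2l => //; rewrite mulr_ge0// addr_ge0// sqr_ge0.
apply: le_trans k7.
have k8 : `|b| * (`|a| * E) <= E * (a ^+ 2 + b ^+ 2).
  have : 0 <= `|b| * `|a| by rewrite mulr_ge0.
  rewrite mulrA [_ * E]mulrC ler_pM2l// => ?; lra.
have a2 := sqr_ge0 a; have b2 := sqr_ge0 b.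
nra.
Qed.

(** One-variable complex differentiability in epsilon-delta form. The ball is
    closed and contains h = 0, because the increment of an inner function may
    vanish in a composition. *)
Definition cdiff (g : C -> C) z := exists d : C,
  forall e : R, 0 < e -> exists2 r : R, 0 < r & forall h : C, normc h <= r ->
    normc (g (z + h) - g z - d * h) <= e * normc h.

Lemma cdiff_cexp z : cdiff cexp z.
Proof.
exists (cexp z) => e e0.
pose M := expR (Re z) * 4 * expR 1.
have M0 : 0 < M by rewrite !mulr_gt0// expR_gt0.
exists (Num.min 1 (e / M)) => [|h]; first by rewrite lt_min ltr01 divr_gt0.
rewrite le_min => /andP[h1 he].
have -> : cexp (z + h) - cexp z - cexp z * h = cexp z * (cexp h - 1 - h).
  by rewrite cexpD; ring.
rewrite normcM normc_cexp.
apply: le_trans (ler_wpM2l (expR_ge0 _) (cexp_taylor h)) _.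
have h0 := normc_ge0 h.
apply: le_trans (_ : M * normc h * normc h <= _).
  rewrite /M expr2 !mulrA -!mulrA [leRHS](_ : _ =
    expR (Re z) * (4 * (normc h * (normc h * expR 1)))); last by ring.
  by rewrite !ler_wpM2l ?expR_ge0// ler_expR.
by rewrite ler_wpM2r// mulrC -ler_pdivlMr.
Qed.

Lemma cdiff_comp (f g : C -> C) z : cdiff f (g z) -> cdiff g z -> cdiff (f \o g) z.
Proof.
move=> [a Ha] [b Hb]; exists (a * b) => e e0.
have B0 : 0 < normc b + 1 by rewrite ltr_wpDl// normc_ge0.
have A0 : 0 < normc a + 1 by rewrite ltr_wpDl// normc_ge0.
have [r r0 Hr] := Ha (e / (2 * (normc b + 1))) (divr_gt0 e0 (mulr_gt0 (ltr0n _ 2) B0)).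
have [s1 s10 Hs1] := Hb 1 ltr01.
have [s2 s20 Hs2] := Hb (e / (2 * (normc a + 1))) (divr_gt0 e0 (mulr_gt0 (ltr0n _ 2) A0)).
exists (Num.min s1 (Num.min s2 (r / (normc b + 1)))) => [|h].
  by rewrite !lt_min s10 s20 divr_gt0.
rewrite !le_min => /and3P[hs1 hs2 hr].
have h0 := normc_ge0 h.
have {Hs1} := Hs1 _ hs1; have {Hs2} := Hs2 _ hs2 => k2 k1.
set k := g (z + h) - g z in k1 k2.
have kb : normc k <= (normc b + 1) * normc h.
  rewrite -[k](subrK (b * h)); apply: le_trans (normcD _ _) _.
  by rewrite normcM; lra.
have kr : normc k <= r.
  by apply: le_trans kb _; rewrite mulrC -ler_pdivlMr.
have := Hr _ kr; rewrite /= -/k.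
have -> : g z + k = g (z + h) by rewrite /k addrC subrK.
move=> k3.
have -> : f (g (z + h)) - f (g z) - a * b * h =
  (f (g (z + h)) - f (g z) - a * k) + a * (k - b * h) by ring.
apply: le_trans (normcD _ _) _; rewrite normcM.
have -> : e * normc h = e / 2 * normc h + e / 2 * normc h by field.
apply: lerD.
  apply: le_trans k3 _; apply: le_trans (ler_wpM2l _ kb) _.
    by rewrite divr_ge0 ?mulr_ge0// ltW.
  rewrite le_eqVlt; apply/orP; left; apply/eqP; field.
  by rewrite gt_eqF.
apply: le_trans (ler_wpM2l (normc_ge0 a) k2) _.
apply: le_trans (_ : (normc a + 1) * (e / (2 * (normc a + 1)) * normc h) <= _).
  by rewrite ler_wpM2r ?lerDl// mulr_ge0// divr_ge0 ?mulr_ge0// ltW.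
rewrite le_eqVlt; apply/orP; left; apply/eqP; field.
by rewrite gt_eqF.
Qed.

Lemma cdiff_id_scale (a b : C) z : cdiff (fun w => a * w + b) z.
Proof.
exists a => e e0; exists 1 => // h _.
have -> : a * (z + h) + b - (a * z + b) - a * h = 0 by ring.
by rewrite normc0E mulr_ge0 ?normc_ge0// ltW.
Qed.

Lemma cdiff_mul (f g : C -> C) z : cdiff f z -> cdiff g z -> cdiff (fun w => f w * g w) z.
Proof.
move=> [a Ha] [b Hb]; exists (a * g z + f z * b) => e e0.
set F := normc (f z) + 1; set G := normc (g z) + 1; set A := normc a + 1.
set B := normc b + 1.
have F0 : 0 < F by rewrite ltr_wpDl// normc_ge0.
have G0 : 0 < G by rewrite ltr_wpDl// normc_ge0.
have A0 : 0 < A by rewrite ltr_wpDl// normc_ge0.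
have B0 : 0 < B by rewrite ltr_wpDl// normc_ge0.
have [r1 r10 H1] := Ha 1 ltr01.
have [r2 r20 H2] := Hb 1 ltr01.
have [r3 r30 H3] := Ha (e / (3 * G)) (divr_gt0 e0 (mulr_gt0 (ltr0n _ 3) G0)).
have [r4 r40 H4] := Hb (e / (3 * F)) (divr_gt0 e0 (mulr_gt0 (ltr0n _ 3) F0)).
have r50 : 0 < e / (3 * (A * B)) by rewrite divr_gt0// !mulr_gt0.
exists (Num.min r1 (Num.min r2 (Num.min r3 (Num.min r4 (e / (3 * (A * B))))))) => [|h].
  by rewrite !lt_min r10 r20 r30 r40.
rewrite !le_min => /and5P[h1 h2 h3 h4 h5].
have h0 := normc_ge0 h.
have {}H1 := H1 _ h1; have {}H2 := H2 _ h2; have {}H3 := H3 _ h3; have {}H4 := H4 _ h4.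
set k := f (z + h) - f z in H1 H3; set l := g (z + h) - g z in H2 H4.
have kA : normc k <= A * normc h.
  rewrite -[k](subrK (a * h)); apply: le_trans (normcD _ _) _.
  by rewrite normcM /A; lra.
have lB : normc l <= B * normc h.
  rewrite -[l](subrK (b * h)); apply: le_trans (normcD _ _) _.
  by rewrite normcM /B; lra.
have -> : f (z + h) * g (z + h) - f z * g z - (a * g z + f z * b) * h =
  (k - a * h) * g z + f z * (l - b * h) + k * l by rewrite /k /l; ring.
apply: le_trans (normcD _ _) _; apply: le_trans (lerD (normcD _ _) (lexx _)) _.
rewrite !normcM.
have -> : e * normc h = e / 3 * normc h + e / 3 * normc h + e / 3 * normc h by field.
apply: lerD; first apply: lerD.
- apply: le_trans (_ : (e / (3 * G) * normc h) * G <= _).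
    by apply: ler_pM; rewrite ?normc_ge0// lerDl.
  by rewrite le_eqVlt; apply/orP; left; apply/eqP; field; rewrite gt_eqF.
- apply: le_trans (_ : F * (e / (3 * F) * normc h) <= _).
    by apply: ler_pM; rewrite ?normc_ge0// lerDl.
  by rewrite le_eqVlt; apply/orP; left; apply/eqP; field; rewrite gt_eqF.
- apply: le_trans (ler_pM (normc_ge0 _) (normc_ge0 _) kA lB) _.
  apply: le_trans (_ : A * normc h * (B * (e / (3 * (A * B)))) <= _).
    by rewrite !ler_wpM2l// ?mulr_ge0// ltW.
  rewrite le_eqVlt; apply/orP; left; apply/eqP; field.
  by rewrite !gt_eqF.
Qed.

Lemma cdiff_cont (g : C -> C) z : cdiff g z ->
  forall e : R, 0 < e -> exists2 r : R, 0 < r & forall h : C, normc h <= r ->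
    normc (g (z + h) - g z) <= e.
Proof.
move=> [d Hd] e e0; have [r r0 Hr] := Hd 1 ltr01.
have B0 : 0 < normc d + 1 by rewrite ltr_wpDl// normc_ge0.
exists (Num.min r (e / (normc d + 1))) => [|h].
  by rewrite lt_min r0 divr_gt0.
rewrite le_min => /andP[hr he].
rewrite -[X in normc X](subrK (d * h)); apply: le_trans (normcD _ _) _.
apply: le_trans (lerD (Hr _ hr) (lexx _)) _; rewrite normcM.
by rewrite -mulrDl addrC mulrC -ler_pdivlMr.
Qed.

End complex_numbers.

(** * Mean values over the unit circle *)

Section circle.
Context (R : realType).
Local Notation C := R[i].

Lemma cauchy_riemann_cdiff (G : C -> C) (s v : R) : cdiff G (s +i* v) ->
  cauchy_riemann_at (fun s v => Re (G (s +i* v))) (fun s v => Im (G (s +i* v))) s v.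
Proof.
move=> [d Hd]; exists (Re d), (Im d) => e e0.
have [r r0 Hr] := Hd e e0.
exists (r / 2) => [|x y xr yr]; first by rewrite divr_gt0.
have hxy : normc (x +i* y) <= `|x| + `|y| := normc_le_ReIm _.
have {}Hr := Hr (x +i* y) (le_trans hxy _).
have {}Hr : normc (G ((s + x) +i* (v + y)) - G (s +i* v) - d * (x +i* y)) <= e * (`|x| + `|y|).
  apply: le_trans (Hr _) _; first by rewrite (splitr r) lerD.
  by rewrite ler_wpM2l// ltW.
split.
- apply: le_trans Hr; apply: le_trans (Re_le_normc _).
  by rewrite !ReB ReM.
- apply: le_trans Hr; apply: le_trans (Im_le_normc _).
  by rewrite !ImB ImM [Im d * _ + _]addrC.
Qed.

(** Cauchy's theorem for g o exp on the rectangle [-S, 0] x [0, 2 pi]: the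
    horizontal sides cancel by periodicity, so the mean over the unit circle
    equals the mean over the circle of radius exp(-S), which tends to g(0). *)
Lemma circle_mean (g : C -> C) : (forall z, cdiff g z) ->
  itg (fun v => Re (g (cos v +i* sin v))) 0 (2 * pi) = Re (g 0) * (2 * pi).
Proof.
move=> Hg.
have pi20 : 0 <= 2 * pi :> R by rewrite mulr_ge0// pi_ge0.
pose G := g \o @cexp R.
have HG z : cdiff G z by apply: cdiff_comp; [exact: Hg|exact: cdiff_cexp].
pose P s v := Re (G (s +i* v)); pose Q s v := Im (G (s +i* v)).
have CR s v : cauchy_riemann_at P Q s v by exact: cauchy_riemann_cdiff.
have [cP1 cP2 cQ1 cQ2] := cauchy_riemann_continuous CR.
have per u : Q u (0 + 2 * pi) = Q u 0.
  rewrite /Q /G /= /cexp /=; have -> : 2 * pi = pi *+ 2 :> R by rewrite mulr_natl.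
  by rewrite cosD2pi sinD2pi.
have key (S : R) : 0 <= S -> itg (P 0) 0 (2 * pi) = itg (P (- S)) 0 (2 * pi).
  move=> S0; have := goursat CR (- S) 0 S0 pi20.
  rewrite /rect_integral; have -> : (fun u => Q u (0 + 2 * pi)) = (fun u => Q u 0).
    by apply/funext => u; exact: per.
  by rewrite subrr add0r addNr => /eqP; rewrite subr_eq0 => /eqP.
have -> : itg (fun v => Re (g (cos v +i* sin v))) 0 (2 * pi) = itg (P 0) 0 (2 * pi).
  by congr itg; apply/funext => v; rewrite /P /G /= /cexp /= expR0 !mul1r.
apply/eqP; rewrite -subr_eq0 -normr_eq0; apply/eqP/le_anti; rewrite normr_ge0 andbT.
apply/ler_addgt0Pl => e e0; rewrite addr0.
have pi2 : 0 < 2 * pi :> R by rewrite mulr_gt0// pi_gt0.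
have [r r0 Hr] := cdiff_cont (Hg 0) (divr_gt0 e0 pi2).
have [S S0 Sr] : exists2 S : R, 0 <= S & expR (- S) <= r.
  exists (Num.max 0 (- ln r)); first by rewrite le_max lexx.
  by rewrite -[leRHS]lnK ?posrE// ler_expR lerNl le_max lexx orbT.
rewrite (key S S0); apply: le_trans (itg_bound (e := e / (2 * pi)) _ _ _) _.
- exact: cP1.
- exact: pi20.
- move=> v _; rewrite -ReB; apply: le_trans (Re_le_normc _) _.
  rewrite /G /=; have := Hr (cexp (- S +i* v)); rewrite add0r; apply.
  by rewrite normc_cexp.
- by rewrite divfK// gt_eqF.
Qed.

End circle.

(** * Complex differentiability on C^n *)

Section Cn.
Context (R : realType) (n : nat).
Local Notation C := R[i].
Local Notation Cn := 'rV[C]_n.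
Local Notation mR := (measurableTypeR R).

Definition l1norm (h : Cn) : R := \sum_j normc (h ord0 j).

Lemma l1norm_ge0 (h : Cn) : 0 <= l1norm h.
Proof. by apply: sumr_ge0 => j _; exact: normc_ge0. Qed.

Lemma l1normZ (c : C) (h : Cn) : l1norm (c *: h) = normc c * l1norm h.
Proof. by rewrite /l1norm mulr_sumr; apply: eq_bigr => j _; rewrite mxE normcM. Qed.

Lemma normc_coord_le (h : Cn) j : normc (h ord0 j) <= l1norm h.
Proof.
rewrite /l1norm (bigD1 j)//= lerDl sumr_ge0// => i _; exact: normc_ge0.
Qed.

(** Complex differentiability in quantitative form: the derivative is an
    explicit linear form and the remainder is measured with the l1 norm, which
    the integral estimates below produce directly. *)
Definition hdiff (f : Cn -> C) (z : Cn) := exists a : 'I_n -> C,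
  forall e : R, 0 < e -> exists2 r : R, 0 < r & forall h : Cn, l1norm h <= r ->
    normc (f (z + h) - f z - \sum_j a j * h ord0 j) <= e * l1norm h.

Lemma mx_norm_le_l1norm (h : Cn) : `|h| <= (l1norm h)%:C.
Proof.
have [h0|h0] := eqVneq (mx_norm h) 0; first by rewrite [leLHS]h0 ler0c l1norm_ge0.
have [[i j] /= hE] := mx_norm_neq0 h0.
rewrite [leLHS]hE normc_norm lecR ord1.
exact: normc_coord_le.
Qed.

Lemma coord_le_mx_norm (h : Cn) j : (normc (h ord0 j))%:C <= `|h|.
Proof.
rewrite -normc_norm [leRHS]mx_normE -[leLHS]nngE num_le.
exact: (le_bigmax _ _ (ord0, j)).
Qed.

(** The l1 norm and the maximum norm of C^n are equivalent, so this unfolds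
    the definition of the differential; the coefficients are its values on the
    standard basis. *)
Lemma differentiable_hdiff (f : Cn -> C) z : differentiable f z -> hdiff f z.
Proof.
move=> df; exists (fun j => 'd f z (delta_mx ord0 j : Cn)) => e e0.
have /eqaddoP/(_ e%:C) := diff_locally df.
rewrite ltr0C => /(_ e0) /nbhs_ballP[r r0 Hr].
have r0' : 0 < complex.Re r by move: r0; rewrite /= ltcE => /andP[].
have rE : r = (complex.Re r)%:C.
  by apply: eq_ReIm => //=; move: r0; rewrite /= ltcE => /andP[/eqP].
exists (complex.Re r / 2) => [|h hr]; first by rewrite divr_gt0.
have := Hr h; rewrite /= => {}Hr.
have bh : ball (0 : Cn) r h.
  rewrite mx_norm_ball /ball_ /= sub0r normrN.
  apply: le_lt_trans (mx_norm_le_l1norm h) _.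
  by rewrite rE ltcR; apply: le_lt_trans hr _; rewrite ltr_pdivrMr// mulr_natr mulr2n ltrDl.
have {}Hr := Hr bh.
have dE : 'd f z h = \sum_j 'd f z (delta_mx ord0 j : Cn) * h ord0 j.
  rewrite {1}[h]row_sum_delta linear_sum; apply: eq_bigr => j _.
  by rewrite linearZ mulrC.
rewrite -lecR -normc_norm realcM.
have -> : f (z + h) - f z - \sum_j 'd f z (delta_mx ord0 j : Cn) * h ord0 j =
   (f \o shift z - (cst (f z) + 'd f z)) h.
  by rewrite -dE !fctE /= [h + z]addrC opprD addrA.
apply: le_trans Hr _; apply: ler_wpM2l (mx_norm_le_l1norm h).
by rewrite ler0c ltW.
Qed.

Lemma hdiff_differentiable (f : Cn -> C) z : hdiff f z -> differentiable f z.
Proof.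
move=> [a Ha].
pose L (h : Cn) : C := \sum_j a j * h ord0 j.
have Llin : linear L.
  move=> k u v; rewrite /L scaler_sumr -big_split/=; apply: eq_bigr => j _.
  by rewrite !mxE mulrDr mulrCA.
pose L' : {linear Cn -> C} := HB.pack L (GRing.isLinear.Build C Cn C _ L Llin).
have Lc : continuous L'.
  move=> u.
  apply: (@differentiable_continuous C Cn C u L').
  have -> : (L' : Cn -> C) = \sum_j (a j *: (fun h : Cn => h ord0 j)).
    by apply/funext => h; rewrite fct_sumE.
  apply: (@differentiable_sum C Cn C n) => j.
  apply: (@differentiableZ C Cn C).
  exact: differentiable_coord.
have ex : f \o shift z = cst (f z) + L' +o_ (0 : Cn) id.
  apply/eqaddoP => e e0.
  have e0' : 0 < complex.Re e by move: e0; rewrite /= ltcE => /andP[].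
  have eE : e = (complex.Re e)%:C.
    by apply: eq_ReIm => //=; move: e0; rewrite /= ltcE => /andP[/eqP].
  pose N := n%:R + 1 : R.
  have N0 : 0 < N by rewrite ltr_wpDl// ler0n.
  have [r r0 Hr] := Ha (complex.Re e / N) (divr_gt0 e0' N0).
  have l1N h : (l1norm h)%:C <= N%:C * `|h|.
    have hR : `|h| = (complex.Re `|h|)%:C.
      apply: eq_ReIm => //=; apply/eqP.
      have : (0 : C) <= `|h| by exact: normr_ge0.
      by rewrite lecE => /andP[].
    rewrite hR -realcM lecR.
    apply: le_trans (_ : \sum_(j < n) complex.Re `|h| <= _).
      by apply: ler_sum => j _; rewrite -lecR -hR; exact: coord_le_mx_norm.
    rewrite sumr_const card_ord -mulr_natl ler_wpM2r ?lerDl//.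
    by rewrite -lecR -hR; exact: normr_ge0.
  apply/nbhs_ballP; exists (r / N)%:C; first by rewrite /= ltr0C divr_gt0.
  move=> h; rewrite mx_norm_ball /ball_ /= sub0r normrN => hr.
  have hl : l1norm h <= r.
    rewrite -lecR; apply: le_trans (l1N h) _.
    apply: le_trans (ler_wpM2l _ (ltW hr)) _; first by rewrite ler0c ltW.
    by rewrite -realcM lecR mulrC divfK// gt_eqF.
  have {}Hr := Hr _ hl.
  rewrite -[X in `|X|]/(f (h + z) - (f z + L h)) [h + z]addrC opprD addrA.
  rewrite normc_norm; apply: le_trans (_ : (complex.Re e / N * l1norm h)%:C <= _).
    by rewrite lecR.
  rewrite realcM; apply: le_trans (ler_wpM2l _ (l1N h)) _.
    by rewrite ler0c divr_ge0// ltW.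
  by rewrite mulrA -realcM divfK ?gt_eqF// -eE.
have dE := diff_unique Lc ex.
by apply/diff_locallyP; rewrite dE.
Qed.

Lemma hdiff_cont (f : Cn -> C) z : hdiff f z ->
  forall e : R, 0 < e -> exists2 r : R, 0 < r & forall h : Cn, l1norm h <= r ->
    normc (f (z + h) - f z) <= e.
Proof.
move=> [a Ha] e e0; have [r r0 Hr] := Ha 1 ltr01.
pose A := \sum_j normc (a j) + 1.
have A0 : 0 <= \sum_j normc (a j) by apply: sumr_ge0 => j _; exact: normc_ge0.
have A1 : 0 < A by rewrite ltr_wpDl.
exists (Num.min r (e / A)) => [|h]; first by rewrite lt_min r0 divr_gt0.
rewrite le_min => /andP[hr he].
rewrite -[X in normc X](subrK (\sum_j a j * h ord0 j)); apply: le_trans (normcD _ _) _.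
apply: le_trans (lerD (Hr _ hr) (normc_sum _ _ _)) _.
apply: le_trans (_ : A * l1norm h <= _); last by rewrite mulrC -ler_pdivlMr.
rewrite /A [leRHS]mulrDl addrC lerD// mulr_suml; apply: ler_sum => j _.
by rewrite normcM ler_wpM2l ?normc_ge0// normc_coord_le.
Qed.

Lemma hdiff_line (f : Cn -> C) (z w : Cn) (l : C) : hdiff f (l *: z + w) ->
  cdiff (fun k => f (k *: z + w)) l.
Proof.
move=> [a Ha]; exists (\sum_j a j * z ord0 j) => e e0.
pose N := l1norm z + 1.
have N0 : 0 < N by rewrite ltr_wpDl// l1norm_ge0.
have [r r0 Hr] := Ha (e / N) (divr_gt0 e0 N0).
exists (r / N) => [|h hr]; first by rewrite divr_gt0.
have lh' : l1norm (h *: z) <= normc h * N.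
  by rewrite l1normZ ler_wpM2l ?normc_ge0// lerDl.
have := Hr (h *: z); rewrite [l *: z + w + _]addrAC -scalerDl => {}Hr.
have -> : (\sum_j a j * z ord0 j) * h = \sum_j a j * (h *: z) ord0 j.
  by rewrite mulr_suml; apply: eq_bigr => j _; rewrite mxE mulrCA mulrC mulrA.
apply: le_trans (Hr _) _.
  by apply: le_trans lh' _; rewrite -ler_pdivlMr.
apply: le_trans (ler_wpM2l _ lh') _; first by rewrite divr_ge0// ltW.
by rewrite [_ * N]mulrC mulrA divfK// gt_eqF.
Qed.

(** A continuous function is the pointwise limit of its values on the grids of
    mesh 1/(k+1), and each approximant takes countably many values on
    measurable boxes. *)
Lemma measurable_fun_of_continuous (m : nat) (F : m.-tuple mR -> R) :
  (forall t (e : R), 0 < e -> exists2 r : R, 0 < r & forall s : m.-tuple mR,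
     (forall i, `|tnth s i - tnth t i| <= r) -> `|F s - F t| <= e) ->
  measurable_fun setT F.
Proof.
move=> cF.
pose fl (k : nat) (t : m.-tuple mR) : m.-tuple int :=
  [tuple Num.floor (tnth t i * k.+1%:R) | i < m].
pose D (k : nat) (c : m.-tuple int) : m.-tuple mR :=
  [tuple ((tnth c i)%:~R / k.+1%:R : R) | i < m].
apply: (@measurable_fun_cvg _ _ _ setT (fun k t => F (D k (fl k t)))).
  move=> k _ Y mY; rewrite setTI.
  rewrite (_ : _ @^-1` Y = \bigcup_(c in [set c | Y (F (D k c))]) (fl k @^-1` [set c])); last first.
    by apply/seteqP; split=> [t Yt|t [c /= Yc tc]]; [exists (fl k t)|rewrite /= tc].
  rewrite bigcup_mkcond.
  apply: countable_bigcupT_measurable => [|c]; first exact: countableP.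
  case: ifPn => // _.
  rewrite (_ : _ @^-1` _ = \bigcap_(i in [set: 'I_m])
    ((fun t : m.-tuple mR => tnth t i) @^-1`
       [set` `[((tnth c i)%:~R / k.+1%:R : R), ((tnth c i + 1)%:~R / k.+1%:R)[])); last first.
    apply/seteqP; split=> t /=.
      move=> tc i _ /=.
      rewrite in_itv/= ler_pdivrMr// ltr_pdivlMr// -tc tnth_mktuple.
      exact: floor_itv.
    move=> H; apply/eq_from_tnth => i; rewrite tnth_mktuple.
    apply/eqP; rewrite floor_eq -ler_pdivrMr// -ltr_pdivlMr//.
    by have := H i I; rewrite /= in_itv.
  apply: fin_bigcap_measurable => [|i _]; first exact: finite_finset.
  rewrite -[X in measurable X]setTI; apply: (@measurable_tnth _ mR) => //.
move=> t _; apply/cvgrPdist_le => e e0.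
have [r r0 Hr] := cF t e e0.
near=> k; rewrite distrC; apply: Hr => i.
rewrite !tnth_mktuple.
set x := tnth t i.
have k0 : 0 < k.+1%:R :> R by [].
have /andP[f1 f2] := floor_itv (x * k.+1%:R).
rewrite distrC ger0_norm ?subr_ge0; last by rewrite ler_pdivrMr.
apply: le_trans (_ : k.+1%:R^-1 <= r); last first.
  by apply: ltW; near: k; exact: (near_infty_natSinv_lt (PosNum r0)).
rewrite lerBlDl -[X in _ + X]mul1r -mulrDl ler_pdivlMr//.
by move: f2; rewrite intrD => /ltW.
Unshelve. all: by end_near. Qed.

End Cn.

(** * Isometries of C^n preserve the volume; Gaussian integrals *)

Section gaussian_volume.
Context (R : realType) (n : nat).
Local Notation C := R[i].
Local Notation Cn := 'rV[C]_n.
Local Notation mu := (@lebesgue_measure R).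
Local Notation mR := (measurableTypeR R).
Local Notation T := ((n + n).-tuple mR).
Local Notation cvec := (@cvec_of_reals R n).
Local Notation vol := (volume R n).

(** Stated with nonnegative measurable integrands, so that no integrability is
    needed to compose; [volume_preserving_integral] extends it to all
    measurable ones. *)
Definition volume_preserving (tau : T -> T) :=
  measurable_fun setT tau /\ forall F : T -> \bar R, measurable_fun setT F ->
    (forall t, 0 <= F t)%E -> (\int[vol]_t F (tau t) = \int[vol]_t F t)%E.

Lemma volume_preserving_comp f g : volume_preserving f -> volume_preserving g ->
  volume_preserving (f \o g).
Proof.
move=> [mf Hf] [mg Hg]; split=> [|F mF F0]; first exact: measurableT_comp.
rewrite (Hg (F \o f)); first exact: Hf.
  exact: measurableT_comp.
by move=> t; exact: F0.
Qed.

Lemma volume_preserving_integral tau (F : T -> \bar R) : volume_preserving tau ->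
  measurable_fun setT F -> (\int[vol]_t F (tau t) = \int[vol]_t F t)%E.
Proof.
move=> [mt Ht] mF; rewrite [LHS]integralE [RHS]integralE.
have -> : (fun t => F (tau t)) = F \o tau by [].
rewrite funepos_comp funeneg_comp; congr (_ - _)%E; apply: Ht => //.
- exact: measurable_funepos.
- exact: measurable_funeneg.
Qed.

Definition xcoord (t : T) (j : 'I_n) : R := tnth t (lshift n j).
Definition ycoord (t : T) (j : 'I_n) : R := tnth t (rshift n j).

Lemma cvecE t j : cvec t ord0 j = xcoord t j +i* ycoord t j.
Proof. by rewrite /cvec_of_reals mxE. Qed.

(** The coordinates of R^(2n) are listed with all real parts first, so a shear
    of C^n acts on the two blocks separately. *)
Definition block_shear (hx hy : 'I_n -> T -> R) : T -> T :=
  shear (fun i t => match fintype.split i with inl j => hx j t | inr j => hy j t end).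

Lemma block_shearx hx hy t j : xcoord (block_shear hx hy t) j = xcoord t j + hx j t.
Proof.
rewrite /xcoord tnth_mktuple; case: splitP => [k jk|k jk].
  by congr (_ + hx _ t); apply/val_inj.
by have := ltn_ord j; rewrite [X in (X < _)%N]jk ltnNge leq_addr.
Qed.

Lemma block_sheary hx hy t j : ycoord (block_shear hx hy t) j = ycoord t j + hy j t.
Proof.
rewrite /ycoord tnth_mktuple; case: splitP => [k jk|k jk].
  by have := ltn_ord k; rewrite -[X in (X < _)%N]jk ltnNge leq_addr.
by congr (_ + hy _ t); apply/val_inj/(@addnI n).
Qed.

Lemma cvec_block_shear hx hy t : cvec (block_shear hx hy t) =
  \row_j ((xcoord t j + hx j t) +i* (ycoord t j + hy j t)).
Proof.
by apply/rowP => j; rewrite cvecE block_shearx block_sheary mxE.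
Qed.

Lemma measurable_xcoord j : measurable_fun setT (fun t : T => xcoord t j).
Proof. exact: (@measurable_tnth _ mR). Qed.
Lemma measurable_ycoord j : measurable_fun setT (fun t : T => ycoord t j).
Proof. exact: (@measurable_tnth _ mR). Qed.

Lemma volume_preserving_translation (w : Cn) : exists2 tau, volume_preserving tau &
  forall t, cvec (tau t) = cvec t + w.
Proof.
exists (block_shear (fun j _ => Re (w ord0 j)) (fun j _ => Im (w ord0 j))); last first.
  move=> t; rewrite cvec_block_shear; apply/rowP => j.
  by rewrite !mxE; apply: eq_ReIm; rewrite ?ReD ?ImD.
split; first by apply: measurable_shear => i; case: (fintype.split i).
by move=> F mF F0; apply: (@ge0_integral_shear _ _ xpredT) => // i; case: (fintype.split i).
Qed.

Lemma volume_preserving_shearx (a : R) :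
  volume_preserving (block_shear (fun j t => a * ycoord t j) (fun _ _ => 0)).
Proof.
have mh (i : 'I_(n + n)) : measurable_fun setT (fun t : T =>
    match fintype.split i with inl j => a * ycoord t j | inr j => 0 end).
  case: (fintype.split i) => // j; apply: measurable_funM => //; exact: measurable_ycoord.
split; first exact: measurable_shear.
move=> F mF F0.
apply: (@ge0_integral_shear _ _ (fun i => if fintype.split i is inl _ then true else false)) => //.
- by move=> i t; case: (fintype.split i).
- move=> i t t' tt'; case: (fintype.split i) => // j.
  rewrite /ycoord tt'//.
  by case: splitP => // k jk; have := ltn_ord k; rewrite -[X in (X < _)%N]jk ltnNge leq_addr.
Qed.

Lemma volume_preserving_sheary (a : R) :
  volume_preserving (block_shear (fun _ _ => 0) (fun j t => a * xcoord t j)).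
Proof.
have mh (i : 'I_(n + n)) : measurable_fun setT (fun t : T =>
    match fintype.split i with inl j => 0 : R | inr j => a * xcoord t j end).
  case: (fintype.split i) => // j; apply: measurable_funM => //; exact: measurable_xcoord.
split; first exact: measurable_shear.
move=> F mF F0.
apply: (@ge0_integral_shear _ _ (fun i => if fintype.split i is inr _ then true else false)) => //.
- by move=> i t; case: (fintype.split i).
- move=> i t t' tt'; case: (fintype.split i) => // j.
  rewrite /xcoord tt'//.
  by case: splitP => // k jk; have := ltn_ord j; rewrite [X in (X < _)%N]jk ltnNge leq_addr.
Qed.

(** A rotation of angle other than pi is a product of three shears, x-y-x,
    with slopes - s / (1 + c), s and - s / (1 + c); the scalar -1 is the
    square of i. *)
Lemma volume_preserving_rotation (c s : R) : c ^+ 2 + s ^+ 2 = 1 ->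
  exists2 tau, volume_preserving tau &
  forall t, cvec (tau t) = (c +i* s) *: cvec t.
Proof.
move=> cs.
have generic (c' s' : R) : c' ^+ 2 + s' ^+ 2 = 1 -> 1 + c' != 0 ->
    exists2 tau, volume_preserving tau & forall t, cvec (tau t) = (c' +i* s') *: cvec t.
  move=> cs' c0; pose a := - s' / (1 + c').
  pose X := block_shear (fun j t => a * ycoord t j) (fun _ _ => 0).
  pose Y := block_shear (fun _ _ => 0) (fun j t => s' * xcoord t j).
  exists (X \o (Y \o X)).
    have pX := volume_preserving_shearx a; have pY := volume_preserving_sheary s'.
    exact: volume_preserving_comp pX (volume_preserving_comp pY pX).
  move=> t; rewrite /= cvec_block_shear; apply/rowP => j; rewrite [RHS]mxE [LHS]mxE cvecE.
  rewrite !(block_shearx, block_sheary).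
  have e1 : a * (1 + c') = - s' by rewrite /a divfK.
  have e2 : s' * a = c' - 1.
    by apply: (mulIf c0); rewrite -mulrA e1; move: cs'; rewrite !expr2; lra.
  apply: eq_ReIm; rewrite ?ReM ?ImM /=.
    rewrite -[RHS]/(c' * xcoord t j - s' * ycoord t j) !addr0.
    move: (xcoord t j) (ycoord t j) => x y.
    transitivity (x + 2 * a * y + (s' * a) * x + (s' * a) * (a * y)); first by ring.
    rewrite e2; transitivity (c' * x + (a * (1 + c')) * y); first by ring.
    by rewrite e1; ring.
  rewrite -[RHS]/(c' * ycoord t j + s' * xcoord t j) !addr0.
  move: (xcoord t j) (ycoord t j) => x y.
  transitivity (y + s' * x + (s' * a) * y); first by ring.
  by rewrite e2; ring.
have [c0|c0] := eqVneq (1 + c) 0; last exact: generic.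
have [||tau ptau Htau] := generic 0 1; [by rewrite expr0n expr1n add0r|by rewrite addr0 oner_neq0|].
exists (tau \o tau); first exact: volume_preserving_comp.
have cE : c = -1 by lra.
have sE : s = 0.
  by apply/eqP; rewrite -sqrf_eq0; apply/eqP; move: cs; rewrite cE sqrrN expr1n; lra.
move=> t; rewrite /= !Htau scalerA; congr (_ *: _).
by apply: eq_ReIm; rewrite ?ReM ?ImM /= ?cE ?sE; ring.
Qed.

Definition sqsum (t : T) : R := \sum_i (tnth t i) ^+ 2.

Lemma sqnorm_cvec t : sqnorm (cvec t) = sqsum t.
Proof.
rewrite /sqnorm /sqsum big_split_ord /= -big_split/=; apply: eq_bigr => j _.
by rewrite cvecE normc_sqr.
Qed.

Lemma measurable_sqsum : measurable_fun setT sqsum.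
Proof.
apply: measurable_sum => i; apply: measurable_funX.
exact: (@measurable_tnth _ mR).
Qed.

Lemma measurable_weight : measurable_fun setT (fun t : T => gauss_weight (cvec t)).
Proof.
rewrite (_ : (fun _ => _) = fun t => expR (- sqsum t / 2)); last first.
  by apply/funext => t; rewrite /gauss_weight sqnorm_cvec.
apply: measurableT_comp => //; apply: measurable_funM => //.
by apply: measurable_funN; exact: measurable_sqsum.
Qed.

Lemma integral_gauss1 (s : R) : 0 < s ->
  (\int[mu]_x (expR (- x ^+ 2 / (s ^+ 2 *+ 2)))%:E = (Num.sqrt (s ^+ 2 * pi *+ 2))%:E)%E.
Proof.
move=> s0.
have sn : s != 0 by rewrite gt_eqF.
have p0 := normal_peak_gt0 sn.
have := integral_normal_pdf 0 s; rewrite normal_pdfE//.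
under eq_integral do rewrite EFinM.
rewrite ge0_integralZl//; last 3 first.
- apply/measurable_EFinP; exact: measurable_normal_fun.
- by move=> x _; rewrite lee_fin normal_fun_ge0.
- by rewrite lee_fin ltW.
have -> : (\int[mu]_x (normal_fun 0 s x)%:E = \int[mu]_x (expR (- x ^+ 2 / (s ^+ 2 *+ 2)))%:E)%E.
  by apply: eq_integral => x _; rewrite /normal_fun subr0.
move=> /(congr1 (fun x => (normal_peak s)^-1%:E * x)%E).
by rewrite muleA -EFinM mulVf ?gt_eqF// mul1e mule1 => ->; rewrite invrK.
Qed.

Lemma integral_gauss (s : R) : 0 < s ->
  (\int[vol]_t (expR (- sqsum t / (s ^+ 2 *+ 2)))%:E = ((s ^+ 2 * pi *+ 2) ^+ n)%:E)%E.
Proof.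
move=> s0.
transitivity (\int[vol]_t (\prod_(i < n + n) expR (- (tnth t i) ^+ 2 / (s ^+ 2 *+ 2)))%:E)%E.
  apply: eq_integral => t _; rewrite -expR_sum; congr (expR _)%:E.
  by rewrite -mulr_suml sumrN.
rewrite (@ge0_integral_tuple_prod R (n + n) (fun x => expR (- x ^+ 2 / (s ^+ 2 *+ 2)))); last 2 first.
- have := measurable_normal_fun 0 s; congr (measurable_fun _ _).
  by apply/funext => x; rewrite /normal_fun subr0.
- by move=> x; exact: expR_ge0.
rewrite integral_gauss1//.
rewrite -EFin_expe; congr (_%:E).
by rewrite addnn -mul2n exprM sqr_sqrtr// mulrn_wge0// mulr_ge0 ?pi_ge0// sqr_ge0.
Qed.

Lemma integral_weight : (\int[vol]_t (gauss_weight (cvec t))%:E = ((2 * pi) ^+ n)%:E)%E.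
Proof.
have := @integral_gauss 1 ltr01; rewrite expr1n mul1r mulr_natl => <-.
by apply: eq_integral => t _; rewrite /gauss_weight sqnorm_cvec.
Qed.

Lemma integrable_gauss (c : R) : 0 < c -> vol.-integrable setT (fun t => (expR (- c * sqsum t))%:E).
Proof.
move=> c0; pose s := Num.sqrt ((2 * c)^-1).
have s0 : 0 < s by rewrite sqrtr_gt0 invr_gt0 mulr_gt0.
apply/integrableP; split.
  apply/measurable_EFinP; apply: measurableT_comp => //; apply: measurable_funM => //.
  exact: measurable_sqsum.
under eq_integral do rewrite gee0_abs ?lee_fin ?expR_ge0//.
rewrite (eq_integral (fun t => (expR (- sqsum t / (s ^+ 2 *+ 2)))%:E)).
  by rewrite integral_gauss// ltry.
move=> t _; congr (expR _)%:E; rewrite /s sqr_sqrtr ?invr_ge0 ?mulr_ge0 ?(ltW c0)//.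
by field; rewrite gt_eqF.
Qed.

Lemma gauss_weightZ (a : C) (z : Cn) : normc a = 1 -> gauss_weight (a *: z) = gauss_weight z.
Proof.
move=> a1; rewrite /gauss_weight; congr (expR (- _ / 2)); apply: eq_bigr => j _.
by rewrite mxE normcM a1 mul1r.
Qed.

End gaussian_volume.

(** * The mean value property for the Gaussian weight *)

Section gaussian_mean.
Context (R : realType) (n : nat).
Local Notation C := R[i].
Local Notation Cn := 'rV[C]_n.
Local Notation mu := (@lebesgue_measure R).
Local Notation mR := (measurableTypeR R).
Local Notation T := ((n + n).-tuple mR).
Local Notation cvec := (@cvec_of_reals R n).
Local Notation vol := (volume R n).

(** Rotation as one function of the angle and the point jointly, for which
    joint measurability can be stated. *)
Definition rotate (p : mR * T) : T :=
  [tuple match fintype.split i with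
    | inl j => cos p.1 * xcoord p.2 j - sin p.1 * ycoord p.2 j
    | inr j => sin p.1 * xcoord p.2 j + cos p.1 * ycoord p.2 j
    end | i < n + n].

Lemma cvec_rotate p : cvec (rotate p) = (cos p.1 +i* sin p.1) *: cvec p.2.
Proof.
apply/rowP => j; rewrite cvecE !mxE /xcoord /ycoord !tnth_mktuple.
have -> : fintype.split (lshift n j) = inl j by rewrite -(unsplitK (inl j)).
have -> : fintype.split (rshift n j) = inr j by rewrite -(unsplitK (inr j)).
by apply: eq_ReIm; rewrite ?ReM ?ImM /xcoord /ycoord /=; ring.
Qed.

Lemma measurable_rotate : measurable_fun setT rotate.
Proof.
have mcos : measurable_fun setT (fun p : mR * T => cos p.1 : R).
  apply: measurableT_comp => //; apply: continuous_measurable_fun.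
  exact: continuous_cos.
have msin : measurable_fun setT (fun p : mR * T => sin p.1 : R).
  apply: measurableT_comp => //; apply: continuous_measurable_fun.
  exact: continuous_sin.
have mx j : measurable_fun setT (fun p : mR * T => xcoord p.2 j).
  by apply: (measurableT_comp (measurable_xcoord j)).
have my j : measurable_fun setT (fun p : mR * T => ycoord p.2 j).
  by apply: (measurableT_comp (measurable_ycoord j)).
apply/measurable_fun_tnthP => i.
rewrite (_ : _ \o _ = fun p : mR * T => match fintype.split i with
    | inl j => cos p.1 * xcoord p.2 j - sin p.1 * ycoord p.2 j : R
    | inr j => sin p.1 * xcoord p.2 j + cos p.1 * ycoord p.2 j
    end); last by apply/funext => p; rewrite /= tnth_mktuple.
case: (fintype.split i) => j.
- by apply: measurable_funB; apply: measurable_funM.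
- by apply: measurable_funD; apply: measurable_funM.
Qed.

Lemma continuous_circle (g : C -> C) : (forall z, cdiff g z) ->
  continuous (fun v : R => Re (g (cos v +i* sin v))).
Proof.
move=> dg; have dG z : cdiff (g \o @cexp R) z.
  by apply: cdiff_comp; [exact: dg|exact: cdiff_cexp].
have [cP _ _ _] := cauchy_riemann_continuous (fun s v => cauchy_riemann_cdiff (dG (s +i* v))).
have -> : (fun v : R => Re (g (cos v +i* sin v))) =
    (fun v => Re ((g \o @cexp R) (0 +i* v))).
  by apply/funext => v; rewrite /= /cexp /= expR0 !mul1r.
exact: cP.
Qed.

(** The weight is invariant under z -> exp(iv) z, so the integral equals its
    average over v. Exchanging the integrals leaves the mean of g over the
    circle through z, which is g(0). *)
Lemma gaussian_mean (g : Cn -> C) :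
  (forall z k, cdiff (fun l => g (l *: z)) k) ->
  measurable_fun setT (fun t : T => Re (g (cvec t))) ->
  vol.-integrable setT (fun t => (Re (g (cvec t)) * gauss_weight (cvec t))%:E) ->
  (\int[vol]_t (Re (g (cvec t)) * gauss_weight (cvec t)) = Re (g 0) * (2 * pi) ^+ n)%R.
Proof.
move=> dg mg ig.
pose G t := Re (g (cvec t)); pose w (t : T) := gauss_weight (cvec t).
have mw : measurable_fun setT w by exact: measurable_weight.
have pi2 : 0 < 2 * pi :> R by rewrite mulr_gt0// pi_gt0.
pose A : set mR := `[0, 2 * pi]%classic.
have mA : measurable A by exact: measurable_itv.
have muA : mu A = (2 * pi)%:E.
  by rewrite lebesgue_measure_itv/= lte_fin pi2 oppr0 adde0.
(* The indicator of [0, 2 pi] turns the average over the angle into an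
   integral over a product of full spaces. *)
pose f (p : mR * T) : \bar R := (\1_A p.1 * (G (rotate p) * w p.2))%:E.
have mf : measurable_fun setT f.
  apply/measurable_EFinP; apply: measurable_funM.
    by apply: measurableT_comp => //; exact: measurable_indic.
  apply: measurable_funM; last exact: measurableT_comp.
  by apply: (measurableT_comp mg); exact: measurable_rotate.
have rotE (H : R -> R) v : measurable_fun setT H ->
  (\int[vol]_t (H (G (rotate (v, t)) * w t))%:E = \int[vol]_t (H (G t * w t))%:E)%E.
  move=> mH; have [tau ptau Htau] := volume_preserving_rotation n (cos2Dsin2 v).
  rewrite -[RHS](volume_preserving_integral ptau (F := fun t => (H (G t * w t))%:E)).
    apply: eq_integral => t _; rewrite /G /w cvec_rotate Htau gauss_weightZ//.
    by rewrite /= cos2Dsin2 sqrtr1.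
  by apply/measurable_EFinP; apply: measurableT_comp => //; exact: measurable_funM.
have [K KE] : exists K : R, (\int[vol]_t (`|G t * w t|)%:E = K%:E)%E.
  exists (fine (\int[vol]_t (`|G t * w t|)%:E)); rewrite fineK//.
  have /integrableP[_ ] := ig; rewrite ge0_fin_numE//.
  by apply: integral_ge0 => t _; rewrite lee_fin.
have indA : (\int[mu]_v (\1_A v)%:E = (2 * pi)%:E)%E.
  by rewrite integral_indic// setIT; exact: muA.
have iA : mu.-integrable setT (fun v => (\1_A v)%:E).
  apply/integrableP; split; first by apply/measurable_EFinP; exact: measurable_indic.
  under eq_integral do rewrite gee0_abs ?lee_fin//.
  by rewrite indA ltry.
have intA (c : R) : (\int[mu]_v ((\1_A v)%:E * c%:E) = (c * (2 * pi))%:E)%E.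
  by rewrite integralZr// indA -EFinM [c * _]mulrC.
have intf : (mu \x vol)%E.-integrable setT f.
  apply: (proj2 (@integrable12ltyP _ _ _ _ R mu vol f mf)).
  rewrite (eq_integral (fun v => (\1_A v)%:E * K%:E)%E); first by rewrite intA ltry.
  move=> v _; rewrite -KE -(rotE Num.Def.normr v)// -ge0_integralZl//.
  - by apply: eq_integral => t _; rewrite -EFinM /f /= normrM ger0_norm.
  - apply/measurable_EFinP; apply: measurableT_comp => //; apply: measurable_funM => //.
    apply: (measurableT_comp mg); apply: (measurableT_comp measurable_rotate).
    exact: pair1_measurable.
have := Fubini intf.
rewrite (eq_integral (fun v => (\1_A v)%:E * (\int[vol]_t (G t * w t)%:E))%E); last first.
  move=> v _; rewrite -(rotE id v)// /f /=.
  rewrite indicE; case: (v \in A) => /=; first by under eq_integral do rewrite mul1r; rewrite mul1e.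
  by under eq_integral do rewrite mul0r; rewrite integral0 mul0e.
rewrite [RHS](eq_integral (fun t => (Re (g 0) * (2 * pi))%:E * (w t)%:E)%E); last first.
  move=> t _; pose h v := Re (g ((cos v +i* sin v) *: cvec t)).
  have hE := circle_mean (dg (cvec t)); rewrite scale0r -/h in hE.
  have ch : continuous h := continuous_circle (dg (cvec t)).
  have ih : mu.-integrable A (EFin \o h) by exact: itg_integrable.
  transitivity (\int[mu]_(v in A) ((h v)%:E * (w t)%:E))%E.
    rewrite [RHS]integral_mkcond; apply: eq_integral => v _.
    rewrite patchE /f /= indicE; case: ifP => _; last by rewrite mul0r.
    by rewrite mul1r EFinM /G cvec_rotate.
  rewrite integralZr//; congr (_ * _)%E.
  rewrite -hE /itg add0r /Rintegral fineK//; exact: integrable_fin_num.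
have fI : (\int[vol]_t (G t * w t)%:E)%E \is a fin_num by exact: integrable_fin_num.
rewrite integralZl//; last first.
  apply/integrableP; split; first exact/measurable_EFinP.
  under eq_integral do rewrite gee0_abs ?lee_fin ?expR_ge0//.
  by rewrite integral_weight ltry.
rewrite integral_weight -(fineK fI) intA -EFinM => -[].
rewrite [X in _ = X]mulrAC => /(mulIf _); apply.
by rewrite gt_eqF.
Qed.

End gaussian_mean.

(** * Integration against the normalized Gaussian *)

Section gaussian_integral.
Context (R : realType) (n : nat).
Local Notation C := R[i].
Local Notation Cn := 'rV[C]_n.
Local Notation mR := (measurableTypeR R).
Local Notation T := ((n + n).-tuple mR).
Local Notation cvec := (@cvec_of_reals R n).
Local Notation vol := (volume R n).
Local Notation gw := (@gauss_weight R n).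
Implicit Types (a b : Cn -> R) (f g h : Cn -> C) (z w : Cn).

Definition rmeas b := measurable_fun setT (fun t : T => b (cvec t)).
Definition gintegrable b := rmeas b /\
  vol.-integrable setT (fun t => (b (cvec t) * gw (cvec t))%:E).
(** The weight gauss_weight normalized to total mass 1 ([gint_cst]). *)
Definition gint b : R := (2 * pi)^-1 ^+ n * \int[vol]_t (b (cvec t) * gw (cvec t)).

Lemma gw_gt0 z : 0 < gw z. Proof. exact: expR_gt0. Qed.

Lemma gconst_gt0 : 0 < (2 * pi)^-1 ^+ n :> R.
Proof. by rewrite exprn_gt0// invr_gt0 mulr_gt0// pi_gt0. Qed.

Lemma rmeas_weighted b : rmeas b -> measurable_fun setT (fun t : T => (b (cvec t) * gw (cvec t))%:E).
Proof.
by move=> mb; apply/measurable_EFinP; apply: measurable_funM => //; exact: measurable_weight.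
Qed.

Lemma rmeasD a b : rmeas a -> rmeas b -> rmeas (fun z => a z + b z).
Proof. by move=> ma mb; apply: measurable_funD. Qed.
Lemma rmeasB a b : rmeas a -> rmeas b -> rmeas (fun z => a z - b z).
Proof. by move=> ma mb; apply: measurable_funB. Qed.
Lemma rmeasM a b : rmeas a -> rmeas b -> rmeas (fun z => a z * b z).
Proof. by move=> ma mb; apply: measurable_funM. Qed.
Lemma rmeas_cst (c : R) : rmeas (fun=> c).
Proof. exact: measurable_cst. Qed.
Lemma rmeas_sqnorm : rmeas (@sqnorm R n).
Proof.
rewrite /rmeas (_ : (fun _ => _) = @sqsum R n); first exact: measurable_sqsum.
by apply/funext => t; rewrite sqnorm_cvec.
Qed.
Lemma rmeas_expR b : rmeas b -> rmeas (fun z => expR (b z)).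
Proof. by move=> mb; apply: measurableT_comp. Qed.

Lemma gintegrableD a b : gintegrable a -> gintegrable b -> gintegrable (fun z => a z + b z).
Proof.
move=> [ma ia] [mb ib]; split; first exact: rmeasD.
apply: eq_integrable (integrableD measurableT ia ib) => //.
by move=> t _; rewrite /= mulrDl EFinD.
Qed.
Lemma gintegrableZ (c : R) b : gintegrable b -> gintegrable (fun z => c * b z).
Proof.
move=> [mb ib]; split; first by apply: rmeasM => //; exact: rmeas_cst.
apply: eq_integrable (integrableZl measurableT c ib) => //.
by move=> t _; rewrite /= -mulrA EFinM.
Qed.
Lemma gintegrableB a b : gintegrable a -> gintegrable b -> gintegrable (fun z => a z - b z).
Proof.
move=> ia ib; have := gintegrableD ia (gintegrableZ (-1) ib).
by congr gintegrable; apply/funext => z; rewrite mulN1r.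
Qed.
Lemma gintegrable_le a b : rmeas a -> (forall z, `|a z| <= b z) -> gintegrable b -> gintegrable a.
Proof.
move=> ma ab [mb ib]; split=> //.
apply: (le_integrable measurableT _ _ ib); first exact: rmeas_weighted.
move=> t _; rewrite !abse_EFin lee_fin !normrM.
by apply: ler_wpM2r => //; apply: le_trans (ab _) (ler_norm _).
Qed.
Lemma gintegrable_cst (c : R) : gintegrable (fun=> c).
Proof.
split; first exact: rmeas_cst.
have i1 : vol.-integrable setT (fun t : T => (gw (cvec t))%:E).
  apply/integrableP; split; first by apply/measurable_EFinP; exact: measurable_weight.
  under eq_integral do rewrite gee0_abs ?lee_fin ?expR_ge0//.
  by rewrite integral_weight ltry.
by apply: eq_integrable (integrableZl measurableT c i1).
Qed.
Lemma gintegrable_exp (c : R) : c < 1 / 2 -> gintegrable (fun z => expR (c * sqnorm z)).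
Proof.
move=> c2; split.
  by apply: rmeas_expR; apply: rmeasM; [exact: rmeas_cst|exact: rmeas_sqnorm].
have c0 : 0 < 1 / 2 - c by rewrite subr_gt0.
apply: eq_integrable (integrable_gauss n c0) => // t _.
by rewrite /gauss_weight -expRD sqnorm_cvec; congr (expR _)%:E; field.
Qed.

Lemma gintD a b : gintegrable a -> gintegrable b -> gint (fun z => a z + b z) = gint a + gint b.
Proof.
move=> [_ ia] [_ ib]; rewrite /gint -mulrDr -RintegralD//; congr (_ * _).
by apply: eq_Rintegral => t _; rewrite mulrDl.
Qed.
Lemma gintZ (c : R) b : gintegrable b -> gint (fun z => c * b z) = c * gint b.
Proof.
move=> [_ ib]; have E : \int[vol]_t (c * b (cvec t) * gw (cvec t)) =
    c * \int[vol]_t (b (cvec t) * gw (cvec t)).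
  by rewrite -RintegralZl//; apply: eq_Rintegral => t _; rewrite mulrA.
by rewrite /gint E mulrCA.
Qed.
Lemma gintB a b : gintegrable a -> gintegrable b -> gint (fun z => a z - b z) = gint a - gint b.
Proof.
move=> ia ib; rewrite -mulN1r -gintZ// -gintD//; last exact: gintegrableZ.
by congr gint; apply/funext => z; rewrite mulN1r.
Qed.
Lemma gint_le a b : gintegrable a -> gintegrable b -> (forall z, a z <= b z) -> gint a <= gint b.
Proof.
move=> [_ ia] [_ ib] ab; rewrite /gint ler_wpM2l ?(ltW gconst_gt0)//.
by apply: le_Rintegral => // t _; rewrite ler_wpM2r ?(ltW (gw_gt0 _)).
Qed.
Lemma gint_ge0 b : (forall z, 0 <= b z) -> 0 <= gint b.
Proof.
move=> b0; rewrite mulr_ge0 ?(ltW gconst_gt0)//.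
by apply: Rintegral_ge0 => t _; rewrite mulr_ge0 ?(ltW (gw_gt0 _)).
Qed.
Lemma gint_cst (c : R) : gint (fun=> c) = c.
Proof.
have -> : c = c * 1 by rewrite mulr1.
rewrite (gintZ c (gintegrable_cst 1)); congr (_ * _).
rewrite /gint; have -> : \int[vol]_t (1 * gw (cvec t)) = (2 * pi) ^+ n.
  rewrite /Rintegral; under eq_integral do rewrite mul1r.
  by rewrite integral_weight.
by rewrite -exprMn mulVf ?expr1n// gt_eqF// mulr_gt0// pi_gt0.
Qed.

Lemma gint_dominated (b_ : nat -> Cn -> R) b B :
  (forall k, rmeas (b_ k)) -> (forall z, b_ k z @[k --> \oo] --> b z) ->
  gintegrable B -> (forall k z, `|b_ k z| <= B z) ->
  gintegrable b /\ gint (b_ k) @[k --> \oo] --> gint b.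
Proof.
move=> mb bb [mB iB] bB.
have mb' : rmeas b.
  apply: (@measurable_fun_cvg _ _ _ setT (fun k t => b_ k (cvec t))) => [k|t _].
    exact: mb.
  exact: bb.
have [||i1 _ c1] := @dominated_convergence _ _ R vol setT measurableT
  (fun k t => (b_ k (cvec t) * gw (cvec t))%:E)
  (fun t => (b (cvec t) * gw (cvec t))%:E) (fun t => (B (cvec t) * gw (cvec t))%:E)
  (fun k => rmeas_weighted (mb k)) (rmeas_weighted mb') _ iB.
- apply: aeW => t _; apply/fine_cvgP; split; first exact: nearW.
  by apply: cvgMl; exact: bb.
- apply: aeW => t k _ /=; rewrite lee_fin normrM (gtr0_norm (gw_gt0 _)).
  by rewrite ler_wpM2r ?(ltW (gw_gt0 _)).
split; first by [].
apply: cvgMr; rewrite /Rintegral; apply: fine_cvg.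
by rewrite fineK//; exact: integrable_fin_num.
Qed.

Lemma gint_mean f : (forall z k, cdiff (fun l => f (l *: z)) k) ->
  gintegrable (fun z => Re (f z)) -> gint (fun z => Re (f z)) = Re (f 0).
Proof.
move=> df [mf inf]; rewrite /gint gaussian_mean// mulrC -mulrA -exprMn divff ?expr1n ?mulr1//.
by rewrite gt_eqF// mulr_gt0// pi_gt0.
Qed.

(** The hypothesis relates a and b through the weight rather than by a change
    of variable alone, because the translated weight differs from the weight
    by an exponential factor, to be absorbed in a. *)
Lemma gint_translation b a w : rmeas a -> gintegrable b ->
  (forall z, b (z + w) * gw (z + w) = a z * gw z) -> gintegrable a /\ gint b = gint a.
Proof.
move=> ma [mb ib] ba.
have [tau ptau Htau] := volume_preserving_translation w.
pose F t := (b (cvec t) * gw (cvec t))%:E.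
have mF : measurable_fun setT F by exact: rmeas_weighted.
have FE : (fun t => F (tau t)) = (fun t => (a (cvec t) * gw (cvec t))%:E).
  by apply/funext => t; rewrite /F Htau ba.
split.
  split=> //; apply/integrableP; split; first exact: rmeas_weighted.
  have /integrableP[_] := ib.
  have := @volume_preserving_integral R n tau (fun t => `|F t|%E) ptau.
  have -> : (fun t => `|F (tau t)|%E) = (fun t => `|(a (cvec t) * gw (cvec t))%:E|%E).
    by apply/funext => t; rewrite -[in RHS](congr1 (@^~ t) FE).
  by move=> -> //; exact: measurableT_comp.
rewrite /gint /Rintegral; congr (_ * fine _).
by rewrite -(volume_preserving_integral ptau mF) FE.
Qed.

End gaussian_integral.

(** * The inner product of the Fock space *)

Section fock_space.
Context (R : realType) (n : nat).
Local Notation C := R[i].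
Local Notation Cn := 'rV[C]_n.
Local Notation cvec := (@cvec_of_reals R n).
Local Notation vol := (volume R n).
Local Notation gw := (@gauss_weight R n).
Implicit Types (a b : Cn -> R) (f g h : Cn -> C) (z w : Cn).

Definition cmeas f := rmeas (fun z => Re (f z)) /\ rmeas (fun z => Im (f z)).
Definition cgintegrable f :=
  gintegrable (fun z => Re (f z)) /\ gintegrable (fun z => Im (f z)).
Definition cgint f : C := gint (fun z => Re (f z)) +i* gint (fun z => Im (f z)).

Lemma cmeasD f g : cmeas f -> cmeas g -> cmeas (f + g).
Proof.
move=> [f1 f2] [g1 g2]; split.
- rewrite (_ : (fun _ => _) = fun z => Re (f z) + Re (g z)); first exact: rmeasD.
  by apply/funext => z; rewrite ReD.
- rewrite (_ : (fun _ => _) = fun z => Im (f z) + Im (g z)); first exact: rmeasD.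
  by apply/funext => z; rewrite ImD.
Qed.
Lemma cmeasM f g : cmeas f -> cmeas g -> cmeas (fun z => f z * g z).
Proof.
move=> [f1 f2] [g1 g2]; split.
- rewrite (_ : (fun _ => _) = fun z => Re (f z) * Re (g z) - Im (f z) * Im (g z)).
    by apply: rmeasB; apply: rmeasM.
  by apply/funext => z; rewrite ReM.
- rewrite (_ : (fun _ => _) = fun z => Re (f z) * Im (g z) + Im (f z) * Re (g z)).
    by apply: rmeasD; apply: rmeasM.
  by apply/funext => z; rewrite ImM.
Qed.
Lemma cmeas_cst (c : C) : cmeas (fun=> c).
Proof. by split; exact: rmeas_cst. Qed.
Lemma cmeasZ (c : C) f : cmeas f -> cmeas (c *: f).
Proof. by move=> mf; apply: (cmeasM (cmeas_cst c) mf). Qed.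
Lemma cmeasJ f : cmeas f -> cmeas (fun z => (f z)^*).
Proof.
move=> [f1 f2]; split.
- by rewrite (_ : (fun _ => _) = fun z => Re (f z))//; apply/funext => z; rewrite ReJ.
- rewrite (_ : (fun _ => _) = fun z => (-1) * Im (f z)).
    by apply: rmeasM => //; exact: rmeas_cst.
  by apply/funext => z; rewrite ImJ mulN1r.
Qed.
Lemma rmeas_normc2 f : cmeas f -> rmeas (fun z => normc (f z) ^+ 2).
Proof.
move=> [f1 f2]; rewrite (_ : (fun _ => _) = fun z => Re (f z) * Re (f z) + Im (f z) * Im (f z)).
  by apply: rmeasD; apply: rmeasM.
by apply/funext => z; rewrite normc_sqr !expr2.
Qed.

Lemma cmeas_hdiff f : (forall z, hdiff f z) -> cmeas f.
Proof.
move=> df.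
have key (F : C -> R) : (forall z w : C, `|F z - F w| <= normc (z - w)) -> rmeas (fun z => F (f z)).
  move=> HF; apply: measurable_fun_of_continuous => t e e0.
  have [r r0 Hr] := hdiff_cont (df (cvec t)) e0.
  exists (r / (2 * n%:R + 1)) => [|s st].
    by rewrite divr_gt0// ltr_wpDl// mulr_ge0.
  apply: le_trans (HF _ _) _.
  have := Hr (cvec s - cvec t); rewrite [cvec t + _]addrC subrK; apply.
  rewrite /l1norm; apply: le_trans (_ : \sum_(j < n) 2 * (r / (2 * n%:R + 1)) <= _).
    apply: ler_sum => j _; rewrite !mxE -[X in normc X]/((_ - _) +i* (_ - _)).
    apply: le_trans (normc_le_ReIm _) _ => /=.
    by rewrite mulr_natl mulr2n lerD.
  rewrite sumr_const card_ord -[leLHS]mulr_natr.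
  have N0 : 0 < 2 * n%:R + 1 :> R by rewrite ltr_wpDl// mulr_ge0.
  rewrite [leLHS](_ : _ = r * ((2 * n%:R) / (2 * n%:R + 1))); last by ring.
  by rewrite ler_piMr ?(ltW r0)// ler_pdivrMr// mul1r lerDl.
split; apply: key => z w.
- by rewrite -ReB; exact: Re_le_normc.
- by rewrite -ImB; exact: Im_le_normc.
Qed.

Definition square_integrable f := cmeas f /\ gintegrable (fun z => normc (f z) ^+ 2).

Lemma fock_sqnormE f : square_integrable f ->
  fock_sqnorm f = (gint (fun z => normc (f z) ^+ 2))%:E.
Proof.
move=> [_ [_ i2]]; rewrite /fock_sqnorm /gint EFinM; congr (_ * _)%E.
by rewrite /Rintegral fineK//; exact: integrable_fin_num.
Qed.

(** A function of the space is continuous, hence measurable, which turns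
    finiteness of the norm into integrability. *)
Lemma fockP f : fock f <-> holomorphic f /\ square_integrable f.
Proof.
split=> [[hf sf]|[hf sf]]; last by split => //; rewrite fock_sqnormE// ltry.
split => //; have mf : cmeas f by apply: cmeas_hdiff => z; exact/differentiable_hdiff.
split => //; have m2 := rmeas_normc2 mf; split => //.
apply/integrableP; split; first exact: (rmeas_weighted m2).
have : (\int[vol]_t (normc (f (cvec t)) ^+ 2 * gw (cvec t))%:E < +oo)%E.
  have k0 := gconst_gt0 R n.
  move: sf; rewrite /fock_sqnorm; case: (\int[vol]_t _)%E => //.
  - by move=> r _; rewrite ltry.
  - by rewrite gt0_muley ?lte_fin// ltxx.
congr (_ < _)%E; apply: eq_integral => t _.
by rewrite gee0_abs// lee_fin mulr_ge0 ?sqr_ge0// ltW// gw_gt0.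
Qed.

Lemma fock_square_integrable f : fock f -> square_integrable f.
Proof. by move=> /fockP[]. Qed.

Lemma square_integrable_le f a : cmeas f -> (forall z, normc (f z) ^+ 2 <= a z) ->
  gintegrable a -> square_integrable f.
Proof.
move=> mf fa ia; split => //; apply: gintegrable_le (rmeas_normc2 mf) _ ia => z.
by rewrite ger0_norm ?sqr_ge0.
Qed.

Lemma normcD_sqr_le (u v : C) : normc (u + v) ^+ 2 <= 2 * normc u ^+ 2 + 2 * normc v ^+ 2.
Proof.
apply: le_trans (_ : (normc u + normc v) ^+ 2 <= _).
  by rewrite ler_pXn2r ?nnegrE ?addr_ge0 ?normc_ge0// normcD.
have := sqr_ge0 (normc u - normc v); rewrite sqrrB sqrrD; lra.
Qed.

Lemma square_integrableD f g : square_integrable f -> square_integrable g ->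
  square_integrable (f + g).
Proof.
move=> [mf i_f] [mg ig].
apply: square_integrable_le (cmeasD mf mg) _ (gintegrableD (gintegrableZ 2 i_f) (gintegrableZ 2 ig)).
by move=> z; exact: normcD_sqr_le.
Qed.
Lemma square_integrableZ (c : C) f : square_integrable f -> square_integrable (c *: f).
Proof.
move=> [mf i_f].
apply: square_integrable_le (cmeasZ c mf) _ (gintegrableZ (normc c ^+ 2) i_f) => z.
by rewrite normcM exprMn.
Qed.

Lemma cgintegrable_mulJ f g : square_integrable f -> square_integrable g ->
  cgintegrable (fun z => f z * (g z)^*).
Proof.
move=> [mf i_f] [mg ig].
have [m1 m2] := cmeasM mf (cmeasJ mg).
have bnd z : normc (f z * (g z)^*) <= normc (f z) ^+ 2 + normc (g z) ^+ 2.
  rewrite normcM normc_conj.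
  have := sqr_ge0 (normc (f z) - normc (g z)); rewrite sqrrB.
  have := normc_ge0 (f z); have := normc_ge0 (g z).
  have := sqr_ge0 (normc (f z)); have := sqr_ge0 (normc (g z)); lra.
split; apply: gintegrable_le (gintegrableD i_f ig) => // z.
- exact: le_trans (Re_le_normc _) (bnd z).
- exact: le_trans (Im_le_normc _) (bnd z).
Qed.

(** The two integrals that define the inner product are those of the real and
    imaginary parts. *)
Lemma fock_dotE f g : fock_dot f g = cgint (fun z => f z * (g z)^*).
Proof.
rewrite /fock_dot /cgint /gint; apply: eq_ReIm; rewrite ?ReM ?ImM /= mul0r ?subr0 ?addr0//.
Qed.

Lemma cgintD f g : cgintegrable f -> cgintegrable g -> cgint (fun z => f z + g z) = cgint f + cgint g.
Proof.
move=> [f1 f2] [g1 g2]; apply: eq_ReIm; rewrite ?ReD ?ImD /= -gintD//;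
  by congr gint; apply/funext => z; rewrite ?ReD ?ImD.
Qed.
Lemma cgintZ (c : C) f : cgintegrable f -> cgint (fun z => c * f z) = c * cgint f.
Proof.
move=> [f1 f2]; apply: eq_ReIm; rewrite ?ReM ?ImM /= -!gintZ//.
- rewrite -gintB; [|exact: gintegrableZ|exact: gintegrableZ].
  by congr gint; apply/funext => z; rewrite ReM.
- rewrite -gintD; [|exact: gintegrableZ|exact: gintegrableZ].
  by congr gint; apply/funext => z; rewrite ImM.
Qed.
Lemma cgintegrableZ (c : C) f : cgintegrable f -> cgintegrable (fun z => c * f z).
Proof.
move=> [f1 f2]; split.
- have := gintegrableB (gintegrableZ (Re c) f1) (gintegrableZ (Im c) f2).
  by congr gintegrable; apply/funext => z; rewrite ReM.
- have := gintegrableD (gintegrableZ (Re c) f2) (gintegrableZ (Im c) f1).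
  by congr gintegrable; apply/funext => z; rewrite ImM.
Qed.

Lemma fock_dotDl (c : C) f g h : square_integrable f -> square_integrable g ->
  square_integrable h ->
  fock_dot (c *: f + g) h = c * fock_dot f h + fock_dot g h.
Proof.
move=> Lf Lg Lh; rewrite !fock_dotE -cgintZ; last exact: cgintegrable_mulJ.
rewrite -cgintD; [|by apply: cgintegrableZ; exact: cgintegrable_mulJ|exact: cgintegrable_mulJ].
by congr cgint; apply/funext => z; rewrite mulrDl mulrA.
Qed.

Lemma fock_dotC f g : square_integrable f -> square_integrable g ->
  fock_dot g f = (fock_dot f g)^*.
Proof.
move=> Lf Lg; have [_ i2] := cgintegrable_mulJ Lf Lg.
rewrite !fock_dotE /cgint; apply: eq_ReIm; rewrite ?ReJ ?ImJ /=.
  by congr gint; apply/funext => z; rewrite !ReM !ReJ !ImJ; ring.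
rewrite -mulN1r -gintZ//; congr gint; apply/funext => z.
by rewrite !ImM !ReJ !ImJ; ring.
Qed.

Lemma fock_norm_ge0 f : 0 <= fock_norm f. Proof. exact: sqrtr_ge0. Qed.

Lemma fock_norm_sqr f : square_integrable f ->
  fock_norm f ^+ 2 = gint (fun z => normc (f z) ^+ 2).
Proof.
move=> Lf; rewrite /fock_norm fock_sqnormE//= sqr_sqrtr//.
by apply: gint_ge0 => z; exact: sqr_ge0.
Qed.

Lemma fock_dotff f : square_integrable f -> fock_dot f f = (fock_norm f ^+ 2)%:C.
Proof.
move=> Lf; rewrite fock_dotE fock_norm_sqr//; apply: eq_ReIm => /=.
  by congr gint; apply/funext => z; rewrite mulcJ.
rewrite -[RHS](gint_cst n 0); congr gint; apply/funext => z.
by rewrite mulcJ.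
Qed.

Lemma fock_dotZl (c : C) f h : square_integrable f -> square_integrable h ->
  fock_dot (c *: f) h = c * fock_dot f h.
Proof.
move=> Lf Lh; rewrite !fock_dotE -cgintZ; last exact: cgintegrable_mulJ.
by congr cgint; apply/funext => z; rewrite mulrA.
Qed.

Lemma fock_dotZr (c : C) f h : square_integrable f -> square_integrable h ->
  fock_dot f (c *: h) = c^* * fock_dot f h.
Proof.
move=> Lf Lh; rewrite [LHS]fock_dotC//; last exact: square_integrableZ.
by rewrite fock_dotZl// conjcM -fock_dotC.
Qed.

Lemma fock_dotDr f g h : square_integrable f -> square_integrable g ->
  square_integrable h -> fock_dot h (f + g) = fock_dot h f + fock_dot h g.
Proof.
move=> Lf Lg Lh; rewrite [LHS]fock_dotC//; last exact: square_integrableD.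
have := @fock_dotDl 1 f g h Lf Lg Lh; rewrite scale1r mul1r => ->.
by rewrite conjcD -!fock_dotC.
Qed.

Lemma fock_dotDl1 f g h : square_integrable f -> square_integrable g ->
  square_integrable h -> fock_dot (f + g) h = fock_dot f h + fock_dot g h.
Proof. by move=> Lf Lg Lh; have := @fock_dotDl 1 f g h Lf Lg Lh; rewrite scale1r mul1r. Qed.

Lemma fock_normD_sqr f g : square_integrable f -> square_integrable g ->
  fock_norm (f + g) ^+ 2 = fock_norm f ^+ 2 + fock_norm g ^+ 2 + 2 * Re (fock_dot f g).
Proof.
move=> Lf Lg; have Lfg := square_integrableD Lf Lg.
have -> : fock_norm (f + g) ^+ 2 = Re (fock_dot (f + g) (f + g)) by rewrite fock_dotff.
rewrite fock_dotDl1// !fock_dotDr// !fock_dotff// (fock_dotC Lf Lg) !ReD ReJ /=; ring.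
Qed.

Lemma fock_normZ (c : C) f : square_integrable f -> fock_norm (c *: f) = normc c * fock_norm f.
Proof.
move=> Lf; apply/eqP; rewrite -(@eqrXn2 _ 2)// ?mulr_ge0 ?normc_ge0 ?fock_norm_ge0//.
rewrite exprMn !fock_norm_sqr//; last exact: square_integrableZ.
rewrite -gintZ; last by case: Lf.
by apply/eqP; congr gint; apply/funext => z; rewrite normcM exprMn.
Qed.

(** The norm of f - t <f,g> g has a nonnegative square for all real t; t =
    ||g||^-2 gives the claim, and a large t settles the case ||g|| = 0. *)
Lemma fock_cauchy_schwarz f g : square_integrable f -> square_integrable g ->
  normc (fock_dot f g) <= fock_norm f * fock_norm g.
Proof.
move=> Lf Lg.
set F := fock_norm f; set N := fock_norm g; set d := fock_dot f g.
have F0 : 0 <= F := fock_norm_ge0 _; have N0 : 0 <= N := fock_norm_ge0 _.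
have key t : 0 <= F ^+ 2 - 2 * t * normc d ^+ 2 + t ^+ 2 * normc d ^+ 2 * N ^+ 2.
  have := sqr_ge0 (fock_norm (f + ((- t)%:C * d) *: g)).
  rewrite fock_normD_sqr//; last exact: square_integrableZ.
  have -> : fock_dot f (((- t)%:C * d) *: g) = (- t * normc d ^+ 2)%:C.
    by rewrite fock_dotZr// conjcM conjcR -/d realcM -mulcJ; ring.
  rewrite fock_normZ// normcM normc_real normrN /= -/F -/N.
  rewrite !exprMn real_normK ?num_real//.
  by congr (_ <= _); ring.
rewrite -(@ler_pXn2r _ 2) ?nnegrE ?normc_ge0 ?mulr_ge0// exprMn.
set be := normc d ^+ 2 in key *.
have be0 : 0 <= be by exact: sqr_ge0.
have [N00|Nn0] := eqVneq N 0.
  rewrite N00 expr0n mulr0.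
  have [//|be1] := leP be 0.
  have := key ((F ^+ 2 + 1) / (2 * be)).
  rewrite N00 expr0n mulr0 addr0.
  have -> : 2 * ((F ^+ 2 + 1) / (2 * be)) * be = F ^+ 2 + 1 by field; rewrite gt_eqF.
  by rewrite opprD addrA subrr; lra.
have N2 : 0 < N ^+ 2 by rewrite exprn_gt0// lt_neqAle eq_sym Nn0.
have := key (N ^+ 2)^-1.
have -> : F ^+ 2 - 2 * (N ^+ 2)^-1 * be + (N ^+ 2)^-1 ^+ 2 * be * N ^+ 2 =
   F ^+ 2 - be / N ^+ 2 by field.
by rewrite subr_ge0 ler_pdivrMr.
Qed.

Lemma fock_normD f g : square_integrable f -> square_integrable g ->
  fock_norm (f + g) <= fock_norm f + fock_norm g.
Proof.
move=> Lf Lg; rewrite -(@ler_pXn2r _ 2) ?nnegrE ?addr_ge0 ?fock_norm_ge0//.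
rewrite fock_normD_sqr// sqrrD.
have := le_trans (le_trans (ler_norm _) (Re_le_normc _)) (fock_cauchy_schwarz Lf Lg).
lra.
Qed.

End fock_space.

Local Notation fL := fock_square_integrable.

(** * The reproducing kernel *)

Section kernel.
Context (R : realType) (n : nat).
Local Notation C := R[i].
Local Notation Cn := 'rV[C]_n.
Local Notation gw := (@gauss_weight R n).
Local Notation sqnorm := (@sqnorm R n).
Implicit Types (f g h : Cn -> C) (z w : Cn).

Definition dotc z w : C := \sum_j z ord0 j * (w ord0 j)^*.

Lemma dotcDl z z' w : dotc (z + z') w = dotc z w + dotc z' w.
Proof. by rewrite /dotc -big_split/=; apply: eq_bigr => j _; rewrite mxE mulrDl. Qed.
Lemma dotcZl (c : C) z w : dotc (c *: z) w = c * dotc z w.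
Proof. by rewrite /dotc mulr_sumr; apply: eq_bigr => j _; rewrite mxE mulrA. Qed.
Lemma dotcC z w : dotc w z = (dotc z w)^*.
Proof.
rewrite /dotc conjc_sum; apply: eq_bigr => j _; rewrite conjcM mulrC.
by congr (_ * _); rewrite [RHS]conjCK.
Qed.
Lemma dotcDr z w w' : dotc z (w + w') = dotc z w + dotc z w'.
Proof. by rewrite dotcC dotcDl conjcD -!dotcC. Qed.
Lemma dotcZr (c : C) z w : dotc z (c *: w) = c^* * dotc z w.
Proof. by rewrite dotcC dotcZl conjcM -dotcC. Qed.
Lemma dotcNl z w : dotc (- z) w = - dotc z w.
Proof. by rewrite -scaleN1r dotcZl mulN1r. Qed.
Lemma dotcNr z w : dotc z (- w) = - dotc z w.
Proof. by rewrite dotcC dotcNl conjcN -dotcC. Qed.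
Lemma dotczz z : dotc z z = (sqnorm z)%:C.
Proof.
rewrite /dotc /Defs.sqnorm; apply: eq_ReIm; rewrite ?Re_sum ?Im_sum /=.
  by apply: eq_bigr => j _; rewrite mulcJ.
by apply: big1 => j _; rewrite mulcJ.
Qed.
Lemma sqnorm_ge0 z : 0 <= sqnorm z.
Proof. by apply: sumr_ge0 => j _; exact: sqr_ge0. Qed.
Lemma sqnormD z w : sqnorm (z + w) = sqnorm z + sqnorm w + 2 * Re (dotc z w).
Proof.
have : dotc (z + w) (z + w) = dotc z z + dotc w w + (dotc z w + dotc w z).
  by rewrite dotcDl !dotcDr; ring.
rewrite !dotczz (dotcC z w) => /(congr1 Re); rewrite !ReD ReJ /= => ->; ring.
Qed.
Lemma sqnormZ (c : C) z : sqnorm (c *: z) = normc c ^+ 2 * sqnorm z.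
Proof.
rewrite /Defs.sqnorm mulr_sumr; apply: eq_bigr => j _.
by rewrite mxE normcM exprMn.
Qed.
Lemma sqnormN z : sqnorm (- z) = sqnorm z.
Proof. by apply: eq_bigr => j _; rewrite mxE normcNE. Qed.
Lemma sqnorm0 : sqnorm 0 = 0.
Proof. by apply: big1 => j _; rewrite mxE normc0E expr0n. Qed.
Lemma sqnorm_eq0 z : sqnorm z = 0 -> z = 0.
Proof.
move=> z0; apply/rowP => j; rewrite mxE; apply: normc_eq0; apply/eqP.
rewrite -sqrf_eq0; apply/eqP.
have := z0; rewrite /Defs.sqnorm => /eqP.
by rewrite psumr_eq0 => [/allP/(_ j (mem_index_enum _))/eqP//|i _]; exact: sqr_ge0.
Qed.
Lemma normc_coord_sqnorm (z : Cn) j : normc (z ord0 j) ^+ 2 <= sqnorm z.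
Proof.
rewrite /Defs.sqnorm (bigD1 j)//= lerDl.
by apply: sumr_ge0 => i _; exact: sqr_ge0.
Qed.

(** Cauchy-Schwarz in the form of a sum with a free parameter d: the exponents
    of Gaussian bounds need a small multiple of |z|^2. *)
Lemma normc_dotc_le (d : R) z w : 0 < d ->
  normc (dotc z w) <= d * sqnorm z + (4 * d)^-1 * sqnorm w.
Proof.
move=> d0; apply: le_trans (normc_sum _ _ _) _.
rewrite /Defs.sqnorm !mulr_sumr -big_split/=; apply: ler_sum => j _.
rewrite normcM normc_conj; set x := normc _; set y := normc _.
have := sqr_ge0 (2 * d * x - y).
have d4 : 0 < 4 * d by rewrite mulr_gt0.
have -> : d * x ^+ 2 + (4 * d)^-1 * y ^+ 2 = (4 * d)^-1 * (2 * d * x - y) ^+ 2 + x * y.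
  by field; rewrite gt_eqF.
by move=> s0; rewrite lerDr mulr_ge0// invr_ge0 ltW.
Qed.

Lemma ReZ (x : R) (c : C) : Re (x%:C * c) = x * Re c.
Proof. by rewrite ReM /= mul0r subr0. Qed.

Definition kernel w : Cn -> C := fun z => cexp (2^-1%:C * dotc z w).

Lemma normc_kernel w z : normc (kernel w z) = expR (Re (dotc z w) / 2).
Proof. by rewrite normc_cexp ReZ mulrC. Qed.

Lemma normc_kernel_le w z : normc (kernel w z) <= expR (1 / 8 * sqnorm z + 1 / 2 * sqnorm w).
Proof.
rewrite normc_kernel ler_expR.
have d0 : 0 < 1 / 4 :> R by [].
have := le_trans (ler_norm _) (le_trans (Re_le_normc _) (normc_dotc_le z w d0)).
have -> : (4 * (1 / 4))^-1 = 1 :> R by field.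
by move=> h; rewrite ler_pdivrMr//; lra.
Qed.

(** Kernels and inner products with kernels are differentiated with a
    quadratic bound of the remainder, which is stronger and simpler to handle.
    *)
Lemma hdiff_of_quadratic f z (a : 'I_n -> C) (M : R) : 0 <= M ->
  (forall h : Cn, l1norm h <= 1 ->
    normc (f (z + h) - f z - \sum_j a j * h ord0 j) <= M * l1norm h ^+ 2) ->
  hdiff f z.
Proof.
move=> M0 H; exists a => e e0.
have M1 : 0 < M + 1 by rewrite ltr_wpDl.
exists (Num.min 1 (e / (M + 1))) => [|h]; first by rewrite lt_min ltr01 divr_gt0.
rewrite le_min => /andP[h1 he]; apply: le_trans (H h h1) _.
rewrite expr2 mulrA ler_wpM2r ?l1norm_ge0//.
apply: le_trans (_ : (M + 1) * l1norm h <= _).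
  by rewrite ler_wpM2r ?l1norm_ge0// lerDl.
by rewrite mulrC -ler_pdivlMr.
Qed.

Lemma hdiff_kernel w z : hdiff (kernel w) z.
Proof.
pose W := l1norm w + 1.
have W0 : 0 < W by rewrite ltr_wpDl// l1norm_ge0.
apply: (@hdiff_of_quadratic _ _ (fun j => kernel w z * (2^-1%:C * (w ord0 j)^*))
  (normc (kernel w z) * (4 * W ^+ 2 * expR W))).
  by rewrite mulr_ge0 ?normc_ge0// mulr_ge0 ?expR_ge0// mulr_ge0// sqr_ge0.
move=> h h1.
have -> : \sum_j kernel w z * (2^-1%:C * (w ord0 j)^*) * h ord0 j =
    kernel w z * (2^-1%:C * dotc h w).
  rewrite /dotc !mulr_sumr; apply: eq_bigr => j _; ring.
have -> : kernel w (z + h) = kernel w z * cexp (2^-1%:C * dotc h w).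
  by rewrite /kernel dotcDl mulrDr cexpD.
set x := 2^-1%:C * dotc h w.
have xW : normc x <= W * l1norm h.
  rewrite normcM normc_real ger0_norm ?invr_ge0//.
  apply: le_trans (_ : 1 * normc (dotc h w) <= _).
    by rewrite ler_wpM2r ?normc_ge0// invf_le1// ler1n.
  rewrite mul1r; apply: le_trans (normc_sum _ _ _) _.
  rewrite mulrC /l1norm mulr_suml; apply: ler_sum => j _.
  rewrite normcM normc_conj ler_wpM2l ?normc_ge0//.
  by apply: le_trans (normc_coord_le _ _) _; rewrite lerDl.
rewrite (_ : _ - _ - _ = kernel w z * (cexp x - 1 - x)); last by ring.
rewrite normcM -[leRHS]mulrA ler_wpM2l ?normc_ge0//.
apply: le_trans (cexp_taylor x) _.
have xW1 : normc x <= W.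
  by apply: le_trans xW _; rewrite ler_piMr// ltW.
have -> : 4 * W ^+ 2 * expR W * l1norm h ^+ 2 = 4 * (W * l1norm h) ^+ 2 * expR W by ring.
have x2 : normc x ^+ 2 <= (W * l1norm h) ^+ 2.
  rewrite ler_pXn2r ?nnegrE ?normc_ge0// mulr_ge0 ?l1norm_ge0//; exact: ltW.
apply: ler_pM; [by rewrite mulr_ge0// sqr_ge0|exact: expR_ge0|by rewrite ler_wpM2l|].
by rewrite ler_expR.
Qed.

Lemma square_integrable_kernel w : square_integrable (kernel w).
Proof.
apply: (@square_integrable_le R n _ (fun z => expR (sqnorm w) * expR (1 / 4 * sqnorm z))).
- by apply: cmeas_hdiff => z; exact: hdiff_kernel.
- move=> z; rewrite normc_kernel -expRM_natl -expRD ler_expR.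
  have d0 : 0 < 1 / 4 :> R by [].
  have := le_trans (ler_norm _) (le_trans (Re_le_normc _) (normc_dotc_le z w d0)).
  have -> : (4 * (1 / 4))^-1 = 1 :> R by field.
  move=> h; have -> : 2%:R * (Re (dotc z w) / 2) = Re (dotc z w) by field.
  by lra.
- apply: gintegrableZ; apply: gintegrable_exp.
  by rewrite ltr_pM2l// ltf_pV2// ?posrE// ltr_nat.
Qed.

Lemma fock_kernel w : fock (kernel w).
Proof.
apply/fockP; split; last exact: square_integrable_kernel.
by move=> z; apply: hdiff_differentiable; exact: hdiff_kernel.
Qed.

Lemma fockD f g : fock f -> fock g -> fock (f + g).
Proof.
move=> /fockP[hf Lf] /fockP[hg Lg]; apply/fockP; split; last exact: square_integrableD.
by move=> z; exact: (@differentiableD C Cn C f g z (hf z) (hg z)).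
Qed.
Lemma fockZ (c : C) f : fock f -> fock (c *: f).
Proof.
move=> /fockP[hf Lf]; apply/fockP; split; last exact: square_integrableZ.
by move=> z; exact: (@differentiableZ C Cn C f c z (hf z)).
Qed.
Lemma fockB f g : fock f -> fock g -> fock (f - g).
Proof.
move=> Ff Fg; have -> : f - g = f + (-1 : C) *: g.
  by apply/funext => z; apply/esym; rewrite -[LHS]/(f z + (-1) * g z) mulN1r.
exact: (fockD Ff (fockZ (-1) Fg)).
Qed.

Lemma hdiff_translate f z w : hdiff f (z + w) -> hdiff (fun z => f (z + w)) z.
Proof.
move=> [a Ha]; exists a => e e0; have [r r0 Hr] := Ha e e0.
by exists r => // h hr; rewrite [z + h + w]addrAC; exact: Hr.
Qed.

Lemma gauss_weight_cexp z : (gw z)%:C = cexp ((- sqnorm z / 2)%:C).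
Proof. by rewrite cexp_real. Qed.

(** After the translation z -> z + w the product of f, the conjugate of K_w
    and the weight becomes f(z + w) K_(-w)(z) times the weight. The first two
    factors are holomorphic, so the Gaussian mean value property gives their
    value f(w) at z = 0. *)
Lemma Re_fock_dot_kernel f w : fock f -> Re (fock_dot f (kernel w)) = Re (f w).
Proof.
move=> Ff; have [hf Lf] := (fockP f).1 Ff.
have df z : hdiff f z by exact: differentiable_hdiff.
pose P z := f z * (kernel w z)^*.
pose g z := f (z + w) * kernel (- w) z.
have [iP _] : cgintegrable P by apply: cgintegrable_mulJ => //; exact: square_integrable_kernel.
have [mg _] : cmeas g.
  apply: cmeasM; apply: cmeas_hdiff => z; last exact: hdiff_kernel.
  exact: hdiff_translate.
have dg z k : cdiff (fun l => g (l *: z)) k.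
  apply: cdiff_mul; first exact: hdiff_line.
  rewrite (_ : (fun _ => _) = @cexp R \o (fun l => (2^-1%:C * dotc z (- w)) * l + 0)); last first.
    by apply/funext => l; rewrite /= /kernel dotcZl addr0; congr cexp; ring.
  by apply: cdiff_comp; [exact: cdiff_cexp|exact: cdiff_id_scale].
have Pg z : Re (P (z + w)) * gw (z + w) = Re (g z) * gw z.
  have ReR (c : C) (x : R) : Re c * x = Re (c * x%:C) by rewrite [c * _]mulrC ReZ mulrC.
  rewrite !ReR; congr Re.
  rewrite /P /g -!mulrA; congr (_ * _).
  have cE u : (kernel w u)^* = cexp (2^-1%:C * dotc w u).
    by rewrite /kernel cexpJ conjcM conjcR -dotcC.
  rewrite cE /kernel !gauss_weight_cexp -!cexpD; congr cexp.
  have hE (x : R) : (- x / 2)%:C = - (2^-1%:C * x%:C).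
    by rewrite -realcM -realcN; congr (_%:C); ring.
  rewrite !hE -!dotczz dotcNr dotcDl !dotcDr.
  have -> : 2^-1%:C = 2^-1 :> C.
    by rewrite fmorphV rmorph_nat.
  by field.
have [ig Eg] := gint_translation mg iP Pg.
rewrite fock_dotE /cgint /= Eg gint_mean// /g add0r /kernel.
by rewrite dotcNr -dotcNl oppr0 -[X in dotc X _](scale0r w) dotcZl mul0r mulr0 cexp0 mulr1.
Qed.

End kernel.

(** * Pointwise limits of bounded sequences *)

Section limit.
Context (R : realType) (n : nat).
Local Notation C := R[i].
Local Notation Cn := 'rV[C]_n.
Local Notation gw := (@gauss_weight R n).
Local Notation sqnorm := (@sqnorm R n).
Local Notation mR := (measurableTypeR R).
Local Notation T := ((n + n).-tuple mR).
Local Notation cvec := (@cvec_of_reals R n).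
Local Notation vol := (volume R n).
Implicit Types (f g h : Cn -> C) (z w : Cn).

(** The real part is known for all functions of the space; applied to -i f it
    gives the imaginary part. *)
Lemma fock_dot_kernel f w : fock f -> fock_dot f (kernel w) = f w.
Proof.
move=> Ff; apply: eq_ReIm; first exact: Re_fock_dot_kernel.
have := Re_fock_dot_kernel w (fockZ (0 -i* 1) Ff).
rewrite fock_dotZl; [|exact: fock_square_integrable|exact: square_integrable_kernel].
rewrite (_ : (_ *: f) w = (0 -i* 1) * f w)// !ReM /= !mul0r !mulN1r.
by rewrite !sub0r !opprK.
Qed.

Lemma fock_norm_kernel w : fock_norm (kernel w) = expR (sqnorm w / 4).
Proof.
apply/eqP; rewrite -(@eqrXn2 _ 2)// ?fock_norm_ge0 ?expR_ge0//.
have := fock_dot_kernel w (fock_kernel w).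
rewrite fock_dotff; last exact: square_integrable_kernel.
rewrite /kernel dotczz -realcM cexp_real => -[->].
by rewrite -expRM_natl; apply/eqP; congr expR; field.
Qed.

(** The growth estimate that drives everything below: point evaluations are
    bounded, with the sharp constant ||K_w||. *)
Lemma fock_eval_le f w : fock f -> normc (f w) <= fock_norm f * expR (sqnorm w / 4).
Proof.
move=> Ff; rewrite -fock_norm_kernel -(fock_dot_kernel w Ff).
by apply: fock_cauchy_schwarz; [exact: fock_square_integrable|exact: square_integrable_kernel].
Qed.

(** Fatou's lemma with real integrals; the uniform bound provides the
    integrability of the limit. *)
Lemma gint_fatou (a_ : nat -> Cn -> R) a (m : R) : (forall k, gintegrable (a_ k)) ->
  (forall k z, 0 <= a_ k z) -> (forall z, a_ k z @[k --> \oo] --> a z) ->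
  (forall k, gint (a_ k) <= m) -> gintegrable a /\ gint a <= m.
Proof.
move=> ia a0 aa am.
have ma : rmeas a.
  apply: (@measurable_fun_cvg _ _ _ setT (fun k t => a_ k (cvec t))) => [k|t _].
    exact: (ia k).1.
  exact: aa.
have pos z : 0 <= a z.
  rewrite -(cvg_lim _ (aa z))//; apply: limr_ge; last exact: nearW.
  by apply/cvg_ex; exists (a z); exact: aa.
pose W k t := (a_ k (cvec t) * gw (cvec t))%:E.
have W0 k t : (0 <= W k t)%E by rewrite lee_fin mulr_ge0 ?(ltW (gw_gt0 _)).
have := @fatou _ T R vol setT measurableT W (fun k => rmeas_weighted (ia k).1) (fun k t _ => W0 k t).
have -> : (fun t => limn_einf (W ^~ t)) = (fun t => (a (cvec t) * gw (cvec t))%:E).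
  apply/funext => t; apply: (cvg_limn_einf_sup _).1.
  apply/fine_cvgP; split; first exact: nearW.
  by apply: cvgMl; exact: aa.
pose c := ((2 * pi)^-1 ^+ n : R).
have c0 : 0 < c := gconst_gt0 R n.
have Wm k : (\int[vol]_t W k t <= (m / c)%:E)%E.
  rewrite -(@fineK _ (\int[vol]_t W k t)%E); last exact: integrable_fin_num (ia k).2.
  by rewrite lee_fin ler_pdivlMr// mulrC; exact: am.
have lim_le : (limn_einf (fun k => \int[vol]_t W k t) <= (m / c)%:E)%E.
  rewrite limn_einf_lim; apply: lime_le; first exact: is_cvg_einfs.
  apply: nearW => k; apply: le_trans (Wm k).
  by apply: ereal_inf_lbound; exists k => /=.
move=> /le_trans/(_ lim_le) Hle.
have ia' : gintegrable a.
  split => //; apply/integrableP; split; first exact: rmeas_weighted.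
  apply: le_lt_trans (ltry (m / c)); apply: le_trans Hle.
  rewrite le_eqVlt; apply/orP; left; apply/eqP; apply: eq_integral => t _.
  by rewrite gee0_abs// lee_fin mulr_ge0 ?(ltW (gw_gt0 _)).
split => //; rewrite /gint -/c mulrC -ler_pdivlMr// /Rintegral -lee_fin fineK//.
exact: integrable_fin_num ia'.2.
Qed.

(** Convergence of complex sequences, expressed by a real null sequence. *)
Definition ccvg (x_ : nat -> C) (x : C) := normc (x_ k - x) @[k --> \oo] --> (0 : R).

Lemma ccvgP (x_ : nat -> C) x : ccvg x_ x <->
  forall e : R, 0 < e -> \forall k \near \oo, normc (x_ k - x) <= e.
Proof.
split=> [/cvgrPdist_le H e /H|H].
  by apply: filterS => k; rewrite sub0r normrN ger0_norm ?normc_ge0.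
apply/cvgrPdist_le => e /H.
by apply: filterS => k; rewrite sub0r normrN ger0_norm ?normc_ge0.
Qed.

Lemma ccvg_Re (x_ : nat -> C) x : ccvg x_ x -> Re (x_ k) @[k --> \oo] --> Re x.
Proof.
move=> /ccvgP H; apply/cvgrPdist_le => e /H; apply: filterS => k; apply: le_trans.
by rewrite -ReB normcB Re_le_normc.
Qed.
Lemma ccvg_Im (x_ : nat -> C) x : ccvg x_ x -> Im (x_ k) @[k --> \oo] --> Im x.
Proof.
move=> /ccvgP H; apply/cvgrPdist_le => e /H; apply: filterS => k; apply: le_trans.
by rewrite -ImB normcB Im_le_normc.
Qed.
Lemma ccvg_ReIm (x_ : nat -> C) x : Re (x_ k) @[k --> \oo] --> Re x ->
  Im (x_ k) @[k --> \oo] --> Im x -> ccvg x_ x.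
Proof.
move=> /cvgrPdist_le Hr /cvgrPdist_le Hi; apply/ccvgP => e e0.
have e2 : 0 < e / 2 by rewrite divr_gt0.
near=> k; rewrite normcB; apply: le_trans (normc_le_ReIm _) _.
rewrite ReB ImB [e]splitr lerD//; near: k; [exact: Hr|exact: Hi].
Unshelve. all: by end_near. Qed.
Lemma ccvgZ (c : C) (x_ : nat -> C) x : ccvg x_ x -> ccvg (fun k => c * x_ k) (c * x).
Proof.
move=> H; rewrite /ccvg; under eq_fun do rewrite -mulrBr normcM.
have := @cvgMr _ _ _ _ _ (normc c) _ H.
by rewrite mulr0; apply.
Qed.
Lemma ccvg_unique (x_ : nat -> C) x y : ccvg x_ x -> ccvg x_ y -> x = y.
Proof.
move=> Hx Hy; apply: eq_ReIm.
- exact: cvg_unique (ccvg_Re Hx) (ccvg_Re Hy).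
- exact: cvg_unique (ccvg_Im Hx) (ccvg_Im Hy).
Qed.
Lemma ccvg_normc_sqr (x_ : nat -> C) x : ccvg x_ x ->
  normc (x_ k) ^+ 2 @[k --> \oo] --> normc x ^+ 2.
Proof.
move=> H; rewrite normc_sqr !expr2; under eq_fun do rewrite normc_sqr !expr2.
have r := ccvg_Re H; have i := ccvg_Im H.
by apply: cvgD; apply: cvgM.
Qed.

(** The derivative of K_w(z) with respect to the conjugate of w_j. *)
Definition dkernel w (j : 'I_n) : Cn -> C :=
  fun z => kernel w z * (2^-1%:C * z ord0 j).

(** The remainder is quadratic in h, uniformly against exp(3/16 |z|^2), whose
    square is integrable for the weight exp(-|z|^2/2). *)
Lemma kernel_taylor w (h : Cn) z : l1norm h <= 1 ->
  normc (kernel (w + h) z - kernel w z - \sum_j (h ord0 j)^* * dkernel w j z) <=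
  l1norm h ^+ 2 * expR (1 / 2 * sqnorm w + 7) * expR (3 / 16 * sqnorm z).
Proof.
move=> h1; set s := sqnorm z; pose r := Num.sqrt s.
have rr : r ^+ 2 = s by rewrite sqr_sqrtr// sqnorm_ge0.
have r0 : 0 <= r := sqrtr_ge0 _.
set l := l1norm h; have l0 : 0 <= l := l1norm_ge0 _.
set x := 2^-1%:C * dotc z h.
have -> : \sum_j (h ord0 j)^* * dkernel w j z = kernel w z * x.
  rewrite /x /dotc !mulr_sumr; apply: eq_bigr => j _; rewrite /dkernel; ring.
have -> : kernel (w + h) z = kernel w z * cexp x.
  by rewrite /kernel dotcDr mulrDr cexpD.
rewrite (_ : _ - _ - _ = kernel w z * (cexp x - 1 - x)); last by ring.
have xr : 2 * normc x <= r * l.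
  rewrite normcM normc_real ger0_norm ?invr_ge0// mulrA divff// mul1r.
  apply: le_trans (normc_sum _ _ _) _; rewrite /l /l1norm mulr_sumr; apply: ler_sum => j _.
  rewrite normcM normc_conj ler_wpM2r ?normc_ge0//.
  by rewrite -(@ler_pXn2r _ 2) ?nnegrE ?normc_ge0// rr; exact: normc_coord_sqnorm.
have x0 := normc_ge0 x.
rewrite normcM; have k1 := normc_kernel_le w z; rewrite -/s in k1.
have k2 := cexp_taylor x.
have e1 : 4 * normc x ^+ 2 <= l ^+ 2 * (32 * expR (s / 32)).
  apply: le_trans (_ : l ^+ 2 * s <= _).
    have -> : 4 * normc x ^+ 2 = (2 * normc x) ^+ 2 by ring.
    rewrite -rr -exprMn mulrC ler_pXn2r ?nnegrE ?mulr_ge0// mulrC.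
    by rewrite [leRHS]mulrC.
  rewrite ler_wpM2l ?sqr_ge0//; have := expR_ge1Dx (s / 32); lra.
have e2 : expR (normc x) <= expR (s / 32 + 2).
  rewrite ler_expR -rr; have := sqr_ge0 (r - 8).
  have : r * l <= r by rewrite ler_piMr.
  rewrite sqrrB; lra.
have e3 : 32 <= expR 5 :> R.
  have -> : 32 = (1 + 1) ^+ 5 :> R by ring.
  have -> : 5 = 5%:R * 1 :> R by rewrite mulr1.
  rewrite expRM_natl ler_pXn2r ?nnegrE ?expR_ge0//; exact: expR_ge1Dx.
apply: le_trans (ler_pM (normc_ge0 _) (normc_ge0 _) k1 k2) _.
apply: le_trans (_ : expR (1 / 8 * s + 1 / 2 * sqnorm w) *
  (l ^+ 2 * (expR 5 * expR (s / 32)) * expR (s / 32 + 2)) <= _).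
  rewrite ler_wpM2l ?expR_ge0// ler_pM ?expR_ge0 ?mulr_ge0 ?sqr_ge0//.
  apply: le_trans e1 _; rewrite ler_wpM2l ?sqr_ge0// ler_wpM2r// expR_ge0//.
have -> : expR (1 / 8 * s + 1 / 2 * sqnorm w) * (l ^+ 2 * (expR 5 * expR (s / 32)) * expR (s / 32 + 2)) =
    l ^+ 2 * (expR (1 / 8 * s + 1 / 2 * sqnorm w) * expR 5 * expR (s / 32) * expR (s / 32 + 2)) by ring.
rewrite -[leRHS](mulrA (l ^+ 2)) ler_wpM2l ?sqr_ge0// -!expRD ler_expR; lra.
Qed.

Lemma hdiff_coord j z : hdiff (fun z => z ord0 j) z.
Proof.
exists (fun i => (i == j)%:R) => e e0.
exists 1 => // h _; rewrite (bigD1 j)//= big1 => [|i /negbTE ->]; last by rewrite mul0r.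
rewrite eqxx mul1r addr0 mxE (_ : _ - _ - _ = 0); last by ring.
by rewrite normc0E mulr_ge0 ?l1norm_ge0// ltW.
Qed.

Lemma square_integrable_dkernel w j : square_integrable (dkernel w j).
Proof.
apply: (@square_integrable_le R n _
  (fun z => 8 * expR (sqnorm w) * expR (3 / 8 * sqnorm z))).
- apply: cmeasM; first by apply: cmeas_hdiff => z; exact: hdiff_kernel.
  apply: cmeasM; first exact: cmeas_cst.
  by apply: cmeas_hdiff => z; exact: hdiff_coord.
- move=> z; rewrite /dkernel !normcM normc_real.
  have k1 := normc_kernel_le w z.
  have k2 : normc (kernel w z) ^+ 2 <= expR (1 / 4 * sqnorm z + sqnorm w).
    have -> : 1 / 4 * sqnorm z + sqnorm w = 2%:R * (1 / 8 * sqnorm z + 1 / 2 * sqnorm w) by field.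
    by rewrite expRM_natl ler_pXn2r ?nnegrE ?normc_ge0 ?expR_ge0.
  have k3 : (`|2^-1| * normc (z ord0 j)) ^+ 2 <= 8 * expR (1 / 8 * sqnorm z).
    have := normc_coord_sqnorm z j.
    rewrite ger0_norm ?invr_ge0// exprMn.
    have := expR_ge1Dx (1 / 8 * sqnorm z); have := sqr_ge0 (normc (z ord0 j)); lra.
  rewrite exprMn.
  have -> : 8 * expR (sqnorm w) * expR (3 / 8 * sqnorm z) =
      expR (1 / 4 * sqnorm z + sqnorm w) * (8 * expR (1 / 8 * sqnorm z)).
    by rewrite (mulrCA (expR _)) -expRD -mulrA -expRD; congr (_ * expR _); field.
  by apply: ler_pM => //; exact: sqr_ge0.
- apply: gintegrableZ; apply: gintegrable_exp; lra.
Qed.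

(** First order expansion of w -> <f, K_w> with a remainder controlled by
    ||f|| alone. Being uniform in f it serves three times: for holomorphy of
    limits, for the argument of Liouville and for equicontinuity. *)
Lemma dot_kernel_taylor w : exists2 D : R, 0 <= D & forall f (h : Cn),
  square_integrable f -> l1norm h <= 1 ->
  normc (fock_dot f (kernel (w + h)) - fock_dot f (kernel w) -
    \sum_j fock_dot f (dkernel w j) * h ord0 j) <= fock_norm f * D * l1norm h ^+ 2.
Proof.
pose c1 := expR (1 / 2 * sqnorm w + 7).
have c10 : 0 <= c1 := expR_ge0 _.
pose I := gint (fun z : Cn => expR (3 / 8 * sqnorm z)).
have I0 : 0 <= I by apply: gint_ge0 => z; exact: expR_ge0.
exists (c1 * Num.sqrt I) => [|f h Lf h1]; first by rewrite mulr_ge0// sqrtr_ge0.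
pose r : Cn -> C := kernel (w + h) - kernel w - \sum_j ((h ord0 j)^* *: dkernel w j).
have Lk v := @square_integrable_kernel R n v.
have LN g : square_integrable g -> square_integrable (- g).
  by move=> Lg; rewrite -scaleN1r; exact: square_integrableZ.
have dotN g : square_integrable g -> fock_dot f (- g) = - fock_dot f g.
  move=> Lg; rewrite -scaleN1r fock_dotZr//.
  by rewrite conjcN [1^*](conjcR (1 : R)) mulN1r.
have L0 : square_integrable (0 : Cn -> C).
  by have := square_integrableZ 0 Lf; rewrite scale0r.
have dot0 : fock_dot f 0 = 0.
  have := fock_dotZr 0 Lf Lf; rewrite scale0r => ->.
  by rewrite [0^*](conjcR (0 : R)) mul0r.
have [Ls dots] : square_integrable (\sum_j ((h ord0 j)^* *: dkernel w j)) /\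
  fock_dot f (\sum_j ((h ord0 j)^* *: dkernel w j)) = \sum_j fock_dot f (dkernel w j) * h ord0 j.
  elim/big_rec2 : _ => [//|j g c _ [Lc Ec]].
  have Lj := square_integrable_dkernel w j; have LZ := square_integrableZ (h ord0 j)^* Lj.
  split; first exact: square_integrableD.
  rewrite fock_dotDr// fock_dotZr// Ec; congr (_ + _).
  by rewrite [_^*^*]conjCK mulrC.
have Lkk := square_integrableD (Lk (w + h)) (LN _ (Lk w)).
have Lr : square_integrable r := square_integrableD Lkk (LN _ Ls).
have <- : fock_dot f r = fock_dot f (kernel (w + h)) - fock_dot f (kernel w) -
    \sum_j fock_dot f (dkernel w j) * h ord0 j.
  rewrite /r fock_dotDr//; last exact: LN.
  rewrite fock_dotDr//; last exact: LN.
  by rewrite !dotN// dots.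
apply: le_trans (fock_cauchy_schwarz Lf Lr) _.
rewrite -mulrA ler_wpM2l ?fock_norm_ge0//.
set l := l1norm h; have l0 : 0 <= l := l1norm_ge0 _.
rewrite -(@ler_pXn2r _ 2) ?nnegrE ?fock_norm_ge0 ?mulr_ge0 ?sqrtr_ge0 ?sqr_ge0//.
rewrite fock_norm_sqr// !exprMn sqr_sqrtr//.
have iE : gintegrable (fun z : Cn => expR (3 / 8 * sqnorm z)) by apply: gintegrable_exp; lra.
apply: le_trans (_ : gint (fun z => (c1 ^+ 2 * (l ^+ 2) ^+ 2) * expR (3 / 8 * sqnorm z)) <= _); last first.
  by rewrite gintZ// mulrAC.
apply: gint_le => [|| z]; [by case: Lr|exact: gintegrableZ|].
have := kernel_taylor w z h1; rewrite -/l -/c1.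
rewrite (_ : kernel (w + h) z - _ - _ = r z); last first.
  by rewrite /r [RHS](_ : _ = kernel (w + h) z - kernel w z - (\sum_j ((h ord0 j)^* *: dkernel w j)) z)// fct_sumE.
move=> H; have -> : 3 / 8 * sqnorm z = 2%:R * (3 / 16 * sqnorm z) by field.
by rewrite expRM_natl -!exprMn ler_pXn2r ?nnegrE ?normc_ge0 ?mulr_ge0 ?expR_ge0 ?sqr_ge0// (mulrC c1).
Qed.

Lemma hdiff_dot_kernel f w : square_integrable f -> hdiff (fun w => fock_dot f (kernel w)) w.
Proof.
move=> Lf; have [D D0 HD] := dot_kernel_taylor w.
apply: (@hdiff_of_quadratic _ _ _ _ (fun j => fock_dot f (dkernel w j)) (fock_norm f * D)).
  by rewrite mulr_ge0 ?fock_norm_ge0.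
by move=> h h1; exact: HD.
Qed.

(** Dominated convergence: the bound |u(z)| <= M exp(|z|^2/4) leaves room for
    the kernel. *)
Lemma ccvg_dot_kernel (u : nat -> Cn -> C) g (M : R) w : 0 <= M -> (forall k, fock (u k)) ->
  (forall k, fock_norm (u k) <= M) -> (forall z, ccvg (u^~ z) (g z)) ->
  square_integrable g -> ccvg (fun k => fock_dot (u k) (kernel w)) (fock_dot g (kernel w)).
Proof.
move=> M0 Fu uM ug Lg.
pose b k z := u k z * (kernel w z)^*.
have bg z : ccvg (b ^~ z) (g z * (kernel w z)^*).
  rewrite mulrC /b; under [X in ccvg X _]funext do rewrite mulrC.
  exact: ccvgZ.
have Lk := @square_integrable_kernel R n w.
have ib k := cgintegrable_mulJ (fock_square_integrable (Fu k)) Lk.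
pose B z := M * expR (1 / 2 * sqnorm w) * expR (3 / 8 * sqnorm z).
have iB : gintegrable B by apply: gintegrableZ; apply: gintegrable_exp; lra.
have bB k z : normc (b k z) <= B z.
  rewrite normcM normc_conj; apply: le_trans (_ : (M * expR (sqnorm z / 4)) * expR (1 / 8 * sqnorm z + 1 / 2 * sqnorm w) <= _).
    apply: ler_pM; rewrite ?normc_ge0//; last exact: normc_kernel_le.
    by apply: le_trans (fock_eval_le z (Fu k)) _; rewrite ler_wpM2r ?expR_ge0.
  rewrite /B -[leLHS]mulrA -[leRHS]mulrA ler_wpM2l// -!expRD ler_expR; lra.
rewrite /= fock_dotE; under [X in ccvg X _]funext do rewrite fock_dotE.
apply: ccvg_ReIm => /=.
- apply: (@gint_dominated _ _ (fun k z => Re (b k z)) (fun z => Re (g z * (kernel w z)^*)) B _ _ iB _).2.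
  + by move=> k; case: (ib k) => -[].
  + by move=> z; exact: ccvg_Re.
  + by move=> k z; apply: le_trans (Re_le_normc _) _.
- apply: (@gint_dominated _ _ (fun k z => Im (b k z)) (fun z => Im (g z * (kernel w z)^*)) B _ _ iB _).2.
  + by move=> k; case: (ib k) => _ [].
  + by move=> z; exact: ccvg_Im.
  + by move=> k z; apply: le_trans (Im_le_normc _) _.
Qed.

(** The limit g is square integrable by Fatou. The reproducing formula passes
    to the limit, so that g(w) = <g, K_w>, and the right-hand side is
    differentiable in w for any square integrable g. *)
Lemma fock_limit (u : nat -> Cn -> C) g (M : R) : (forall k, fock (u k)) ->
  (forall k, fock_norm (u k) <= M) -> (forall z, ccvg (u^~ z) (g z)) ->
  fock g /\ fock_norm g <= M.
Proof.
move=> Fu uM ug.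
have M0 : 0 <= M := le_trans (fock_norm_ge0 (u 0%N)) (uM 0%N).
have mg : cmeas g.
  split.
  - apply: (@measurable_fun_cvg _ _ _ setT (fun k t => Re (u k (cvec t)))) => [k|t _].
      exact: (fock_square_integrable (Fu k)).1.1.
    exact: ccvg_Re (ug _).
  - apply: (@measurable_fun_cvg _ _ _ setT (fun k t => Im (u k (cvec t)))) => [k|t _].
      exact: (fock_square_integrable (Fu k)).1.2.
    exact: ccvg_Im (ug _).
have [||ig gM] := @gint_fatou (fun k z => normc (u k z) ^+ 2) (fun z => normc (g z) ^+ 2) (M ^+ 2)
  (fun k => (fock_square_integrable (Fu k)).2) (fun k z => sqr_ge0 _) _ _.
- by move=> z; exact: ccvg_normc_sqr (ug z).
- move=> k; rewrite -fock_norm_sqr; last exact: fock_square_integrable.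
  by rewrite ler_pXn2r ?nnegrE ?fock_norm_ge0.
have Lg : square_integrable g by [].
split; last first.
  by rewrite -(@ler_pXn2r _ 2) ?nnegrE ?fock_norm_ge0// fock_norm_sqr.
apply/fockP; split => // z; apply: hdiff_differentiable.
rewrite (_ : g = fun w => fock_dot g (kernel w)); first exact: hdiff_dot_kernel.
apply/funext => w; apply: ccvg_unique (ug w) _.
have := ccvg_dot_kernel w M0 Fu uM ug Lg.
by congr (ccvg _ _); apply/funext => k; rewrite fock_dot_kernel.
Qed.

End limit.

(** * Completeness, Riesz representation and adjoints *)

Section hilbert.
Context (R : realType) (n : nat).
Local Notation C := R[i].
Local Notation Cn := 'rV[C]_n.
Local Notation sqnorm := (@sqnorm R n).
Implicit Types (f g h : Cn -> C) (z w : Cn).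

Lemma fock0 : fock (0 : Cn -> C).
Proof. by have := fockZ 0 (fock_kernel (0 : Cn)); rewrite scale0r. Qed.

Lemma fock_norm0 : fock_norm (0 : Cn -> C) = 0.
Proof.
by have := fock_normZ 0 (fL (fock_kernel (0 : Cn))); rewrite scale0r normc0E mul0r.
Qed.

Lemma fock_normN f : fock f -> fock_norm (- f) = fock_norm f.
Proof.
by move=> Ff; rewrite -scaleN1r fock_normZ ?normcNE ?normc1E ?mul1r//; exact: fL.
Qed.

Lemma fock_normBC f g : fock f -> fock g -> fock_norm (f - g) = fock_norm (g - f).
Proof. by move=> Ff Fg; rewrite -(fock_normN (fockB Ff Fg)) opprB. Qed.

Lemma fock_dotNr f g : fock f -> fock g -> fock_dot f (- g) = - fock_dot f g.
Proof.
move=> Ff Fg; rewrite -scaleN1r fock_dotZr; [|exact: fL|exact: fL].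
by rewrite conjcN [1^*](conjcR (1 : R)) mulN1r.
Qed.

Lemma fockN f : fock f -> fock (- f).
Proof. by move=> Ff; rewrite -scaleN1r; exact: fockZ. Qed.

Lemma fock_normB_sqr f g : fock f -> fock g ->
  fock_norm (f - g) ^+ 2 = fock_norm f ^+ 2 + fock_norm g ^+ 2 - 2 * Re (fock_dot f g).
Proof.
move=> Ff Fg; rewrite fock_normD_sqr; [|exact: fL|exact/fL/fockN].
by rewrite fock_normN// fock_dotNr// ReN mulrN.
Qed.

Lemma ccauchy_cvg (x_ : nat -> C) :
  (forall e : R, 0 < e -> exists N, forall k l, (N <= k)%N -> (N <= l)%N -> normc (x_ k - x_ l) <= e) ->
  exists x, ccvg x_ x.
Proof.
move=> H.
have key (F : C -> R) : (forall z w : C, `|F z - F w| <= normc (z - w)) ->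
    cvgn (fun k => F (x_ k)).
  move=> HF; apply/cauchy_cvgP/cauchy_exP => e e0.
  have e2 : 0 < e / 2 by rewrite divr_gt0.
  have [N HN] := H _ e2; exists (F (x_ N)); exists N => // k /= Nk.
  rewrite /ball/= (le_lt_trans (HF _ _))// (le_lt_trans (HN _ _ _ _))//.
  by rewrite gtr_pMr// invf_lt1// ltr1n.
have /cvg_ex[a Ha] := key Re (fun z w : C => ltac:(rewrite -ReB; exact: Re_le_normc)).
have /cvg_ex[b Hb] := key Im (fun z w : C => ltac:(rewrite -ImB; exact: Im_le_normc)).
by exists (a +i* b); exact: ccvg_ReIm.
Qed.

Lemma ccvg_cst (x : C) : ccvg (fun=> x) x.
Proof. by apply/ccvgP => e e0; apply: nearW => k; rewrite subrr normc0E ltW. Qed.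
Lemma ccvgB (x_ y_ : nat -> C) x y : ccvg x_ x -> ccvg y_ y -> ccvg (fun k => x_ k - y_ k) (x - y).
Proof.
move=> hx hy; apply: ccvg_ReIm; rewrite ?ReB ?ImB;
  under eq_fun do rewrite ?ReB ?ImB; apply: cvgB; try exact: ccvg_Re; exact: ccvg_Im.
Qed.

(** Norm convergence dominates pointwise convergence; [fock_limit] is applied
    once to the sequence and once to the differences u_k - u_l with k fixed.
    *)
Lemma fock_complete (u : nat -> Cn -> C) : (forall k, fock (u k)) ->
  (forall e : R, 0 < e -> exists N, forall k l, (N <= k)%N -> (N <= l)%N ->
     fock_norm (u k - u l) <= e) ->
  exists2 g, fock g & fock_norm (u k - g) @[k --> \oo] --> (0 : R).
Proof.
move=> Fu H.
have pw z : exists x, ccvg (u^~ z) x.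
  apply: ccauchy_cvg => e e0; have ez : 0 < e / expR (sqnorm z / 4) by rewrite divr_gt0// expR_gt0.
  have [N HN] := H _ ez; exists N => k l Nk Nl.
  apply: le_trans (fock_eval_le z (fockB (Fu k) (Fu l))) _.
  by rewrite -ler_pdivlMr ?expR_gt0//; exact: HN.
have [g Hg] := choice pw.
have shift N z : ccvg (fun k => u (k + N)%N z) (g z).
  apply/ccvgP => e e0; have := (ccvgP _ _).1 (Hg z) e e0.
  by move=> [M _ HM]; exists M => // k /= Mk; apply: HM => /=; rewrite (leq_trans Mk)// leq_addr.
have Fg : fock g.
  have [N HN] := H 1 ltr01.
  apply: (@fock_limit R n (fun k => u (k + N)%N) g (fock_norm (u N) + 1) _ _ (shift N)).1 => // k.
  rewrite -[u (k + N)%N](subrK (u N)) addrC.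
  by apply: le_trans (fock_normD (fL (Fu N)) (fL (fockB (Fu _) (Fu N)))) _; rewrite lerD2l HN// leq_addl.
exists g => //; apply/cvgrPdist_le => e e0; have [N HN] := H e e0.
exists N => // k /= Nk; rewrite sub0r normrN ger0_norm ?fock_norm_ge0//.
apply: (@fock_limit R n (fun l => u k - u (l + N)%N) (u k - g) e _ _ _).2.
- by move=> l; exact: fockB.
- by move=> l; apply: HN => //; exact: leq_addl.
- by move=> z; exact: ccvgB (ccvg_cst _) (shift N z).
Qed.

(** The representing vector minimizes ||f||^2 - 2 Re L f. Minimizing sequences
    are Cauchy by the parallelogram law, and varying the minimizer along t v
    gives Re <h,v> = Re L v; the imaginary part follows by linearity. *)
Lemma riesz (L : (Cn -> C) -> C) (B : R) : 0 <= B ->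
  (forall (c : C) f g, fock f -> fock g -> L (c *: f + g) = c * L f + L g) ->
  (forall f, fock f -> normc (L f) <= B * fock_norm f) ->
  exists2 h, fock h & forall f, fock f -> L f = fock_dot f h.
Proof.
move=> B0 linL bL.
have LD f g : fock f -> fock g -> L (f + g) = L f + L g.
  by move=> Ff Fg; have := linL 1 f g Ff Fg; rewrite scale1r mul1r.
have L0 : L 0 = 0.
  apply: normc_eq0; apply/eqP; rewrite eq_le normc_ge0 andbT.
  by have := bL _ fock0; rewrite fock_norm0 mulr0.
have LZ (c : C) f : fock f -> L (c *: f) = c * L f.
  by move=> Ff; have := linL c f 0 Ff fock0; rewrite L0 !addr0.
pose J f := fock_norm f ^+ 2 - 2 * Re (L f).
pose E : set R := [set r | exists2 f, fock f & r = J f].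
have lbE : lbound E (- B ^+ 2).
  move=> _ [f Ff ->]; rewrite /J.
  have := le_trans (ler_norm _) (le_trans (Re_le_normc _) (bL f Ff)).
  have := sqr_ge0 (fock_norm f - B); rewrite sqrrB; lra.
have hE : has_inf E.
  by split; [exists (J 0); exists 0; [exact: fock0|]|exists (- B ^+ 2)].
pose m := inf E.
have mJ f : fock f -> m <= J f by move=> Ff; apply: ge_inf; [exact: hE.2|exists f].
have near_min k : exists f, fock f /\ J f <= m + k.+1%:R^-1.
  have k0 : 0 < k.+1%:R^-1 :> R by rewrite invr_gt0.
  by have [_ [f Ff ->] /ltW fm] := inf_adherent k0 hE; exists f.
have [u Hu] := choice near_min.
have Fu k : fock (u k) := (Hu k).1.
have par f g : fock f -> fock g ->
    fock_norm (f - g) ^+ 2 <= 2 * (J f - m) + 2 * (J g - m).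
  move=> Ff Fg; have Ffg := fockD Ff Fg.
  have := mJ _ (fockZ (2^-1)%:C Ffg).
  rewrite /J fock_normZ; last exact: fL.
  rewrite LZ// LD// ReZ ReD normc_real ger0_norm ?invr_ge0// exprMn.
  rewrite fock_normB_sqr// fock_normD_sqr; [|exact: fL|exact: fL].
  lra.
have [h Fh uh] : exists2 h, fock h & fock_norm (u k - h) @[k --> \oo] --> (0 : R).
  apply: fock_complete => // e e0.
  have e4 : 0 < e ^+ 2 / 4 by rewrite divr_gt0// exprn_gt0.
  have [N HN] : exists N, forall k, (N <= k)%N -> k.+1%:R^-1 <= e ^+ 2 / 4 :> R.
    have /cvgrPdist_le/(_ _ e4)[N _ HN] := @cvg_harmonic R.
    exists N => k Nk; have := HN k Nk; rewrite /= sub0r normrN ger0_norm// /harmonic/= invr_ge0.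
  exists N => k l Nk Nl.
  rewrite -(@ler_pXn2r _ 2) ?nnegrE ?fock_norm_ge0// ?(ltW e0)//.
  apply: le_trans (par _ _ (Fu k) (Fu l)) _.
  move: (HN k Nk) (HN l Nl) (Hu k).2 (Hu l).2.
  move: (k.+1%:R^-1) (l.+1%:R^-1) (J (u k)) (J (u l)) => a b x y; lra.
(* The variation is performed on the minimizing sequence, and only the inner
   product with v is passed to the limit. *)
have main v : fock v -> Re (fock_dot h v) = Re (L v).
  move=> Fv; set c := Re (fock_dot h v) - Re (L v); set N := fock_norm v ^+ 2.
  have cu : Re (fock_dot (u k) v) @[k --> \oo] --> Re (fock_dot h v).
    apply: ccvg_Re; apply/ccvgP => e e0.
    have e1 : 0 < e / (fock_norm v + 1) by rewrite divr_gt0// ltr_wpDl// fock_norm_ge0.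
    move/cvgrPdist_le : uh => /(_ _ e1); apply: filterS => k.
    rewrite sub0r normrN ger0_norm ?fock_norm_ge0// => Hk.
    have -> : fock_dot (u k) v - fock_dot h v = fock_dot (u k - h) v.
      have E1 : u k = u k - h + h by rewrite subrK.
      by rewrite {1}E1 (fock_dotDl1 (fL (fockB (Fu k) Fh)) (fL Fh) (fL Fv)) addrK.
    apply: le_trans (fock_cauchy_schwarz (fL (fockB (Fu k) Fh)) (fL Fv)) _.
    apply: le_trans (_ : e / (fock_norm v + 1) * fock_norm v <= _).
      by rewrite ler_wpM2r ?fock_norm_ge0.
    rewrite -mulrA ler_piMr ?(ltW e0)// mulrC ler_pdivrMr ?mul1r ?lerDl//.
    by rewrite ltr_wpDl// fock_norm_ge0.
  have quad (t : R) : 0 <= 2 * t * c + t ^+ 2 * N.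
    have Hk k : 0 <= k.+1%:R^-1 + 2 * t * (Re (fock_dot (u k) v) - Re (L v)) + t ^+ 2 * N.
      have := mJ _ (fockD (Fu k) (fockZ t%:C Fv)).
      rewrite /J fock_normD_sqr; [|exact: fL|exact/fL/fockZ].
      rewrite (LD _ _ (Fu k) (fockZ t%:C Fv)).
      rewrite LZ// ReD fock_dotZr; [|exact: fL|exact: fL].
      rewrite conjcR; move: (fock_dot (u k) v) => d; rewrite !ReZ fock_normZ; last exact: fL.
      rewrite normc_real exprMn real_normK ?num_real//.
      have := (Hu k).2; rewrite /J /N.
      move: (k.+1%:R^-1) (Re d) (Re (L v)) (Re (L (u k))) (fock_norm (u k) ^+ 2) (fock_norm v ^+ 2).
      by move=> x1 x2 x3 x4 x5 x6; lra.
    have cv : k.+1%:R^-1 + 2 * t * (Re (fock_dot (u k) v) - Re (L v)) + t ^+ 2 * N @[k --> \oo] -->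
        0 + 2 * t * c + t ^+ 2 * N.
      apply: cvgD; last exact: cvg_cst.
      apply: cvgD; first exact: cvg_harmonic.
      by apply: cvgMr; apply: cvgB => //; exact: cvg_cst.
    rewrite -[2 * t * c]add0r -(cvg_lim _ cv)//; apply: limr_ge; last exact: nearW.
    by apply/cvg_ex; eexists; exact: cv.
  apply/eqP; rewrite -subr_eq0 -/c; apply/eqP.
  have N0 : 0 <= N by exact: sqr_ge0.
  have N1 : 0 < N + 1 by rewrite ltr_wpDl.
  have := quad (- c / (N + 1)).
  have -> : 2 * (- c / (N + 1)) * c + (- c / (N + 1)) ^+ 2 * N =
     - (c ^+ 2 * (N + 2) / (N + 1) ^+ 2) by field; rewrite gt_eqF.
  rewrite oppr_ge0 => le0; apply/eqP; rewrite -sqrf_eq0 eq_le sqr_ge0 andbT.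
  move: le0; rewrite pmulr_lle0 ?invr_gt0 ?exprn_gt0// pmulr_lle0//.
  by rewrite ltr_wpDl.
exists h => // f Ff.
have H1 := main f Ff.
have H2 := main _ (fockZ (0 -i* 1) Ff).
rewrite [RHS]fock_dotC; [|exact: fL|exact: fL].
move: H1 H2; rewrite LZ// fock_dotZr; [|exact: fL|exact: fL].
move: (fock_dot h f) (L f) => a b; rewrite !ReM ReJ ImJ /= => H1 H2.
by apply: eq_ReIm; rewrite ?ReJ ?ImJ; lra.
Qed.

Lemma fock_dot_inj g h : fock g -> fock h ->
  (forall f, fock f -> fock_dot f g = fock_dot f h) -> g = h.
Proof.
move=> Fg Fh H; apply/funext => w.
have K := @fock_kernel R n w.
rewrite -(fock_dot_kernel w Fg) -(fock_dot_kernel w Fh).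
by rewrite (fock_dotC (fL K) (fL Fg)) (fock_dotC (fL K) (fL Fh)) H.
Qed.

(** The adjoint is chosen pointwise by the Riesz representation; uniqueness
    makes it linear, and ||S g||^2 = <T (S g), g> bounds it. *)
Lemma bounded_adjoint (T : (Cn -> C) -> (Cn -> C)) : bounded_operator T ->
  exists S, adjoint_of T S.
Proof.
move=> [[FT linT] [M0 bT0]].
pose M := Num.max M0 0.
have MM : 0 <= M by rewrite le_max lexx orbT.
have bT f : fock f -> fock_norm (T f) <= M * fock_norm f.
  move=> Ff; apply: le_trans (bT0 f Ff) _.
  by rewrite ler_wpM2r ?fock_norm_ge0// le_max lexx.
have ex g : exists h, fock g -> fock h /\ forall f, fock f -> fock_dot (T f) g = fock_dot f h.
  have [Fg|nFg] := pselect (fock g); last by exists 0.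
  have [|||h Fh Hh] := @riesz (fun f => fock_dot (T f) g) (M * fock_norm g).
  - by rewrite mulr_ge0// fock_norm_ge0.
  - move=> c f1 f2 F1 F2; rewrite /= linT//.
    exact: fock_dotDl (fL (FT _ F1)) (fL (FT _ F2)) (fL Fg).
  - move=> f Ff; apply: le_trans (fock_cauchy_schwarz (fL (FT _ Ff)) (fL Fg)) _.
    by rewrite [leRHS]mulrAC ler_wpM2r ?fock_norm_ge0//; exact: bT.
  by exists h.
have [S HS] := choice ex.
have FS g : fock g -> fock (S g) by move=> /HS[].
have SE f g : fock f -> fock g -> fock_dot (T f) g = fock_dot f (S g).
  by move=> Ff /HS[_]; exact.
exists S; split => //; split.
  split => // a f g Ff Fg; have Fag := fockD (fockZ a Ff) Fg.
  apply: fock_dot_inj; [exact: FS|by apply: fockD; [apply: fockZ|]; exact: FS|].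
  move=> h Fh; rewrite -SE//; have LTh := fL (FT _ Fh).
  rewrite fock_dotDr//; [|exact/fL/fockZ|exact: fL].
  rewrite fock_dotZr//; last exact: fL.
  rewrite fock_dotDr//; [|exact/fL/fockZ/FS|exact/fL/FS|exact: fL].
  by rewrite fock_dotZr ?SE//; apply: fL => //; exact: FS.
exists M => g Fg; have LS := fL (FS _ Fg).
have [->|nz] := eqVneq (fock_norm (S g)) 0; first by rewrite mulr_ge0// fock_norm_ge0.
have pos : 0 < fock_norm (S g) by rewrite lt_neqAle eq_sym nz fock_norm_ge0.
rewrite -(ler_pM2r pos) -expr2.
have -> : fock_norm (S g) ^+ 2 = normc (fock_dot (T (S g)) g).
  by rewrite SE ?fock_dotff// ?normc_real ?ger0_norm ?sqr_ge0//; exact: FS.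
apply: le_trans (fock_cauchy_schwarz (fL (FT _ (FS _ Fg))) (fL Fg)) _.
by rewrite [leRHS]mulrAC ler_wpM2r ?fock_norm_ge0// bT//; exact: FS.
Qed.

End hilbert.

(** * Compactness and normality imply essential normality *)

Section operators.
Context (R : realType) (n : nat).
Local Notation C := R[i].
Local Notation Cn := 'rV[C]_n.
Local Notation operator := ((Cn -> C) -> (Cn -> C)).
Implicit Types (f g h : Cn -> C) (z w : Cn) (T S : operator).

Lemma strict_homo_ge (s : nat -> nat) : {homo s : i j / (i < j)%N} -> forall k, (k <= s k)%N.
Proof.
by move=> hs; elim=> [//|k IH]; apply: leq_ltn_trans IH (hs _ _ _).
Qed.

Lemma cvg_subseq (a : nat -> R) (l : R) (s : nat -> nat) : {homo s : i j / (i < j)%N} ->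
  a k @[k --> \oo] --> l -> a (s k) @[k --> \oo] --> l.
Proof.
move=> hs al; apply/cvgrPdist_le => e e0; have /cvgrPdist_le/(_ e e0)[N _ HN] := al.
by exists N => // k /= Nk; apply: HN => /=; exact: leq_trans Nk (strict_homo_ge hs k).
Qed.

Lemma cvg0_squeeze (a b : nat -> R) : (forall k, 0 <= a k <= b k) ->
  b k @[k --> \oo] --> (0 : R) -> a k @[k --> \oo] --> (0 : R).
Proof. by move=> ab b0; apply: (squeeze_cvgr _ (cvg_cst _) b0); exact: nearW. Qed.

Lemma linear_operatorB T f g : linear_operator T -> fock f -> fock g -> T (f - g) = T f - T g.
Proof.
move=> [FT lT] Ff Fg; have -> : f - g = (-1) *: g + f by rewrite scaleN1r addrC.
by rewrite (lT _ _ _ Fg Ff) scaleN1r addrC.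
Qed.

Lemma linear_operatorZ T (c : C) f : linear_operator T -> fock f -> T (c *: f) = c *: T f.
Proof.
move=> lT Ff; have T0 : T 0 = 0 by rewrite -[X in T X](subrr f) (linear_operatorB lT Ff Ff) subrr.
by rewrite -[c *: f]addr0 (lT.2 c f 0 Ff (fock0 R n)) T0 addr0.
Qed.

Lemma linear_commutator T S : linear_operator T -> linear_operator S ->
  linear_operator (fun f => S (T f) - T (S f)).
Proof.
move=> LT LS; have [FT _] := LT; have [FS _] := LS; split=> [f Ff|a f g Ff Fg].
  exact: (fockB (FS _ (FT _ Ff)) (FT _ (FS _ Ff))).
rewrite (LT.2 _ _ _ Ff Fg) (LS.2 _ _ _ (FT _ Ff) (FT _ Fg)).
rewrite (LS.2 _ _ _ Ff Fg) (LT.2 _ _ _ (FS _ Ff) (FS _ Fg)).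
by rewrite opprD addrACA scalerBr.
Qed.

Lemma bounded_operator_ge0 T : bounded_operator T -> exists2 M : R, 0 <= M &
  forall f, fock f -> fock_norm (T f) <= M * fock_norm f.
Proof.
move=> [_ [M HM]]; exists (Num.max M 0) => [|f Ff]; first by rewrite le_max lexx orbT.
by apply: le_trans (HM f Ff) _; rewrite ler_wpM2r ?fock_norm_ge0// le_max lexx.
Qed.

(** With S bounded, S T and T S are both compact; two extractions make both
    converge along one subsequence. *)
Lemma compact_essentially_normal T : bounded_operator T -> compact_operator T ->
  essentially_normal T.
Proof.
move=> bT [LT cT]; have [S aTS] := bounded_adjoint bT; exists S; first exact: aTS.
have [bS _] := aTS; have [LS _] := bS; have [FT _] := LT; have [FS _] := LS.
have [B B0 HB] := bounded_operator_ge0 bS.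
split; first exact: linear_commutator.
move=> u Fu [M uM].
have [s1 [hs1 [g1 Fg1 c1]]] := cT u Fu (ex_intro _ M uM).
have [|s2 [hs2 [g2 Fg2 c2]]] := cT (fun k => S (u (s1 k))) (fun k => FS _ (Fu _)).
  exists (B * M) => k; apply: le_trans (HB _ (Fu _)) _.
  by rewrite ler_wpM2l.
exists (s1 \o s2); split => [i j ij|]; first exact/hs1/hs2.
exists (S g1 - g2); first exact: (fockB (FS _ Fg1) Fg2).
have bnd k : 0 <= fock_norm (S (T (u (s1 (s2 k)))) - T (S (u (s1 (s2 k)))) - (S g1 - g2)) <=
    B * fock_norm (T (u (s1 (s2 k))) - g1) + fock_norm (T (S (u (s1 (s2 k)))) - g2).
  rewrite fock_norm_ge0/=; set v := u _; have Fv : fock v := Fu _.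
  have F1 := fockB (FT _ Fv) Fg1; have F2 := fockB (FT _ (FS _ Fv)) Fg2.
  have -> : S (T v) - T (S v) - (S g1 - g2) = S (T v - g1) - (T (S v) - g2).
    by rewrite (linear_operatorB LS (FT _ Fv) Fg1) !opprB -!addrA; congr (_ + _);
      rewrite addrC -addrA [RHS]addrCA.
  apply: le_trans (fock_normD (fL (FS _ F1)) (fL (fockN F2))) _.
  by rewrite (fock_normN F2) lerD2r; exact: HB.
apply: cvg0_squeeze bnd _; rewrite -[X in _ --> X](addr0 (0 : R)) -[X in _ --> X + _](mulr0 B).
apply: cvgD; last exact: c2.
by apply: cvgMr; exact: (@cvg_subseq (fun k => fock_norm (T (u (s1 k)) - g1))).
Qed.

(** The commutator is zero on the space, though not necessarily outside of it.
    *)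
Lemma normal_essentially_normal T : linear_operator T -> normal_operator T -> essentially_normal T.
Proof.
move=> LT [S aTS ST]; have [[LS _] _] := aTS; exists S; first exact: aTS.
split; first exact: linear_commutator.
move=> u Fu _; exists id; split => //; exists 0; first exact: fock0.
rewrite (_ : (fun _ => _) = fun=> 0); first exact: cvg_cst.
by apply/funext => k; rewrite (ST _ (Fu k)) subrr subr0 fock_norm0.
Qed.

End operators.

(** * The symbol of a bounded composition operator is affine *)

Section affine.
Context (R : realType) (n : nat).
Local Notation C := R[i].
Local Notation Cn := 'rV[C]_n.
Local Notation sqnorm := (@sqnorm R n).
Implicit Types (f g h : Cn -> C) (z w : Cn).

Lemma quadratic_le0_lead (a b c : R) : (forall t : R, a * t ^+ 2 + b * t + c <= 0) -> a <= 0.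
Proof.
move=> H; rewrite leNgt; apply/negP => a0.
pose t := 1 + `|c| / a.
have ca : 0 <= `|c| / a by rewrite divr_ge0// ltW.
have H1 := H t; have H2 := H (- t); have := ler_norm (- c); rewrite normrN => H3.
have at_ : a * t = a + `|c| by rewrite /t mulrDr mulr1 mulrC divfK// gt_eqF.
have H4 : a * t <= a * t ^+ 2.
  by rewrite ler_wpM2l ?(ltW a0)// expr2 ler_peMl// ?lerDl// addr_ge0.
rewrite sqrrN in H2; lra.
Qed.

Lemma linear_le0_lead (b c : R) : (forall t : R, b * t + c <= 0) -> b = 0.
Proof.
move=> H; apply/eqP/negP => /negP b0.
have := H ((1 - c) / b); rewrite mulrC divfK// subrK; lra.
Qed.

Lemma gintegrable_sqnorm : gintegrable sqnorm.
Proof.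
apply: (@gintegrable_le R n _ (fun z => 4 * expR (1 / 4 * sqnorm z))).
- exact: rmeas_sqnorm.
- move=> z; rewrite ger0_norm ?sqnorm_ge0//; have := expR_ge1Dx (1 / 4 * sqnorm z); lra.
- by apply: gintegrableZ; apply: gintegrable_exp; lra.
Qed.

Lemma fock_hdiff_le f (a : Cn -> R) : (forall z, hdiff f z) ->
  (forall z, normc (f z) ^+ 2 <= a z) -> gintegrable a -> fock f.
Proof.
move=> df fa ia; apply/fockP; split.
  by move=> z; apply: hdiff_differentiable; exact: df.
by apply: square_integrable_le fa ia; exact: cmeas_hdiff.
Qed.

Lemma fock_coord j : fock (fun z : Cn => z ord0 j).
Proof.
apply: fock_hdiff_le gintegrable_sqnorm => z; first exact: hdiff_coord.
exact: normc_coord_sqnorm.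
Qed.

Lemma hdiff_scale f (c : C) z : hdiff f (c *: z) -> hdiff (fun z => f (c *: z)) z.
Proof.
move=> [a Ha]; exists (fun j => a j * c) => e e0.
have c1 : 0 < normc c + 1 by rewrite ltr_wpDl// normc_ge0.
have [r r0 Hr] := Ha (e / (normc c + 1)) (divr_gt0 e0 c1).
exists (r / (normc c + 1)) => [|h hr]; first exact: divr_gt0.
have ch : l1norm (c *: h) <= (normc c + 1) * l1norm h.
  by rewrite l1normZ ler_wpM2r ?l1norm_ge0// lerDl.
have := Hr (c *: h); rewrite scalerDr.
have -> : \sum_j a j * (c *: h) ord0 j = \sum_j a j * c * h ord0 j.
  by apply: eq_bigr => j _; rewrite mxE mulrA.
move=> H; apply: le_trans (H _) _.
  by apply: le_trans ch _; rewrite mulrC -ler_pdivlMr.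
apply: le_trans (_ : e / (normc c + 1) * ((normc c + 1) * l1norm h) <= _).
  by rewrite ler_wpM2l// divr_ge0 ?ltW.
by rewrite mulrA divfK// gt_eqF.
Qed.

(** The dilates f(r z) have norm of order r. Expanding <f(r .), K_(w/r)> =
    f(w) at 0 leaves a remainder of order r (|w|/r)^2, so f - f(0) is a
    pointwise limit of linear forms as r grows. *)
Lemma liouville_affine f (c : R) : fock f -> (forall z, normc (f z) ^+ 2 <= sqnorm z + c) ->
  forall w, f w = f 0 + \sum_j w ord0 j * (f (delta_mx ord0 j) - f 0).
Proof.
move=> Ff fc.
have c0 : 0 <= c.
  have := le_trans (sqr_ge0 _) (fc 0); by rewrite sqnorm0 add0r.
have df z : hdiff f z by apply: differentiable_hdiff; exact: ((fockP f).1 Ff).1.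
pose r k : R := k.+1%:R.
have r0 k : 0 < r k by rewrite ltr0n.
have r1 k : 1 <= r k by rewrite ler1n.
pose F k z := f ((r k)%:C *: z).
pose a z := sqnorm z + c.
have ia : gintegrable a by apply: gintegrableD gintegrable_sqnorm _; exact: gintegrable_cst.
have Fa k z : normc (F k z) ^+ 2 <= r k ^+ 2 * a z.
  apply: le_trans (fc _) _; rewrite sqnormZ normc_real real_normK ?num_real// mulrDr lerD2l.
  by rewrite ler_peMl// expr_ge1.
have FF k : fock (F k).
  apply: fock_hdiff_le (Fa k) _; last exact: gintegrableZ.
  by move=> z; apply: hdiff_scale; exact: df.
pose J := Num.sqrt (gint a).
have J0 : 0 <= J := sqrtr_ge0 _.
have normF k : fock_norm (F k) <= r k * J.
  rewrite -(@ler_pXn2r _ 2) ?nnegrE ?fock_norm_ge0 ?mulr_ge0 ?(ltW (r0 k))//.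
  rewrite fock_norm_sqr ?exprMn ?sqr_sqrtr; [| |exact: fL].
    rewrite -gintZ//; apply: gint_le; [exact: (fL (FF k)).2|exact: gintegrableZ|exact: Fa].
  by apply: gint_ge0 => z; rewrite addr_ge0// sqnorm_ge0.
have [D D0 HD] := dot_kernel_taylor (0 : Cn).
pose b k j := fock_dot (F k) (dkernel 0 j) * (r k)^-1%:C.
have lim w : ccvg (fun k => \sum_j b k j * w ord0 j) (f w - f 0).
  apply/ccvgP => e e0; set l := l1norm w; have l0 : 0 <= l := l1norm_ge0 w.
  have big_r : \forall k \near \oo, l <= r k /\ J * D * l ^+ 2 / e <= r k.
    have [N HN] : exists N : nat, Num.max l (J * D * l ^+ 2 / e) <= N%:R.
      by exists (Num.bound (Num.max l (J * D * l ^+ 2 / e))); apply/ltW/archi_boundP; rewrite le_max l0.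
    exists N => // k /= Nk; apply/andP; rewrite -ge_max; apply: le_trans HN _.
    by rewrite ler_nat (leq_trans Nk).
  apply: filterS big_r => k [lr er].
  have := HD (F k) ((r k)^-1%:C *: w) (fL (FF k)).
  rewrite l1normZ normc_real ger0_norm ?invr_ge0 ?(ltW (r0 k))// add0r.
  rewrite !fock_dot_kernel// /F scaler0 scalerA -realcM divff ?gt_eqF// scale1r -/(F k).
  have -> : \sum_j fock_dot (F k) (dkernel 0 j) * ((r k)^-1%:C *: w) ord0 j = \sum_j b k j * w ord0 j.
    by apply: eq_bigr => j _; rewrite mxE mulrA.
  rewrite normcB => H; apply: le_trans (H _) _.
    by rewrite mulrC ler_pdivrMr// mul1r.
  apply: le_trans (_ : r k * J * D * ((r k)^-1 * l) ^+ 2 <= _).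
    by rewrite ler_wpM2r ?sqr_ge0// ler_wpM2r.
  have -> : r k * J * D * ((r k)^-1 * l) ^+ 2 = J * D * l ^+ 2 / r k.
    by field; rewrite gt_eqF.
  by rewrite ler_pdivrMr// [leRHS]mulrC -ler_pdivrMr.
have limj j : ccvg (b ^~ j) (f (delta_mx ord0 j) - f 0).
  have := lim (delta_mx ord0 j); congr ccvg; apply/funext => k.
  rewrite (bigD1 j)//= big1 => [|i /negbTE ij]; last by rewrite mxE ij andbF mulr0.
  by rewrite mxE !eqxx mulr1 addr0.
have ccvgD (x_ y_ : nat -> C) x y : ccvg x_ x -> ccvg y_ y -> ccvg (fun k => x_ k + y_ k) (x + y).
  move=> hx hy; have := ccvgB hx (ccvgZ (-1) hy).
  by rewrite mulN1r opprK; congr ccvg; apply/funext => k; rewrite mulN1r opprK.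
move=> w; apply/eqP; rewrite addrC -subr_eq; apply/eqP; apply: ccvg_unique (lim w) _.
elim: (index_enum _) => [|j s IH].
  by under [X in ccvg X _]funext do rewrite big_nil; rewrite big_nil; exact: ccvg_cst.
under [X in ccvg X _]funext do rewrite big_cons.
rewrite big_cons; apply: ccvgD IH.
under [X in ccvg X _]funext do rewrite mulrC.
exact: ccvgZ.
Qed.

Section bounded_composition.
Variable phi : Cn -> Cn.
Hypothesis bphi : bounded_operator (composition_operator phi).

(** Evaluating the image of K_(phi w) at w gives exp(|phi w|^2/2) <= M
    exp(|phi w|^2/4) exp(|w|^2/4). *)
Lemma composition_growth : exists c : R, forall w, sqnorm (phi w) <= sqnorm w + c.
Proof.
have [[FT _] _] := bphi; have [M M0 HM] := bounded_operator_ge0 bphi.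
exists (4 * M) => w.
have FK := @fock_kernel R n (phi w).
have := le_trans (fock_eval_le w (FT _ FK)) (ler_wpM2r (expR_ge0 _) (HM _ FK)).
rewrite (_ : composition_operator phi (kernel (phi w)) w = kernel (phi w) (phi w))//.
rewrite fock_norm_kernel normc_kernel dotczz => H.
have : expR (sqnorm (phi w) / 2) <= expR (M + sqnorm (phi w) / 4 + sqnorm w / 4).
  apply: le_trans H _; rewrite !expRD ler_wpM2r ?expR_ge0// ler_wpM2r ?expR_ge0//.
  have := expR_ge1Dx M; lra.
rewrite ler_expR; lra.
Qed.

(** The coordinate functions belong to the space, so the components of phi do
    too. *)
Lemma composition_affine : exists A b, forall z, phi z = z *m A + b.
Proof.
have [[FT _] _] := bphi; have [c Hc] := composition_growth.
exists (\matrix_(i, j) (phi (delta_mx ord0 i) - phi 0) ord0 j), (phi 0) => z.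
apply/rowP => j; rewrite mxE [X in _ = X + _]mxE addrC.
rewrite (@liouville_affine (fun z => phi z ord0 j) c); last first.
- by move=> w; apply: le_trans (normc_coord_sqnorm _ _) (Hc w).
- exact: FT _ (fock_coord j).
by congr (_ + _); apply: eq_bigr => i _; rewrite !mxE.
Qed.

End bounded_composition.

Section contraction.
Variables (A : 'M[C]_n) (b : Cn) (c : R).
Hypothesis growth : forall z, sqnorm (z *m A + b) <= sqnorm z + c.

Let growth_line z (t : R) : (sqnorm (z *m A) - sqnorm z) * t ^+ 2 +
  2 * Re (dotc (z *m A) b) * t + (sqnorm b - c) <= 0.
Proof.
have := growth (t%:C *: z); rewrite -scalemxAl sqnormD !sqnormZ dotcZl ReZ.
rewrite normc_real real_normK ?num_real//; lra.
Qed.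

Lemma growth_contraction z : sqnorm (z *m A) <= sqnorm z.
Proof. by rewrite -subr_le0; exact: quadratic_le0_lead (growth_line z). Qed.

(** When |z A| = |z| the growth inequality along t z is linear in t, so its
    slope vanishes; replacing z by i z gives the imaginary part. *)
Lemma growth_orthogonal z : sqnorm (z *m A) = sqnorm z -> dotc (z *m A) b = 0.
Proof.
move=> zA.
have key v : sqnorm (v *m A) = sqnorm v -> Re (dotc (v *m A) b) = 0.
  move=> vA; suff : 2 * Re (dotc (v *m A) b) = 0 by lra.
  apply: (@linear_le0_lead _ (sqnorm b - c)) => t.
  by have := growth_line v t; rewrite vA subrr mul0r add0r.
apply: eq_ReIm; first exact: key.
have := key ((0 +i* 1) *: z); rewrite -scalemxAl !sqnormZ zA dotcZl ReM /= mul0r mul1r sub0r.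
by move=> /(_ erefl)/eqP; rewrite oppr_eq0 => /eqP.
Qed.

End contraction.

End affine.

(** * Pointwise convergent subsequences *)

Section compactness.
Context (R : realType) (n : nat).
Local Notation C := R[i].
Local Notation Cn := 'rV[C]_n.
Local Notation sqnorm := (@sqnorm R n).
Implicit Types (f g h : Cn -> C) (z w : Cn).

(** The limit is the largest x such that a(k) >= x for most k in the sense of
    the ultrafilter. *)
Lemma ultra_bounded_cvg (T : Type) (U : set_system T) (a : T -> R) (B : R) : UltraFilter U ->
  (forall k, `|a k| <= B) -> exists p, forall e : R, 0 < e -> U [set k | `|a k - p| <= e].
Proof.
move=> UU aB; pose E := [set x : R | U [set k | x <= a k]].
have E0 : E (- B).
  by rewrite /E/=; apply: (filterS _ filterT) => k _ /=; have := aB k; rewrite ler_norml => /andP[].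
have EB : ubound E B.
  move=> x /filter_ex[k /= xk]; apply: le_trans xk _.
  by have := aB k; rewrite ler_norml => /andP[].
have hE : has_sup E by split; [exists (- B)|exists B].
exists (sup E) => e e0.
have U1 : U [set k | sup E - e <= a k].
  have [x Ex xe] := sup_adherent e0 hE.
  by apply: filterS Ex => k /=; apply: le_trans; exact: ltW.
have U2 : U [set k | a k <= sup E + e].
  have [H|] := in_ultra_setVsetC [set k | sup E + e <= a k] UU.
    have := ub_le_sup hE.2 (H : E (sup E + e)).
    by rewrite gerDl leNgt e0.
  by apply: filterS => k /= /negP; rewrite -ltNge => /ltW.
by apply: filterS (filterI U1 U2) => k /= [k1 k2]; rewrite ler_distl lerBlDr; apply/andP; split=> //; rewrite -lerBlDr.
Qed.

(** Limits along a free ultrafilter exist for all rows at once; an index good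
    for the first N rows up to 1/(N+1) exists beyond any bound, because the
    corresponding set of indices belongs to the ultrafilter. *)
Lemma diagonal_subsequence (a : nat -> nat -> C) (B : nat -> R) :
  (forall m k, normc (a m k) <= B m) ->
  exists s : nat -> nat, {homo s : i j / (i < j)%N} /\
    forall m, exists p, ccvg (fun k => a m (s k)) p.
Proof.
move=> aB.
have [U [UU HU]] := ultraFilterLemma (@eventually_filter).
have ex m : exists p : C, forall e : R, 0 < e -> U [set k | normc (a m k - p) <= e].
  have [x Hx] := @ultra_bounded_cvg _ U (fun k => Re (a m k)) (B m) UU
    (fun k => le_trans (Re_le_normc _) (aB m k)).
  have [y Hy] := @ultra_bounded_cvg _ U (fun k => Im (a m k)) (B m) UU
    (fun k => le_trans (Im_le_normc _) (aB m k)).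
  exists (x +i* y) => e e0; have e2 : 0 < e / 2 by rewrite divr_gt0.
  apply: filterS (filterI (Hx _ e2) (Hy _ e2)) => k /= [k1 k2].
  apply: le_trans (normc_le_ReIm _) _; rewrite ReB ImB /= [e]splitr.
  exact: lerD.
have [p Hp] := choice ex.
have step (Nk : nat * nat) : exists k, (Nk.2 <= k)%N /\
    forall m, (m <= Nk.1)%N -> normc (a m k - p m) <= Nk.1.+1%:R^-1.
  case: Nk => N k0 /=.
  have N0 : 0 < N.+1%:R^-1 :> R by rewrite invr_gt0.
  have : U [set k | (k0 <= k)%N /\ forall m, (m <= N)%N -> normc (a m k - p m) <= N.+1%:R^-1].
    have Uk : U [set k | (k0 <= k)%N] by apply: HU; exists k0.
    suff H j : U [set k | forall m, (m < j)%N -> normc (a m k - p m) <= N.+1%:R^-1].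
      by apply: filterS (filterI Uk (H N.+1)) => k [].
    elim: j => [|j IH]; first by apply: (filterS _ filterT) => k _.
    apply: filterS (filterI IH (Hp j _ N0)) => k /= [Hk Hj] m.
    by rewrite ltnS leq_eqVlt => /orP[/eqP->//|]; exact: Hk.
  by move=> /filter_ex[k Hk]; exists k.
have [F HF] := choice step.
pose s := fix s N := if N is N'.+1 then F (N, (s N').+1) else F (0%N, 0%N).
have sS N : (s N < s N.+1)%N by rewrite /=; exact: (HF (N.+1, (s N).+1)).1.
have sP N m : (m <= N)%N -> normc (a m (s N) - p m) <= N.+1%:R^-1.
  by case: N => [|N] mN; [exact: (HF (0%N, 0%N)).2|exact: (HF (N.+1, (s N).+1)).2].
exists s; split; first exact: (homo_ltn ltn_trans sS).
move=> m; exists (p m); apply/ccvgP => e e0.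
have /cvgrPdist_le/(_ _ e0)[N _ HN] := @cvg_harmonic R.
exists (maxn N m) => // k /=; rewrite geq_max => /andP[Nk mk].
apply: le_trans (sP _ _ mk) _; have := HN k Nk.
by rewrite /= sub0r normrN ger0_norm// /harmonic/= invr_ge0.
Qed.

Definition rational_point (m : nat) : Cn :=
  if @unpickle 'rV[rat * rat]_n m is Some v
  then \row_j ((ratr (v ord0 j).1) +i* (ratr (v ord0 j).2)) else 0.

Lemma rational_dense z (e : R) : 0 < e -> exists m, l1norm (rational_point m - z) <= e.
Proof.
move=> e0; pose d := e / (2 * (n%:R + 1)).
have n1 : 0 < n%:R + 1 :> R by rewrite ltr_wpDl.
have d0 : 0 < d by rewrite divr_gt0// mulr_gt0.
have approx (x : R) : exists q : rat, `|ratr q - x| <= d.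
  have /rat_in_itvoo[q] : x - d < x + d by rewrite ltrD2l gtrN.
  rewrite in_itv/= => /andP[q1 q2]; exists q; rewrite ler_distl (ltW q1)/=.
  exact: ltW.
have [q Hq] := choice approx.
pose v : 'rV[rat * rat]_n := \row_j (q (Re (z ord0 j)), q (Im (z ord0 j))).
exists (pickle v); rewrite /rational_point pickleK.
apply: le_trans (_ : \sum_(j < n) 2 * d <= _).
  apply: ler_sum => j _; apply: le_trans (normc_le_ReIm _) _.
  by rewrite !mxE ReB ImB /= mulr_natl mulr2n lerD.
rewrite sumr_const card_ord -(mulr_natl (2 * d) n).
have -> : n%:R * (2 * d) = e * (n%:R / (n%:R + 1)) by rewrite /d; field; rewrite gt_eqF.
by rewrite ler_piMr ?(ltW e0)// ler_pdivrMr// mul1r lerDl.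
Qed.

(** A Lipschitz bound at z whose constant depends on f only through its norm.
    *)
Lemma fock_equicontinuous z : exists2 E : R, 0 <= E & forall f (h : Cn), fock f -> l1norm h <= 1 ->
  normc (f (z + h) - f z) <= fock_norm f * (E * l1norm h).
Proof.
have [D D0 HD] := dot_kernel_taylor z.
pose S := \sum_j fock_norm (dkernel z j).
have S0 : 0 <= S by apply: sumr_ge0 => j _; exact: fock_norm_ge0.
exists (S + D) => [|f h Ff h1]; first exact: addr_ge0.
have := HD f h (fL Ff) h1; rewrite !fock_dot_kernel//.
set s := \sum_j _; set l := l1norm h; have l0 : 0 <= l := l1norm_ge0 h.
have sl : normc s <= fock_norm f * (S * l).
  apply: le_trans (normc_sum _ _ _) _; rewrite /S mulr_suml mulr_sumr; apply: ler_sum => j _.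
  rewrite normcM mulrA ler_pM ?normc_ge0// ?normc_coord_le//.
  exact: fock_cauchy_schwarz (fL Ff) (square_integrable_dkernel _ _).
move=> H; have -> : f (z + h) - f z = (f (z + h) - f z - s) + s by rewrite subrK.
apply: le_trans (normcD _ _) _; rewrite mulrDl mulrDr addrC lerD//.
apply: le_trans H _; rewrite -mulrA ler_wpM2l ?fock_norm_ge0// ler_wpM2l//.
by rewrite expr2 ler_piMr.
Qed.

(** A diagonal subsequence converges at the points with rational coordinates,
    and equicontinuity makes it Cauchy at the others. *)
Lemma fock_montel (u : nat -> Cn -> C) (M : R) : (forall k, fock (u k)) ->
  (forall k, fock_norm (u k) <= M) ->
  exists s : nat -> nat, {homo s : i j / (i < j)%N} /\
    exists2 g, fock g /\ fock_norm g <= M & forall z, ccvg (fun k => u (s k) z) (g z).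
Proof.
move=> Fu uM; have M0 : 0 <= M := le_trans (fock_norm_ge0 (u 0%N)) (uM 0%N).
have [|s [hs Hs]] := @diagonal_subsequence (fun m k => u k (rational_point m))
  (fun m => M * expR (sqnorm (rational_point m) / 4)).
  by move=> m k; apply: le_trans (fock_eval_le _ (Fu k)) _; rewrite ler_wpM2r ?expR_ge0.
have pw z : exists p, ccvg (fun k => u (s k) z) p.
  apply: ccauchy_cvg => e e0.
  have [E E0 HE] := fock_equicontinuous z.
  pose d := Num.min 1 (e / 4 / (M * E + 1)).
  have ME : 0 < M * E + 1 by rewrite ltr_wpDl// mulr_ge0.
  have e4 : 0 < e / 4 by rewrite divr_gt0.
  have d0 : 0 < d by rewrite lt_min ltr01 divr_gt0.
  have [m Hm] := rational_dense z d0.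
  move: Hm; rewrite le_min => /andP[h1 hE]; set h := _ - z in h1 hE.
  have zh : rational_point m = z + h by rewrite /h addrCA subrr addr0.
  have close k : normc (u k (z + h) - u k z) <= e / 4.
    apply: le_trans (HE _ _ (Fu k) h1) _; rewrite mulrA.
    apply: le_trans (_ : (M * E + 1) * l1norm h <= _).
      rewrite ler_wpM2r ?l1norm_ge0//; apply: le_trans (_ : M * E <= _); last by rewrite lerDl.
      by rewrite ler_wpM2r.
    by rewrite mulrC -ler_pdivlMr.
  have [p /ccvgP/(_ _ e4)[N _ HN]] := Hs m; exists N => k l Nk Nl.
  have := HN k Nk; have := HN l Nl; rewrite /= zh => Hl Hk.
  have tri (a b c d' x : C) : a - d' = (a - b) + ((b - x) + ((x - c) + (c - d'))) by ring.
  rewrite (tri _ (u (s k) (z + h)) (u (s l) (z + h)) _ p).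
  rewrite (_ : e = e / 4 + (e / 4 + (e / 4 + e / 4))); last by field.
  apply: le_trans (normcD _ _) _; apply: lerD; first by rewrite normcB.
  apply: le_trans (normcD _ _) _; apply: lerD => //.
  by apply: le_trans (normcD _ _) _; apply: lerD => //; rewrite normcB.
have [g Hg] := choice pw.
by exists s; split => //; exists g => //; exact: (fock_limit (fun k => Fu (s k)) (fun k => uM (s k)) Hg).
Qed.

End compactness.

(** * Strict contractions give compact operators *)

Section strict.
Context (R : realType) (n : nat).
Local Notation C := R[i].
Local Notation Cn := 'rV[C]_n.
Local Notation sqnorm := (@sqnorm R n).
Implicit Types (f g h : Cn -> C) (z w : Cn) (A : 'M[C]_n).

Definition adjmx A : 'M[C]_n := \matrix_(i, j) (A j i)^*.

Lemma dotc_adjmx A z w : dotc (z *m A) w = dotc z (w *m adjmx A).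
Proof.
rewrite /dotc; under eq_bigr do rewrite mxE mulr_suml.
rewrite exchange_big/=; apply: eq_bigr => i _.
rewrite mxE conjc_sum mulr_sumr; apply: eq_bigr => j _.
rewrite mxE conjcM [_^*^*]conjCK; ring.
Qed.

Lemma sqnorm_mulmx_le A : exists2 B : R, 0 <= B & forall z, sqnorm (z *m A) <= B * sqnorm z.
Proof.
pose q j := \sum_i normc (A i j).
exists (\sum_j q j ^+ 2) => [|z]; first by apply: sumr_ge0 => j _; exact: sqr_ge0.
rewrite [X in X <= _]/Defs.sqnorm mulr_suml; apply: ler_sum => j _.
pose r := Num.sqrt (sqnorm z).
have rr : r ^+ 2 = sqnorm z by rewrite sqr_sqrtr// sqnorm_ge0.
have r0 : 0 <= r := sqrtr_ge0 _.
have q0 : 0 <= q j by apply: sumr_ge0 => i _; exact: normc_ge0.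
rewrite -rr -exprMn ler_pXn2r ?nnegrE ?normc_ge0 ?mulr_ge0//.
rewrite mxE; apply: le_trans (normc_sum _ _ _) _; rewrite /q mulr_suml; apply: ler_sum => i _.
rewrite normcM mulrC ler_wpM2l ?normc_ge0//.
by rewrite -(@ler_pXn2r _ 2) ?nnegrE ?normc_ge0// rr normc_coord_sqnorm.
Qed.

Lemma nonneg_quadratic (a b c : R) : 0 <= c -> (forall t : R, 0 <= a + 2 * t * b + t ^+ 2 * c) ->
  b ^+ 2 <= a * c.
Proof.
move=> c0 H; have [cz|cnz] := eqVneq c 0.
  have : 2 * - b = 0.
    apply: (@linear_le0_lead _ _ (- a)) => t; have := H t; rewrite cz; lra.
  move=> b0; have -> : b = 0 by lra.
  by rewrite cz mulr0 expr0n.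
have cp : 0 < c by rewrite lt_neqAle eq_sym cnz.
have := H (- b / c).
have -> : a + 2 * (- b / c) * b + (- b / c) ^+ 2 * c = (a * c - b ^+ 2) / c by field.
by rewrite pmulr_lge0 ?invr_gt0// subr_ge0.
Qed.

(** The form B(z,w) = <z,w> - <z A, w A> is positive definite with invertible
    matrix P = 1 - A A'. Cauchy-Schwarz for B, applied to z and x = z P^-1,
    gives |z|^4 <= B(x,x) B(z,z), where B(x,x) = <z,x> is at most K |z|^2.
    This avoids compactness of the unit sphere. *)
Lemma strict_contraction A : (forall z, z != 0 -> sqnorm (z *m A) < sqnorm z) ->
  exists k : R, [/\ 0 <= k, k < 1 & forall z, sqnorm (z *m A) <= k * sqnorm z].
Proof.
move=> HA.
have le z : sqnorm (z *m A) <= sqnorm z.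
  by have [->|/HA/ltW//] := eqVneq z 0; rewrite mul0mx.
pose P := 1%:M - A *m adjmx A.
pose B z w := dotc z w - dotc (z *m A) (w *m A).
have BP z w : B z w = dotc (z *m P) w.
  rewrite /P mulmxBr mulmx1 mulmxA dotcDl dotcNl /B; congr (_ - _).
  by rewrite dotcC [in RHS]dotcC -dotc_adjmx.
have qE z : Re (B z z) = sqnorm z - sqnorm (z *m A).
  by rewrite /B !dotczz ReB.
have uP : P \in unitmx.
  rewrite -row_free_unit -kermx_eq0; apply/eqP/row_matrixP => i; rewrite row0.
  apply/eqP; apply: contraT => nz.
  have := HA _ nz; have := qE (row i (kermx P)).
  by rewrite BP -row_mul mulmx_ker row0 -(scale0r (0 : Cn)) dotcZl mul0r /=; lra.
have [c c0 Hc] := sqnorm_mulmx_le (invmx P).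
pose K := 1 + c.
have K1 : 1 <= K by rewrite lerDl.
have K0 : 0 < K by apply: lt_le_trans K1.
have main z : sqnorm z <= K * (sqnorm z - sqnorm (z *m A)).
  pose x := z *m invmx P.
  have xP : x *m P = z by rewrite /x -mulmxA mulVmx// mulmx1.
  have q0 : 0 <= sqnorm z - sqnorm (z *m A) by rewrite subr_ge0.
  have Bxz : Re (B x z) = sqnorm z by rewrite BP xP dotczz.
  have cs : sqnorm z ^+ 2 <= (sqnorm x - sqnorm (x *m A)) * (sqnorm z - sqnorm (z *m A)).
    apply: nonneg_quadratic q0 _ => t.
    have : 0 <= sqnorm (x + t%:C *: z) - sqnorm ((x + t%:C *: z) *m A) by rewrite subr_ge0.
    rewrite mulmxDl -scalemxAl !sqnormD !sqnormZ !dotcZr !conjcR !ReZ normc_real real_normK ?num_real//.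
    move: Bxz; rewrite /B ReB => <-; lra.
  have qx : sqnorm x - sqnorm (x *m A) <= K * sqnorm z.
    rewrite -qE BP xP; apply: le_trans (ler_norm _) _; apply: le_trans (Re_le_normc _) _.
    have h2 : 0 < 1 / 2 :> R by [].
    have := normc_dotc_le z x h2; have := Hc z; rewrite -/x.
    have -> : (4 * (1 / 2))^-1 = 1 / 2 :> R by field.
    have := sqnorm_ge0 z; have : 0 <= c * sqnorm z by rewrite mulr_ge0// sqnorm_ge0.
    by rewrite /K; lra.
  have [z0|znz] := eqVneq (sqnorm z) 0.
    by rewrite {1}z0 mulr_ge0// ltW.
  have zp : 0 < sqnorm z by rewrite lt_neqAle eq_sym znz sqnorm_ge0.
  rewrite -(ler_pM2l zp) -expr2; apply: le_trans cs _.
  by rewrite mulrCA mulrA ler_wpM2r.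
exists (1 - K^-1); split => [||z].
- by rewrite subr_ge0 invf_le1.
- by rewrite gtrBl invr_gt0.
- have := main z; rewrite mulrC -ler_pdivrMr// mulrBl mul1r => H; lra.
Qed.

(** The cross term 2 Re <z A, b> costs an arbitrarily small multiple of |z
    A|^2, which the gap 1 - k absorbs. *)
Lemma affine_growth A (b : Cn) (k : R) : 0 <= k -> k < 1 ->
  (forall z, sqnorm (z *m A) <= k * sqnorm z) ->
  exists k' c : R, k' < 1 /\ forall z, sqnorm (z *m A + b) <= k' * sqnorm z + c.
Proof.
move=> k0 k1 HA; pose d := (1 - k) / 4.
have d0 : 0 < d by rewrite divr_gt0// subr_gt0.
exists ((1 + 2 * d) * k), ((1 + 2 * (4 * d)^-1) * sqnorm b); split.
  have : (1 - k) * k <= (1 - k) * 1 by rewrite ler_wpM2l ?subr_ge0// ltW.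
  rewrite /d; lra.
move=> z; rewrite sqnormD.
have := le_trans (ler_norm _) (le_trans (Re_le_normc _) (normc_dotc_le (z *m A) b d0)).
have : (1 + 2 * d) * sqnorm (z *m A) <= (1 + 2 * d) * (k * sqnorm z).
  by rewrite ler_wpM2l// addr_ge0// mulr_ge0// ltW.
lra.
Qed.

(** Pointwise convergent subsequences have convergent images, by dominated
    convergence: |f(phi z)|^2 is at most ||f||^2 exp(|phi z|^2/2), and k < 1
    makes this integrable against exp(-|z|^2/2). *)
Lemma composition_compact (phi : Cn -> Cn) (k c : R) :
  linear_operator (composition_operator phi) -> k < 1 ->
  (forall z, sqnorm (phi z) <= k * sqnorm z + c) ->
  compact_operator (composition_operator phi).
Proof.
move=> LT k1 growth; have [FT _] := LT; split; first exact: LT.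
move=> u Fu [M uM]; have [s [hs [g [Fg gM] ug]]] := fock_montel Fu uM.
exists s; split; first exact: hs.
exists (composition_operator phi g); first exact: FT _ Fg.
pose v j z := u (s j) (phi z) - g (phi z).
have vE j : composition_operator phi (u (s j)) - composition_operator phi g = v j by [].
have Fv j : fock (v j) by rewrite -vE; exact: fockB (FT _ (Fu _)) (FT _ Fg).
have MB j : fock_norm (u (s j) - g) <= 2 * M.
  apply: le_trans (fock_normD (fL (Fu _)) (fL (fockN Fg))) _; rewrite (fock_normN Fg).
  have := uM (s j); lra.
have M0 : 0 <= M by apply: le_trans (fock_norm_ge0 _) gM.
pose B z := (2 * M) ^+ 2 * expR (c / 2) * expR (k / 2 * sqnorm z).
have iB : gintegrable B by apply: gintegrableZ; apply: gintegrable_exp; lra.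
have vB j z : normc (v j z) ^+ 2 <= B z.
  have := fock_eval_le (phi z) (fockB (Fu (s j)) Fg).
  rewrite (_ : (u (s j) - g) (phi z) = v j z)// => H.
  apply: le_trans (_ : (2 * M * expR (sqnorm (phi z) / 4)) ^+ 2 <= _).
    rewrite ler_pXn2r ?nnegrE ?normc_ge0 ?mulr_ge0 ?expR_ge0//.
    by apply: le_trans H _; rewrite ler_wpM2r ?expR_ge0.
  rewrite exprMn /B -mulrA -expRM_natl ler_wpM2l ?sqr_ge0// -expRD ler_expR.
  have := growth z; lra.
have lim : gint (fun z => normc (v j z) ^+ 2) @[j --> \oo] --> (0 : R).
  rewrite -[X in _ --> X](gint_cst n 0).
  apply: (gint_dominated _ _ iB _).2 => [j|z|j z].
  - exact: (fL (Fv j)).2.1.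
  - have := ccvg_normc_sqr (ccvgB (ug (phi z)) (ccvg_cst (g (phi z)))).
    by rewrite subrr normc0E expr0n.
  - by rewrite ger0_norm ?sqr_ge0.
apply/cvgrPdist_le => e e0; have e2 : 0 < e ^+ 2 by rewrite exprn_gt0.
move/cvgrPdist_le : lim => /(_ _ e2); apply: filterS => j.
rewrite vE !sub0r !normrN ger0_norm; last by apply: gint_ge0 => z; exact: sqr_ge0.
rewrite -fock_norm_sqr ?ger0_norm ?fock_norm_ge0//; last exact: fL.
by rewrite ler_pXn2r ?nnegrE ?fock_norm_ge0// ltW.
Qed.

End strict.

(** * The commutator on normalized kernels *)

Section commutator.
Context (R : realType) (n : nat).
Local Notation C := R[i].
Local Notation Cn := 'rV[C]_n.
Local Notation sqnorm := (@sqnorm R n).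
Implicit Types (f g h : Cn -> C) (z w : Cn).

(** The values along integers m -> oo of a nonzero quadratic polynomial stay
    away from zero. Smallness is only available for infinitely many m, whence
    the form of the hypothesis. *)
Lemma polynomial_frequently_small (a b c : R) :
  (forall (e : R) (N : nat), 0 < e -> exists2 m : nat, (N <= m)%N & `|a * m%:R ^+ 2 + b * m%:R + c| <= e) ->
  [/\ a = 0, b = 0 & c = 0].
Proof.
move=> H.
have large (x : R) : exists N : nat, forall m, (N <= m)%N -> x <= m%:R /\ 1 <= m%:R :> R.
  exists (maxn 1 (Num.bound `|x|)) => m; rewrite geq_max => /andP[m1 mx].
  rewrite ler1n m1; split=> //; apply: le_trans (_ : (Num.bound `|x|)%:R <= _); last by rewrite ler_nat.
  exact: le_trans (ler_norm x) (ltW (archi_boundP (normr_ge0 x))).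
have a0 : a = 0.
  apply/eqP; apply: contraT => an; have ap : 0 < `|a| by rewrite normr_gt0.
  have [N HN] := large ((`|b| + `|c| + 2) / `|a|); have [m /HN[mx m1] Hm] := H 1 N ltr01.
  exfalso; move: mx; rewrite ler_pdivrMr// => mx.
  have h1 : (`|b| + `|c| + 2) * m%:R <= `|a| * m%:R ^+ 2.
    by rewrite expr2 mulrA ler_wpM2r// mulrC.
  have h2 : `|c| <= `|c| * m%:R by rewrite ler_peMr.
  have h3 : `|a| * m%:R ^+ 2 <= `|a * m%:R ^+ 2 + b * m%:R + c| + `|b| * m%:R + `|c|.
    have -> : `|a| * m%:R ^+ 2 = `|a * m%:R ^+ 2| by rewrite normrM (ger0_norm (sqr_ge0 _)).
    have -> : `|b| * m%:R = `|b * m%:R| by rewrite normrM (@ger0_norm _ m%:R).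
    have -> : a * m%:R ^+ 2 = (a * m%:R ^+ 2 + b * m%:R + c) - b * m%:R - c by ring.
    rewrite [X in _ <= `|X| + _ + _](_ : _ = a * m%:R ^+ 2 + b * m%:R + c); last by ring.
    apply: le_trans (ler_normB _ _) _; rewrite lerD2r; exact: ler_normB.
  lra.
have b0 : b = 0.
  apply/eqP; apply: contraT => bn; have bp : 0 < `|b| by rewrite normr_gt0.
  have [N HN] := large ((`|c| + 2) / `|b|); have [m /HN[mx m1] Hm] := H 1 N ltr01.
  exfalso; move: mx; rewrite ler_pdivrMr// => mx.
  move: Hm; rewrite a0 mul0r add0r => Hm.
  have : m%:R * `|b| <= `|b * m%:R + c| + `|c|.
    have -> : m%:R * `|b| = `|b * m%:R| by rewrite normrM mulrC (@ger0_norm _ m%:R).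
    have -> : b * m%:R = (b * m%:R + c) - c by rewrite addrK.
    by rewrite subrK; exact: ler_normB.
  lra.
split=> //; apply/eqP; rewrite -normr_le0; apply/ler_addgt0Pr => e e0.
by have [m _] := H e 0%N e0; rewrite a0 b0 !mul0r !add0r.
Qed.

(** Continuity of the logarithm at exp q. *)
Lemma expR_inj_quant (q e : R) : 0 < e -> exists2 d : R, 0 < d &
  forall x, `|expR x - expR q| <= d -> `|x - q| <= e.
Proof.
move=> e0; have e1 : 0 < 1 + e by rewrite addr_gt0.
have q0 := expR_gt0 q.
pose r := e / (1 + e) / 2.
have r0 : 0 < r by rewrite !divr_gt0.
have re : r < e / (1 + e) by rewrite ltr_pdivrMr// ltr_pMr ?divr_gt0// ltr1n.
have re' : e / (1 + e) < e by rewrite ltr_pdivrMr// ltr_pMr// ltrDl.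
exists (expR q * r) => [|x]; first exact: mulr_gt0.
have -> : expR x - expR q = expR q * (expR (x - q) - 1).
  by rewrite mulrBr -expRD addrCA subrr addr0 mulr1.
rewrite normrM (gtr0_norm q0) ler_pM2l// => H.
move: (x - q) H => y; rewrite ler_norml => /andP[H1 H2].
rewrite ler_norml; apply/andP; split; last by have := expR_ge1Dx y; lra.
rewrite leNgt; apply/negP => ye.
have h : expR y <= (1 + e)^-1.
  apply: le_trans (_ : expR (- e) <= _); first by rewrite ler_expR ltW.
  by rewrite expRN lef_pV2 ?posrE ?expR_gt0// expR_ge1Dx.
have : 1 - (1 + e)^-1 = e / (1 + e) by field; rewrite gt_eqF.
lra.
Qed.

Lemma kernel_decay p (e : R) : 0 < e -> exists B : R, forall w, B <= sqnorm w ->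
  normc (kernel p w) * expR (- (sqnorm w / 4)) <= e.
Proof.
move=> e0; pose K := expR (1 / 2 * sqnorm p); have K0 : 0 < K := expR_gt0 _.
exists (8 * (K / e)) => w Bw.
apply: le_trans (_ : expR (1 / 8 * sqnorm w + 1 / 2 * sqnorm p) * expR (- (sqnorm w / 4)) <= _).
  by rewrite ler_wpM2r ?expR_ge0// normc_kernel_le.
have -> : expR (1 / 8 * sqnorm w + 1 / 2 * sqnorm p) * expR (- (sqnorm w / 4)) =
    K / expR (sqnorm w / 8).
  by rewrite -expRN /K -!expRD; congr expR; field.
rewrite ler_pdivrMr ?expR_gt0// -ler_pdivrMl// mulrC.
by have := expR_ge1Dx (sqnorm w / 8); lra.
Qed.

Section affine_symbol.
Variables (A : 'M[C]_n) (b : Cn) (S : (Cn -> C) -> (Cn -> C)).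
Let phi z := z *m A + b.
Let T := composition_operator phi.
Hypothesis bT : bounded_operator T.
Hypothesis aS : adjoint_of T S.

Let LT : linear_operator T := bT.1.
Let LS : linear_operator S := aS.1.1.
Let FT := LT.1.
Let FS := LS.1.
Let FK := @fock_kernel R n.

Lemma composition_kernel w : T (kernel w) = cexp (2^-1%:C * dotc b w) *: kernel (w *m adjmx A).
Proof.
apply/funext => z; rewrite -[LHS]/(kernel w (z *m A + b)).
rewrite -[RHS]/(cexp (2^-1%:C * dotc b w) * kernel (w *m adjmx A) z) /kernel.
by rewrite dotcDl dotc_adjmx mulrDr cexpD mulrC.
Qed.

Lemma kernelC z w : (kernel z w)^* = kernel w z.
Proof. by rewrite /kernel cexpJ conjcM conjcR -dotcC. Qed.

Lemma adjoint_eval f w : fock f -> S f w = fock_dot f (T (kernel w)).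
Proof.
move=> Ff; rewrite -(fock_dot_kernel w (FS Ff)).
by rewrite [LHS](fock_dotC (fL (FK w)) (fL (FS Ff))) -(aS.2 _ _ (FK w) Ff) -(fock_dotC (fL (FT (FK w))) (fL Ff)).
Qed.

Lemma adjoint_kernel w : S (kernel w) = kernel (phi w).
Proof.
apply/funext => z; rewrite (adjoint_eval z (FK w)).
rewrite (fock_dotC (fL (FT (FK z))) (fL (FK w))) (fock_dot_kernel _ (FT (FK z))).
by rewrite (_ : T (kernel z) w = kernel z (phi w))// kernelC.
Qed.

Let D f := S (T f) - T (S f).

(** The two terms are ||T K_w||^2 and ||S K_w||^2. *)
Lemma commutator_kernel_diag w : fock_dot (D (kernel w)) (kernel w) =
  (expR (Re (dotc b w) + sqnorm (w *m adjmx A) / 2) - expR (sqnorm (phi w) / 2))%:C.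
Proof.
have E1 : fock_dot (S (T (kernel w))) (kernel w) = (expR (Re (dotc b w) + sqnorm (w *m adjmx A) / 2))%:C.
  rewrite (fock_dot_kernel _ (FS (FT (FK w)))) (adjoint_eval w (FT (FK w))).
  rewrite (fock_dotff (fL (FT (FK w)))); congr (_%:C).
  rewrite composition_kernel (fock_normZ _ (fL (FK _))) normc_cexp fock_norm_kernel.
  by rewrite ReZ -expRD -expRM_natl; congr expR; field.
have E2 : fock_dot (T (S (kernel w))) (kernel w) = (expR (sqnorm (phi w) / 2))%:C.
  rewrite (aS.2 _ _ (FS (FK w)) (FK w)) (fock_dotff (fL (FS (FK w)))) adjoint_kernel.
  by rewrite fock_norm_kernel -expRM_natl; congr (expR _)%:C; field.
rewrite /D (fock_dotDl1 (fL (FS (FT (FK w)))) (fL (fockN (FT (FS (FK w))))) (fL (FK w))) E1.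
rewrite -scaleN1r (fock_dotZl _ (fL (FT (FS (FK w)))) (fL (FK w))) E2.
by apply: eq_ReIm; rewrite ?ReD ?ImD ?ReM ?ImM /=; ring.
Qed.

(** The image of a kernel under the commutator is a combination of two
    kernels, and K_p(v) exp(-|v|^2/4) tends to 0 as |v| grows. *)
Lemma commutator_kernel_decay w (e : R) : 0 < e -> exists B : R, forall v, B <= sqnorm v ->
  normc (D (kernel w) v) * expR (- (sqnorm v / 4)) <= e.
Proof.
move=> e0.
have E v : D (kernel w) v = cexp (2^-1%:C * dotc b w) * kernel (phi (w *m adjmx A)) v -
    cexp (2^-1%:C * dotc b (phi w)) * kernel (phi w *m adjmx A) v.
  rewrite /D (adjoint_kernel w) composition_kernel (linear_operatorZ _ LS (FK _)).
  by rewrite adjoint_kernel composition_kernel.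
set c1 := cexp _ in E; set c2 := cexp (_ * dotc b (phi w)) in E.
pose c := normc c1 + normc c2 + 1.
have n1 := normc_ge0 c1; have n2 := normc_ge0 c2.
have c0 : 0 < c by rewrite /c; lra.
have ec : 0 < e / c / 2 by rewrite !divr_gt0.
have [B1 H1] := kernel_decay (phi (w *m adjmx A)) ec.
have [B2 H2] := kernel_decay (phi w *m adjmx A) ec.
exists (Num.max B1 B2) => v; rewrite ge_max => /andP[/H1 h1 /H2 h2].
rewrite E; apply: le_trans (_ : (normc c1 * normc (kernel (phi (w *m adjmx A)) v) +
   normc c2 * normc (kernel (phi w *m adjmx A) v)) * expR (- (sqnorm v / 4)) <= _).
  rewrite ler_wpM2r ?expR_ge0//; apply: le_trans (normcD _ _) _.
  by rewrite normcNE !normcM.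
rewrite mulrDl -!mulrA.
apply: le_trans (_ : c * (e / c / 2) + c * (e / c / 2) <= _).
  have ck : normc c1 <= c by rewrite /c -addrA lerDl addr_ge0.
  have cl : normc c2 <= c by rewrite /c addrAC lerDr addr_ge0.
  by apply: lerD; apply: ler_pM => //; rewrite mulr_ge0 ?normc_ge0 ?expR_ge0.
have -> : c * (e / c / 2) + c * (e / c / 2) = e by field; rewrite gt_eqF.
exact: lexx.
Qed.

(** Along a subsequence the images D u_m of the normalized kernels converge to
    some g. For two indices k and l far enough in it, <D u_k, u_k> is close to
    <D u_l, u_k>, which is the value of D u_l at w_k up to the normalization
    of u_k. With l fixed this tends to 0, so that weak convergence of the
    normalized kernels is only used against combinations of kernels. *)
Lemma commutator_frequently_small (w : nat -> Cn) : compact_operator D ->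
  (forall B : R, exists N, forall m, (N <= m)%N -> B <= sqnorm (w m)) ->
  forall (e : R) (N : nat), 0 < e -> exists2 m, (N <= m)%N &
  `|expR (Re (dotc b (w m)) + sqnorm (w m *m adjmx A) / 2 - sqnorm (w m) / 2) -
    expR (sqnorm (phi (w m)) / 2 - sqnorm (w m) / 2)| <= e.
Proof.
move=> [LD cD] woo e N e0.
pose c m := expR (- (sqnorm (w m) / 4)).
pose u m := (c m)%:C *: kernel (w m).
have c0 m : 0 <= c m := expR_ge0 _.
have Fu m : fock (u m) by exact: fockZ.
have u1 m : fock_norm (u m) = 1.
  rewrite /u (fock_normZ _ (fL (FK _))) normc_real ger0_norm// fock_norm_kernel /c.
  by rewrite -expRD addNr expR0.
have [|s [hs [g Fg ug]]] := cD u Fu; first by exists 1 => m; rewrite u1.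
have e3 : 0 < e / 3 by rewrite divr_gt0.
move/cvgrPdist_le : ug => /(_ _ e3)[N1 _ HN1].
have close k : (N1 <= k)%N -> fock_norm (D (u (s k)) - g) <= e / 3.
  by move=> /HN1; rewrite /= sub0r normrN ger0_norm ?fock_norm_ge0.
pose l := s N1.
have Du m : D (u m) = (c m)%:C *: D (kernel (w m)) by exact: linear_operatorZ LD (FK _).
have [B HB] := commutator_kernel_decay (w l) e3.
have [N2 HN2] := woo B.
pose k := maxn N1 (maxn N N2).
have sk : (k <= s k)%N := strict_homo_ge hs k.
have Nk : (N <= s k)%N by apply: leq_trans sk; rewrite !leq_max leqnn orbT.
exists (s k); first exact: Nk.
have N1k : (N1 <= k)%N by rewrite leq_max leqnn.
have N2k : (N2 <= s k)%N by apply: leq_trans sk; rewrite !leq_max leqnn !orbT.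
have BW := HB _ (HN2 _ N2k).
set v := w (s k) in BW *.
have cm : c (s k) ^+ 2 = expR (- (sqnorm v / 2)).
  by rewrite /c -expRM_natl; congr expR; field.
have -> : expR (Re (dotc b v) + sqnorm (v *m adjmx A) / 2 - sqnorm v / 2) -
    expR (sqnorm (phi v) / 2 - sqnorm v / 2) = Re (fock_dot (D (u (s k))) (u (s k))).
  have FD := LD.1 _ (FK v).
  rewrite Du /u -/v (fock_dotZl _ (fL FD) (fL (fockZ _ (FK v)))) (fock_dotZr _ (fL FD) (fL (FK v))).
  rewrite conjcR commutator_kernel_diag -!realcM mulrA -expr2 cm /= mulrBr -!expRD.
  by congr (expR _ - expR _); ring.
apply: le_trans (Re_le_normc _) _.
have FDk m : fock (D (u m)) := LD.1 _ (Fu m).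
have F1 := fockB (FDk (s k)) Fg.
have F2 := fockB Fg (FDk l).
have decomp : D (u (s k)) = (D (u (s k)) - g) + ((g - D (u l)) + D (u l)).
  by rewrite subrK subrK.
rewrite decomp (fock_dotDl1 (fL F1) (fL (fockD F2 (FDk l))) (fL (Fu _))).
rewrite (fock_dotDl1 (fL F2) (fL (FDk l)) (fL (Fu _))).
have -> : e = e / 3 + (e / 3 + e / 3) by field.
apply: le_trans (normcD _ _) _; apply: lerD.
  apply: le_trans (fock_cauchy_schwarz (fL F1) (fL (Fu _))) _.
  by rewrite u1 mulr1; exact: close.
apply: le_trans (normcD _ _) _; apply: lerD.
  apply: le_trans (fock_cauchy_schwarz (fL F2) (fL (Fu _))) _.
  by rewrite u1 mulr1 fock_normBC//; exact: close.
rewrite /u -/v (fock_dotZr _ (fL (FDk l)) (fL (FK v))) (fock_dot_kernel _ (FDk l)) Du.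
rewrite -[(_ *: D _) v]/((c l)%:C * D (kernel (w l)) v) conjcR !normcM !normc_real !ger0_norm//.
apply: le_trans BW; rewrite [leRHS]mulrC -[expR _]/(c (s k)) ler_wpM2l//.
rewrite ler_piMl ?normc_ge0//.
by rewrite -expR0 ler_expR oppr_le0 divr_ge0// sqnorm_ge0.
Qed.

End affine_symbol.

End commutator.

(** * An isometric direction forces normality *)

Section conclusion.
Context (R : realType) (n : nat).
Local Notation C := R[i].
Local Notation Cn := 'rV[C]_n.
Local Notation sqnorm := (@sqnorm R n).
Implicit Types (f g h : Cn -> C) (z w : Cn).

(** At a zero x of the nonnegative form <x,x> - <x A, x A>, Cauchy-Schwarz
    makes the polar form vanish. *)
Lemma contraction_isometric_direction (A : 'M[C]_n) x z : (forall y, sqnorm (y *m A) <= sqnorm y) ->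
  sqnorm (x *m A) = sqnorm x -> Re (dotc (x *m A) (z *m A)) = Re (dotc x z).
Proof.
move=> HA xA.
pose B := Re (dotc z x) - Re (dotc (z *m A) (x *m A)).
have : B ^+ 2 <= (sqnorm z - sqnorm (z *m A)) * 0.
  apply: nonneg_quadratic => // t.
  have : 0 <= sqnorm (z + t%:C *: x) - sqnorm ((z + t%:C *: x) *m A) by rewrite subr_ge0.
  rewrite mulmxDl -scalemxAl !sqnormD !sqnormZ !dotcZr !conjcR !ReZ xA /B; lra.
rewrite mulr0 => B2; have /eqP : B ^+ 2 == 0 by rewrite eq_le B2 sqr_ge0.
move=> /eqP; rewrite sqrf_eq0 => /eqP; rewrite /B.
rewrite [in X in _ -> X]dotcC [in X in _ -> _ = X]dotcC !ReJ; lra.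
Qed.

(** |z A'|^2 = Re <z A' A, z>, which is at most (|z A'|^2 + |z|^2)/2. *)
Lemma adjmx_contraction (A : 'M[C]_n) z : (forall y, sqnorm (y *m A) <= sqnorm y) ->
  sqnorm (z *m adjmx A) <= sqnorm z.
Proof.
move=> HA; set y := z *m adjmx A.
have e : sqnorm y = Re (dotc (y *m A) z) by rewrite dotc_adjmx dotczz.
have h2 : 0 < 1 / 2 :> R by [].
have := le_trans (ler_norm _) (le_trans (Re_le_normc _) (normc_dotc_le (y *m A) z h2)).
have -> : (4 * (1 / 2))^-1 = 1 / 2 :> R by field.
have := HA y; rewrite -e; lra.
Qed.

Lemma dotc_inj z w : (forall y, dotc z y = dotc w y) -> z = w.
Proof.
move=> H; apply/eqP; rewrite -subr_eq0; apply/eqP/sqnorm_eq0.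
have := H (z - w); move/eqP; rewrite -subr_eq0 -dotcNl -dotcDl dotczz => /eqP.
by move=> /(congr1 Re).
Qed.

(** Polarization: two Hermitian forms with the same quadratic form are equal.
    *)
Lemma normal_matrix (A : 'M[C]_n) : (forall z, sqnorm (z *m A) = sqnorm (z *m adjmx A)) ->
  forall z, z *m adjmx A *m A = z *m A *m adjmx A.
Proof.
move=> H z; apply: dotc_inj => y.
have reE x w : Re (dotc (x *m A) (w *m A)) = Re (dotc (x *m adjmx A) (w *m adjmx A)).
  have := H (x + w); rewrite !mulmxDl !sqnormD !H; lra.
have E : dotc (z *m A) (y *m A) = dotc (z *m adjmx A) (y *m adjmx A).
  apply: eq_ReIm; first exact: reE.
  have := reE z ((0 +i* 1) *: y); rewrite -!scalemxAl !dotcZr !ReM ReJ ImJ /=; lra.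
by rewrite [LHS]dotc_adjmx -E [LHS]dotcC dotc_adjmx -dotcC.
Qed.

Lemma sqnorm_line_unbounded z y : z != 0 ->
  forall B : R, exists N, forall m : nat, (N <= m)%N -> B <= sqnorm (m%:R%:C *: z + y).
Proof.
move=> z0 B; set s := sqnorm z.
have s0 : 0 < s.
  rewrite lt_neqAle sqnorm_ge0 andbT eq_sym; apply: contra z0 => /eqP z0.
  by apply/eqP; exact: sqnorm_eq0.
pose x := 2 * (B + sqnorm y) / s.
exists (maxn 1 (Num.bound `|x|)) => m; rewrite geq_max => /andP[m1 mx].
have m1' : 1 <= m%:R :> R by rewrite ler1n.
have mx' : x <= m%:R.
  apply: le_trans (_ : (Num.bound `|x|)%:R <= _); last by rewrite ler_nat.
  exact: le_trans (ler_norm x) (ltW (archi_boundP (normr_ge0 x))).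
have h1 : 2 * (B + sqnorm y) <= m%:R * s by rewrite -ler_pdivrMr.
have h2 : m%:R * s <= m%:R ^+ 2 * s by rewrite ler_wpM2r ?(ltW s0)// expr2 ler_peMl.
rewrite sqnormD sqnormZ normc_real (@ger0_norm _ m%:R)// -/s.
have q : 0 < 1 / 4 :> R by [].
have := le_trans (ler_norm _) (le_trans (Re_le_normc _) (normc_dotc_le (- (m%:R%:C *: z)) y q)).
rewrite dotcNl ReN sqnormN sqnormZ normc_real (@ger0_norm _ m%:R)// -/s.
have -> : (4 * (1 / 4))^-1 = 1 :> R by field.
lra.
Qed.

Section isometric_direction.
Variables (A : 'M[C]_n) (b x : Cn) (S : (Cn -> C) -> (Cn -> C)).
Let phi z := z *m A + b.
Let T := composition_operator phi.
Hypothesis bT : bounded_operator T.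
Hypothesis aS : adjoint_of T S.
Hypothesis compactD : compact_operator (fun f => S (T f) - T (S f)).
Hypothesis contractA : forall z, sqnorm (z *m A) <= sqnorm z.
Hypothesis xA : sqnorm (x *m A) = sqnorm x.
Hypothesis xb : dotc (x *m A) b = 0.
Hypothesis x0 : x != 0.

Let line y (m : nat) := m%:R%:C *: x + y.

Let phi_line y m : sqnorm (phi (line y m)) - sqnorm (line y m) = sqnorm (y *m A + b) - sqnorm y.
Proof.
rewrite /phi /line mulmxDl -addrA -scalemxAl !sqnormD !sqnormZ xA !dotcZl !ReZ.
by rewrite dotcDr ReD (contraction_isometric_direction _ contractA xA) xb /=; ring.
Qed.

Let exponents_close y (e : R) N : 0 < e -> exists2 m, (N <= m)%N &
  `|(Re (dotc b (line y m)) + sqnorm (line y m *m adjmx A) / 2 - sqnorm (line y m) / 2) -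
    (sqnorm (y *m A + b) - sqnorm y) / 2| <= e.
Proof.
move=> e0; have [d d0 Hd] := expR_inj_quant ((sqnorm (y *m A + b) - sqnorm y) / 2) e0.
have [m Nm Hm] := commutator_frequently_small bT aS compactD (sqnorm_line_unbounded y x0) N d0.
exists m => //; apply: Hd; move: Hm; rewrite -/(line y m) -/(phi (line y m)).
by rewrite -mulrBl phi_line.
Qed.

(** With y = 0 the difference of the exponents is a polynomial in m with
    coefficients (|x A'|^2 - |x|^2)/2, Re <b,x> and - |b|^2/2. *)
Lemma isometric_direction_adjmx : sqnorm (x *m adjmx A) = sqnorm x /\ b = 0.
Proof.
have [|a1 a2 a3] := @polynomial_frequently_small R ((sqnorm (x *m adjmx A) - sqnorm x) / 2) (Re (dotc b x))
   (- (sqnorm b / 2)).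
  move=> e N e0; have [m Nm Hm] := exponents_close 0 N e0; exists m => //.
  apply: le_trans Hm; rewrite /line addr0 mul0mx add0r sqnorm0 subr0.
  rewrite -scalemxAl !sqnormZ normc_real (@ger0_norm _ m%:R)// dotcZr conjcR ReZ.
  by rewrite le_eqVlt; apply/orP; left; apply/eqP; congr `|_|; ring.
split; first lra.
apply: sqnorm_eq0; lra.
Qed.

(** Now b = 0, and x is an isometric direction for both A and A', so the two
    exponents do not depend on m: they are (|y A'|^2 - |y|^2)/2 and (|y A|^2 -
    |y|^2)/2. *)
Lemma isometric_direction_normal y : sqnorm (y *m A) = sqnorm (y *m adjmx A).
Proof.
have [xA' b0] := isometric_direction_adjmx.
have contractA' z := adjmx_contraction z contractA.
have [|_ _ a3] := @polynomial_frequently_small R 0 0 ((sqnorm (y *m adjmx A) - sqnorm (y *m A)) / 2).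
  move=> e N e0; have [m Nm Hm] := exponents_close y N e0; exists m => //.
  apply: le_trans Hm; rewrite !mul0r !add0r b0 -(scale0r (0 : Cn)) dotcZl mul0r scale0r addr0 add0r.
  rewrite /line mulmxDl -scalemxAl !sqnormD !sqnormZ xA' !dotcZl !ReZ.
  rewrite (contraction_isometric_direction _ contractA' xA').
  by rewrite le_eqVlt; apply/orP; left; apply/eqP; congr `|_|; ring.
lra.
Qed.

Lemma isometric_direction_normal_operator : normal_operator T.
Proof.
have [_ b0] := isometric_direction_adjmx.
exists S; first exact: aS.
have [FT _] := bT.1; have [FS _] := aS.1.1.
have TE f z : T f z = f (z *m A) by rewrite /T /composition_operator /= /phi b0 addr0.
have SE f z : fock f -> S f z = f (z *m adjmx A).
  move=> Ff; have FK := @fock_kernel R n.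
  rewrite (adjoint_eval bT aS z Ff) (composition_kernel A b z) b0.
  rewrite -(scale0r (0 : Cn)) dotcZl mul0r mulr0 cexp0 scale1r.
  exact: fock_dot_kernel.
move=> f Ff; apply/funext => z.
by rewrite (SE _ _ (FT _ Ff)) !TE (SE _ _ Ff) (normal_matrix isometric_direction_normal).
Qed.

End isometric_direction.

Theorem essentially_normal_dichotomy (phi : Cn -> Cn) : bounded_operator (composition_operator phi) ->
  essentially_normal (composition_operator phi) <->
  compact_operator (composition_operator phi) \/ normal_operator (composition_operator phi).
Proof.
move=> bphi; split=> [[S aS cD]|[cT|nT]]; last 2 first.
- exact: compact_essentially_normal.
- exact: normal_essentially_normal bphi.1 nT.
have [A [b phiE]] := composition_affine bphi.
have [c Hc] := composition_growth bphi.
have {phiE} phiE : phi = fun z => z *m A + b by apply/funext.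
subst phi.
have contractA := growth_contraction Hc.
have [strict|] := pselect (forall z : Cn, z != 0 -> sqnorm (z *m A) < sqnorm z).
  have [k [k0 k1 Hk]] := strict_contraction strict.
  have [k' [c' [k'1 Hk']]] := affine_growth b k0 k1 Hk.
  by left; exact: composition_compact bphi.1 k'1 Hk'.
move=> /existsNP[x /not_implyP[x0 /negP]]; rewrite -leNgt => xA.
have {}xA : sqnorm (x *m A) = sqnorm x by apply: le_anti; rewrite contractA xA.
right; exact: isometric_direction_normal_operator bphi aS cD contractA xA (growth_orthogonal Hc xA) x0.
Qed.

End conclusion.

Theorem theorem3p3 (R : realType) (n : nat) (phi : 'rV[R[i]]_n -> 'rV[R[i]]_n)
    (n_gt0 : (0 < n)%N) (phi_holomorphic : holomorphic phi)
    (phi_bounded : bounded_operator (composition_operator phi)) :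
  essentially_normal (composition_operator phi) <->
  compact_operator (composition_operator phi) \/
  normal_operator (composition_operator phi).
Proof. exact: essentially_normal_dichotomy. Qed.
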